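(* Let $q$ be a prime power, $n\ge 0$, and let $\gamma$ be an indifference graph on $[n]$. Then \[ \operatorname{Ind}^{\mathrm{GL}_{n}(\mathbb{F}_q)}_{\mathrm{UT}_{\gamma}}(\mathbbm{1}) = (q-1)^{n}\, \mathbf{p}_{\{1\}}^{-1}\big(X_{\gamma}(\mathbf{x}; q)\big), \] where $\mathbbm{1}$ is the trivial character of $\mathrm{UT}_\gamma$.
   Context: $\mathbb{F}_q$ is the field with $q$ elements, $\mathrm{GL}_n=\mathrm{GL}_n(\mathbb{F}_q)$, and $\mathrm{UT}_n\subseteq \mathrm{GL}_n$ is the group of unipotent upper triangular matrices. An indifference graph on $[n]=\{1,\dots,n\}$ is a simple undirected graph with vertex set $[n]$ and edge set $E(\gamma)$ such that whenever $\{i,l\}\in E(\gamma)$, every $\{j,k\}$ with $i\le j<k\le l$ is also in $E(\gamma)$. For such $\gamma$, $\mathrm{UT}_\gamma=\{g\in \mathrm{UT}_n : g_{i,j}=0 \text{ whenever } i<j,\ \{i,j\}\in E(\gamma)\}$ (a normal subgroup of $\mathrm{UT}_n$). An element of $\mathrm{GL}_n$ is unipotent if it is conjugate to an element of $\mathrm{UT}_n$; unipotent conjugacy classes are $O_\lambda$, $\lambda$ a partition of $n$, where $O_\lambda$ is the class of the block diagonal matrix of Jordan blocks with eigenvalue $1$ of sizes $\lambda_1,\lambda_2,\dots$. Let $\delta_\lambda$ be the indicator function of $O_\lambda$ and let $\mathsf{cf}^{\mathrm{uni}}_{\mathrm{supp}}(\mathrm{GL}_n)$ be the span of the $\delta_\lambda$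 (class functions vanishing off unipotent elements). $\mathbf{p}_{\{1\}}$ is the linear bijection from $\mathsf{cf}^{\mathrm{uni}}_{\mathrm{supp}}(\mathrm{GL}_n)$ onto the degree-$n$ symmetric functions (over $\mathbb{C}$) defined by $\delta_\lambda\mapsto q^{-n(\lambda)}P_\lambda(\mathbf{x};q^{-1})$, where $P_\lambda(\mathbf{x};t)$ is the Hall--Littlewood polynomial (Macdonald, Symmetric Functions and Hall Polynomials, III.2) and $n(\lambda)=\sum_{i}\binom{\lambda'_i}{2}$, $\lambda'$ the transpose partition. For a graph $\gamma$ on $[n]$, a proper coloring is a map $\kappa:[n]\to\mathbb{Z}_{>0}$ with $\kappa(i)\ne\kappa(j)$ for all $\{i,j\}\in E(\gamma)$; $\operatorname{asc}_\gamma(\kappa)=|\{\{i,j\}\in E(\gamma): i<j,\ \kappa(i)<\kappa(j)\}|$; the chromatic quasisymmetric function is $X_\gamma(\mathbf{x};t)=\sum_{\kappa \text{ proper}} t^{\operatorname{asc}_\gamma(\kappa)}x_{\kappa(1)}\cdots x_{\kappa(n)}$, and $X_\gamma(\mathbf{x};q)$ is its evaluation at $t=q$. *)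

(* Defs.v *)
From HB Require Import structures.
From mathcomp Require Import all_boot all_order all_algebra all_fingroup.
From mathcomp Require Import all_field all_character.
From mathcomp.multinomials Require Import mpoly.

Set Implicit Arguments.
Unset Strict Implicit.
Unset Printing Implicit Defensive.

Import GroupScope GRing.Theory.
Local Open Scope ring_scope.

(* MathComp's {'GL_n[F]} consists of matrices of size n.-1.+1, which is wrong *)
(* for n = 0; GL F n is the group of invertible n x n matrices for every n.   *)
Section GeneralLinearGroup.
Variables (F : finFieldType) (n : nat).

Record GL := MkGL { glval :> 'M[F]_n; _ : glval \in unitmx }.
HB.instance Definition _ := [isSub for glval].
HB.instance Definition _ := [Finite of GL by <:].

Lemma GL_mul_subproof (g h : GL) : glval g *m glval h \in unitmx.
Proof. by rewrite unitmx_mul (valP g) (valP h). Qed.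

Lemma GL_inv_subproof (g : GL) : invmx g \in unitmx.
Proof. by rewrite unitmx_inv (valP g). Qed.

Definition GL_mul (g h : GL) : GL := Sub (glval g *m glval h) (GL_mul_subproof g h).
Definition GL_one : GL := Sub 1%:M (unitmx1 F n).
Definition GL_inv (g : GL) : GL := Sub (invmx g) (GL_inv_subproof g).

Lemma GL_mulA : associative GL_mul.
Proof. by move=> g h k; apply: val_inj; rewrite /= mulmxA. Qed.

Lemma GL_mul1 : left_id GL_one GL_mul.
Proof. by move=> g; apply: val_inj; rewrite /= mul1mx. Qed.

Lemma GL_mulV : left_inverse GL_one GL_inv GL_mul.
Proof. by move=> g; apply: val_inj; rewrite /= mulVmx ?(valP g). Qed.

HB.instance Definition _ :=
  Finite_isGroup.Build GL GL_mulA GL_mul1 GL_mulV.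

End GeneralLinearGroup.

(* The vertex set [n] is 'I_n, hence 0-based. *)
Record indiff_graph (n : nat) := IndiffGraph {
  edge :> rel 'I_n;
  edge_sym : forall i j, edge i j = edge j i;
  edge_irr : forall i, edge i i = false;
  edge_indiff : forall i j k l : 'I_n,
    edge i l -> (i <= j)%N -> (j < k)%N -> (k <= l)%N -> edge j k
}.

Section UnipotentSubgroups.
Variables (F : finFieldType) (n : nat).

Definition UT_set : {set GL F n} :=
  [set g : GL F n | [forall i : 'I_n, g i i == 1] &&
     [forall i : 'I_n, forall j : 'I_n, (j < i)%N ==> (g i j == 0)]].

Definition UTg_set (gamma : indiff_graph n) : {set GL F n} :=
  [set g in UT_set | [forall i : 'I_n, forall j : 'I_n,
     ((i < j)%N && gamma i j) ==> (g i j == 0)]].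

Lemma UTgP (gamma : indiff_graph n) (g : GL F n) :
  reflect [/\ forall i, g i i = 1,
              forall i j : 'I_n, (j < i)%N -> g i j = 0 &
              forall i j : 'I_n, (i < j)%N -> gamma i j -> g i j = 0]
          (g \in UTg_set gamma).
Proof.
rewrite !inE; apply: (iffP andP) => [[/andP[/forallP d /forallP l] /forallP u]|].
  split=> [i|i j ji|i j ij e]; first exact/eqP/d.
    by move/forallP: (l i) => /(_ j); rewrite ji => /eqP.
  by move/forallP: (u i) => /(_ j); rewrite ij e => /eqP.
move=> [d l u]; split; first (apply/andP; split).
- by apply/forallP => i; rewrite d.
- by apply/forallP => i; apply/forallP => j; apply/implyP => /l ->.
- apply/forallP => i; apply/forallP => j; apply/implyP => /andP[ij e].
  by rewrite u.
Qed.

Lemma UTg_group_set (gamma : indiff_graph n) : group_set (UTg_set gamma).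
Proof.
apply/group_setP; split=> [|g h /UTgP[gd gl gu] /UTgP[hd hl hu]].
  apply/UTgP; split=> [i|i j ij|i j ij _]; rewrite mxE ?eqxx //.
    by case: eqP ij => // ->; rewrite ltnn.
  by case: eqP ij => // ->; rewrite ltnn.
apply/UTgP; split=> [i|i j ji|i j ij e]; rewrite mxE.
- rewrite (bigD1 i) //= gd hd mulr1 big1 ?addr0 // => k ki.
  have [ik|ki'|/val_inj E] := ltngtP i k; last by rewrite E eqxx in ki.
    by rewrite [X in _ * X]hl ?mulr0.
  by rewrite gl ?mul0r.
- apply: big1 => k _; have [ki|ik] := ltnP k i; first by rewrite gl ?mul0r.
  by rewrite [X in _ * X]hl ?mulr0 // (leq_trans ji ik).
- apply: big1 => k _.
  have [ki|ik|/val_inj ->] := ltngtP k i; first by rewrite gl ?mul0r.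
    have [jk|kj|/val_inj <-] := ltngtP j k; first by rewrite [X in _ * X]hl ?mulr0.
      by rewrite gu ?mul0r // (edge_indiff e) // ltnW.
    by rewrite gu ?mul0r.
  by rewrite [X in _ * X]hu ?mulr0.
Qed.

Canonical UTg (gamma : indiff_graph n) : {group GL F n} :=
  Group (UTg_group_set gamma).

End UnipotentSubgroups.

(* A partition of n is a weakly decreasing n-tuple of parts of sum n, padded *)
(* with zeros.                                                               *)
Definition is_partn n (s : n.-tuple 'I_n.+1) :=
  let s' := [seq val k | k <- s] in sorted geq s' && (sumn s' == n).

Record partn n := Partn { parts : n.-tuple 'I_n.+1; _ : is_partn parts }.
HB.instance Definition _ n := [isSub for @parts n].
HB.instance Definition _ n := [Finite of partn n by <:].

Section Partitions.
Variables (n : nat) (la : partn n).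

(* part i is the (i+1)-st part of la; it is 0 for i >= n. *)
Definition part (i : nat) : nat := nth 0%N [seq val k | k <- parts la] i.

Lemma sum_part : (\sum_(i < n) part i)%N = n.
Proof.
have /andP[_ /eqP sum_la] := valP la.
rewrite -[RHS]sum_la sumnE big_map (big_nth ord0) size_tuple big_mkord.
by apply: eq_bigr => i _; rewrite /part (nth_map ord0) // size_tuple.
Qed.

Definition part_len : nat := #|[set i : 'I_n | (0 < part i)%N]|.
Definition part_mult (k : nat) : nat := #|[set i : 'I_n | part i == k]|.
Definition part_conj (j : nat) : nat := #|[set i : 'I_n | (j < part i)%N]|.
Definition part_n : nat := (\sum_(j < n) 'C(part_conj j, 2))%N.

End Partitions.

Section UnipotentClasses.
Variables (F : finFieldType) (n : nat).

Definition jordan_block m : 'M[F]_m :=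
  \matrix_(i, j) ((i == j :> nat)%:R + (i.+1 == j :> nat)%:R).

Definition jordan_mx (la : partn n) : 'M[F]_n :=
  castmx (sum_part la, sum_part la)
         (\mxdiag_(i < n) jordan_block (part la i)).

Lemma jordan_block_unit m : jordan_block m \in unitmx.
Proof.
rewrite -unitmx_tr unitmxE det_trig; last first.
  apply/is_trig_mxP => i j ij; rewrite !mxE gtn_eqF // gtn_eqF ?addr0 //.
  exact: ltnW.
rewrite big1 ?unitr1 // => i _.
by rewrite !mxE eqxx gtn_eqF ?addr0.
Qed.

Lemma castmx_unit m m' (e : m = m') (A : 'M[F]_m) :
  A \in unitmx -> castmx (e, e) A \in unitmx.
Proof. by case: m' / e; rewrite castmx_id. Qed.

Lemma jordan_mx_unit la : jordan_mx la \in unitmx.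
Proof.
apply: castmx_unit; rewrite -row_free_unit /row_free rank_mxdiag; apply/eqP.
by apply: eq_bigr => i _; apply: mxrank_unit; apply: jordan_block_unit.
Qed.

Definition jordan (la : partn n) : GL F n := Sub (jordan_mx la) (jordan_mx_unit la).

(* 'CF(G) consists of the class functions with values in algC. *)
Definition delta (la : partn n) : 'CF([set: GL F n]) :=
  '1_(jordan la ^: [set: GL F n]).

Definition cf_uni : {vspace 'CF([set: GL F n])} :=
  <<[seq delta la | la : partn n]>>%VS.

End UnipotentClasses.

(* A symmetric function (an element of the inverse limit of the rings of     *)
(* symmetric polynomials in N variables) is given by its images in all the   *)
(* {mpoly K[N]}. Because of the denominators in the definition of            *)
(* Hall-Littlewood polynomials, these are computed in the fraction fields.   *)
Section SymmetricFunctions.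
Variable K : fieldType.

Definition mfrac N (p : {mpoly K[N]}) : {fraction {mpoly K[N]}} := FracField.tofrac p.

Definition fracC N (c : K) : {fraction {mpoly K[N]}} := mfrac c%:MP.
Definition fracX N (i : 'I_N) : {fraction {mpoly K[N]}} := mfrac 'X_i.

(* v_m(t) = prod_(i = 1)^m (1 - t^i) / (1 - t), with each factor expanded. *)
Definition HL_v (t : K) (m : nat) : K :=
  \prod_(1 <= i < m.+1) \sum_(0 <= j < i) t ^+ j.

(* The stabilising constant of la in N variables, where 0 occurs N - l(la)   *)
(* times as a part.                                                          *)
Definition HL_vpart n (la : partn n) N (t : K) : K :=
  HL_v t (N - part_len la) * \prod_(1 <= k < n.+1) HL_v t (part_mult la k).

Definition hall_littlewood n (la : partn n) (t : K) N :
    {fraction {mpoly K[N]}} :=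
  if (N < part_len la)%N then 0 else
  fracC N (HL_vpart la N t)^-1 *
  \sum_(w : 'S_N)
    (\prod_(i < N) fracX (w i) ^+ part la i) *
    (\prod_(i < N) \prod_(j < N | (i < j)%N)
       ((fracX (w i) - fracC N t * fracX (w j)) /
        (fracX (w i) - fracX (w j)))).

Definition proper_coloring n (gamma : indiff_graph n) N
    (kappa : {ffun 'I_n -> 'I_N}) : bool :=
  [forall i, forall j, gamma i j ==> (kappa i != kappa j)].

Definition asc n (gamma : indiff_graph n) N (kappa : {ffun 'I_n -> 'I_N}) : nat :=
  #|[set e : 'I_n * 'I_n |
      [&& (e.1 < e.2)%N, gamma e.1 e.2 & (kappa e.1 < kappa e.2)%N]]|.

Definition chromatic_qsym n (gamma : indiff_graph n) (t : K) N : {mpoly K[N]} :=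
  \sum_(kappa : {ffun 'I_n -> 'I_N} | proper_coloring gamma kappa)
    t ^+ asc gamma kappa *: \prod_(i < n) 'X_(kappa i).

End SymmetricFunctions.

Section JordanClasses.
Variables (F : finFieldType) (n : nat).

Definition shift_mx m (k : nat) : 'M[F]_m := \matrix_(i, j) ((i + k)%N == j :> nat)%:R.

Lemma jordan_blockE m : jordan_block F m = 1%:M + shift_mx m 1.
Proof. by apply/matrixP => i j; rewrite !mxE addn1. Qed.

Lemma mul_shift_mx m k : shift_mx m 1 *m shift_mx m k = shift_mx m k.+1.
Proof.
apply/matrixP => i j; rewrite !mxE.
have [im|im] := ltnP i.+1 m.
  rewrite (bigD1 (Ordinal im)) //= big1 => [|l nl].
    by rewrite !mxE /= addn1 eqxx mul1r addr0 addSn addnS.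
  rewrite !mxE addn1; case: eqP => [E|_]; last by rewrite mul0r.
  by case/eqP: nl; apply: val_inj.
rewrite big1 => [|l _].
  case: eqP => // E; have := ltn_ord j; rewrite -E addnS ltnNge.
  by rewrite (leq_trans im) // ltnS leq_addr.
rewrite !mxE addn1; case: eqP => [E|_]; last by rewrite mul0r.
by have := ltn_ord l; rewrite -E ltnNge im.
Qed.

Lemma rank_shift_mx m k : \rank (shift_mx m k) = (m - k)%N.
Proof.
apply/eqP; rewrite eqn_leq; apply/andP; split.
  have -> : shift_mx m k = pid_mx (m - k) *m shift_mx m k.
    apply/matrixP => i j; rewrite [RHS]mxE (bigD1 i) //= big1 => [|l nl].
      rewrite !mxE eqxx addr0 /=; case: ltnP => [_|im]; first by rewrite mul1r.
      rewrite mul0r; case: eqP => // E; have := ltn_ord j.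
      by rewrite -E ltnNge addnC -leq_subLR im.
    rewrite mxE; have -> : (i == l :> nat) = false.
      by apply: contraNF nl => /eqP/val_inj ->.
    by rewrite mul0r.
  apply: leq_trans (mxrankM_maxl _ _) _.
  by rewrite rank_pid_mx // leq_subr.
have E : shift_mx m k *m (shift_mx m k)^T = pid_mx (m - k).
  apply/matrixP => i j; rewrite !mxE; case: ltnP => [im|im].
    have im' : (i + k < m)%N by rewrite addnC -ltn_subRL.
    rewrite (bigD1 (Ordinal im')) //= big1 => [|l nl].
      by rewrite !mxE /= eqxx mul1r addr0 andbT eqn_add2r eq_sym.
    rewrite !mxE; case: eqP => [E|_]; last by rewrite mul0r.
    by case/eqP: nl; apply: val_inj.
  rewrite andbF big1 // => l _; rewrite !mxE; case: eqP => [E|_]; last by rewrite mul0r.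
  by have := ltn_ord l; rewrite -E ltnNge addnC -leq_subLR im.
by rewrite -{1}(@rank_pid_mx F m m (m - k)) ?leq_subr // -E mxrankM_maxl.
Qed.

Definition npow (A : 'M[F]_n) k := iter k (mulmx (A - 1%:M)) 1%:M.

Lemma rank_npow (la : partn n) k :
  \rank (npow (jordan_mx F la) k) = (\sum_(i < n) (part la i - k))%N.
Proof.
have -> : npow (jordan_mx F la) k =
    castmx (sum_part la, sum_part la) (\mxdiag_(i < n) shift_mx (part la i) k).
  have cast m (e : m = n) (A B : 'M[F]_m) : castmx (e, e) (A *m B) = castmx (e, e) A *m castmx (e, e) B.
    by case: n / e; rewrite !castmx_id.
  have castB m (e : m = n) (A B : 'M[F]_m) : castmx (e, e) (A - B) = castmx (e, e) A - castmx (e, e) B.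
    by case: n / e; rewrite !castmx_id.
  have cast1 m (e : m = n) : 1%:M = castmx (e, e) 1%:M :> 'M[F]_n.
    by case: n / e; rewrite !castmx_id.
  elim: k => [|k IHk] /=.
    rewrite /npow /= (cast1 _ (sum_part la)) -mxdiagZ; congr castmx.
    by apply: eq_mxdiag => i; apply/matrixP => a b; rewrite !mxE addn0.
  transitivity ((jordan_mx F la - 1%:M) *m npow (jordan_mx F la) k); first by [].
  rewrite IHk {1}(cast1 _ (sum_part la)) /jordan_mx.
  rewrite -castB -cast; congr castmx.
  rewrite -mxdiagZ -mxdiagB mul_mxdiag_mxblock; apply: eq_mxblock => i j.
  rewrite jordan_blockE addrAC subrr add0r.
  case: (eqVneq i j) => [E|ne]; last by rewrite ?conform_mx_id ?mulmx0.
  by case: j / E; rewrite !conform_mx_id mul_shift_mx.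
have -> m (e : m = n) (A : 'M[F]_m) : \rank (castmx (e, e) A) = \rank A.
  by case: n / e; rewrite castmx_id.
by rewrite rank_mxdiag; apply: eq_bigr => i _; rewrite rank_shift_mx.
Qed.

Lemma rank_npowJ (g h : GL F n) k : \rank (npow (g ^ h)%g k) = \rank (npow g k).
Proof.
have hu : (h : 'M_n) \in unitmx by exact: valP h.
have -> : npow (g ^ h)%g k = invmx h *m (npow g k *m h).
  elim: k => [|k IHk]; first by rewrite /npow /= mul1mx mulVmx.
  transitivity ((glval (g ^ h)%g - 1%:M) *m npow (g ^ h)%g k); first by [].
  rewrite IHk.
  have -> : glval (g ^ h)%g - 1%:M = invmx h *m (glval g - 1%:M) *m h.
    by rewrite mulmxBr mulmxBl mulmx1 mulVmx //= mulmxA.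
  by rewrite !mulmxA mulmxK // -!mulmxA.
rewrite eqmxMfull ?mxrankMfree ?row_free_unit ?row_full_unit //.
by rewrite unitmx_inv.
Qed.

Lemma partn_inj (la mu : partn n) :
  (forall k, \sum_(i < n) (part la i - k) = \sum_(i < n) (part mu i - k))%N -> la = mu.
Proof.
move=> E; apply: val_inj; apply: val_inj; apply: (inj_map val_inj) => /=.
have /andP[sla _] := valP la; have /andP[smu _] := valP mu.
apply: (sorted_eq _ _ sla smu).
- by move=> a b c ab bc; apply: leq_trans bc ab.
- by move=> a b /andP[ab ba]; apply/eqP; rewrite eqn_leq; apply/andP; split; [exact: ba|exact: ab].
have sz (nu : partn n) : size [seq val x | x <- parts nu] = n.
  by rewrite size_map size_tuple.
have cnt (nu : partn n) k : (count (fun x => k < x) [seq val x | x <- parts nu] +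
    \sum_(i < n) (part nu i - k.+1) = \sum_(i < n) (part nu i - k))%N.
  rewrite -sum1_count (big_nth 0%N) sz big_mkord [X in (X + _)%N]big_mkcond -big_split.
  apply: eq_bigr => i _ /=; rewrite -/(part nu i) subnS.
  case: ltnP => [ki|]; first by rewrite add1n prednK // subn_gt0.
  by rewrite -subn_eq0 => /eqP ->.
have cE k : count (fun x => k < x)%N [seq val x | x <- parts la] =
            count (fun x => k < x)%N [seq val x | x <- parts mu].
  by apply/eqP; rewrite -(eqn_add2r (\sum_(i < n) (part la i - k.+1))) cnt E E cnt.
have eC k (s : seq nat) : (count_mem k.+1 s + count (fun x => k.+1 < x) s = count (fun x => k < x) s)%N.
  elim: s => //= x s IHs; rewrite addnACA IHs; congr addn.
  by case: (ltngtP x k.+1).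
have eC0 (s : seq nat) : (count_mem 0 s + count (fun x => 0 < x) s = size s)%N.
  elim: s => //= x s IHs; rewrite addnACA IHs; by case: x.
apply/allP => k _ /=; apply/eqP; case: k => [|k].
  by apply/eqP; rewrite -(eqn_add2r (count (fun x => 0 < x)%N [seq val x | x <- parts la])) eC0 cE eC0 !sz.
by apply/eqP; rewrite -(eqn_add2r (count (fun x => k.+1 < x)%N [seq val x | x <- parts la])) eC !cE eC.
Qed.

Lemma delta_jordan (la mu : partn n) : delta F la (jordan F mu) = (mu == la)%:R.
Proof.
rewrite /delta cfun_classE inE /=; congr (nat_of_bool _)%:R.
apply/imsetP/eqP => [[h _ E]|->]; last by exists 1%g; rewrite ?conjg1 ?inE.
by apply: partn_inj => k; have := rank_npowJ (jordan F la) h k; rewrite -E /= !rank_npow.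
Qed.
End JordanClasses.

(* The linear map p_{1}, written on all class functions: on the span of the  *)
(* delta la, phi (jordan F la) is the coordinate of phi along delta la.      *)
(* Linearity is p1_linear, and the value at delta la is p1_delta.            *)
Definition p1 (F : finFieldType) n (phi : 'CF([set: GL F n])) N :
    {fraction {mpoly algC[N]}} :=
  let q : algC := #|F|%:R in
  \sum_(la : partn n)
    fracC N (phi (jordan F la) * q ^- part_n la) * hall_littlewood la q^-1 N.

Lemma p1_linear (F : finFieldType) n (a : algC)
    (phi psi : 'CF([set: GL F n])) N :
  p1 (a *: phi + psi) N = fracC N a * p1 phi N + p1 psi N.
Proof.
rewrite /p1 mulr_sumr -big_split; apply: eq_bigr => la _ /=.
rewrite !cfunE [fracC N a * _]mulrA -[RHS]mulrDl; congr (_ * _).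
by rewrite mulrDl -mulrA /fracC /mfrac mpolyCD mpolyCM tofracD tofracM.
Qed.

Lemma p1_delta (F : finFieldType) n (la : partn n) N :
  let q : algC := #|F|%:R in
  p1 (delta F la) N = fracC N (q ^- part_n la) * hall_littlewood la q^-1 N.
Proof.
move=> q; rewrite /p1 -/q (bigD1 la) //= big1 => [|mu ne]; rewrite delta_jordan.
  by rewrite eqxx mul1r addr0.
by rewrite (negPf ne) mul0r /fracC /mfrac mpolyC0 tofrac0 mul0r.
Qed.

(* Main.v *)
(** Put [Y := (u - 1)^T] for [u] in [UT_gamma]. Both sides are sums over the
    pairs formed by such a [Y] and [N] vectors generating [F^n] as an
    [F[Y]]-module, weighted by [\prod_i y_i ^ dim (V_(i+1) / V_i)], where [V_i] is
    the submodule generated by the first [i] vectors and [y_i] is [x_i] divided by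
    a power of [q].

    For a single nilpotent [Y] of Jordan type [la], the weighted sum is a multiple
    of the Hall-Littlewood polynomial of [la]. This is first proved on average,
    for [Y] running over all the extensions of a fixed [Y'] by an [m]-dimensional
    space that is killed: on both sides this multiplies the value at [Y'] by the
    elementary symmetric polynomial [e_m], for symmetrized sums because the Pieri
    rule adds vertical strips to the exponents, which adjacent transpositions
    straighten to partitions. The extensions whose kernel is exactly
    [m]-dimensional are all conjugate and the others have smaller rank, so that
    the identity for each [Y] follows by induction.

    When [Y] varies over all strictly lower triangular matrices with the zeros
    prescribed by [gamma], the pairs are instead sorted by the map [kappa] that
    records for each [j] the first [V_i] in which the [j]-th coordinate is a
    pivot. The maps that occur are exactly the proper colorings, and the number
    of pairs with given [kappa] is computed one coordinate at a time.

    Uniqueness holds because the symmetrized sums of the partitions of [n] in [n]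
    variables span the products of elementary symmetric polynomials (Pieri again),
    and are as numerous as these, hence linearly independent. *)

Require Import Defs.
From mathcomp Require Import all_boot all_order all_algebra all_fingroup.
From mathcomp Require Import all_field all_character.
From mathcomp.multinomials Require Import mpoly.
From mathcomp Require Import ring zify.

Set Implicit Arguments.
Unset Strict Implicit.
Unset Printing Implicit Defensive.

Import GroupScope GRing.Theory.
Local Open Scope ring_scope.

(** * Counting matrices over a finite field *)

(** In the Frobenius formula, the number of [y] that conjugate a Jordan matrix to a given [u] is a
    centralizer order. Its factors cancel the constants of the Hall-Littlewood polynomial and of the
    characteristic map, so that only a flag sum remains for each [u]. Averaging over extensions
    makes this sum accessible: the linear relations between the generators of [V_i] in the quotient
    form a space of dimension [i], whatever the matrix and the generators are. A uniformly random
    extension therefore acts on a fixed chain like a uniformly random matrix, of which only the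
    pivot rows matter. The same relations, for extensions by one dimension, give the coloring count.
    The transpose in [Y] makes the first coordinate the one that is killed, so that passing to the
    quotient deletes the first vertex of [gamma]. The count then involves descents; reversing the
    variables turns them into ascents and does not affect the symmetric side. The factor [(q - 1)^n]
    comes from the coloring count, one [q - 1] for each vertex. *)

Section MatrixSums.
Variables (R : finType) (V : nmodType).

Lemma sum_col_mx m1 m2 n (f : 'M[R]_(m1 + m2, n) -> V) :
  \sum_C f C = \sum_A \sum_B f (col_mx A B).
Proof.
rewrite pair_big /= (reindex (fun AB : 'M[R]_(m1, n) * 'M_(m2, n) => col_mx AB.1 AB.2)) //=.
exists (fun C => (usubmx C, dsubmx C)) => [[A B] _|C _] /=.
  by rewrite col_mxKu col_mxKd.
by rewrite vsubmxK.
Qed.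

Lemma sum_row_mx m n1 n2 (f : 'M[R]_(m, n1 + n2) -> V) :
  \sum_C f C = \sum_A \sum_B f (row_mx A B).
Proof.
rewrite pair_big /= (reindex (fun AB : 'M[R]_(m, n1) * 'M_(m, n2) => row_mx AB.1 AB.2)) //=.
exists (fun C => (lsubmx C, rsubmx C)) => [[A B] _|C _] /=.
  by rewrite row_mxKl row_mxKr.
by rewrite hsubmxK.
Qed.
End MatrixSums.

Section Counting.
Variable F : finFieldType.
Implicit Types m n p : nat.

Lemma card_submx m n p (A : 'M[F]_(p, n)) :
  #|[set Z : 'M[F]_(m, n) | (Z <= A)%MS]| = (#|F| ^ (m * \rank A))%N.
Proof.
rewrite -card_mx -cardsT -(card_imset _ (row_free_inj (row_base_free A))).
apply: eq_card => Z; rewrite inE; apply/idP/imsetP => [|[X _ ->]].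
  by rewrite -(eq_row_base A) => /submxP[X ->]; exists X.
by rewrite (submx_trans (submxMl _ _)) // eq_row_base.
Qed.

Lemma card_mulmx_eq m n p (S : 'M[F]_(p, n)) (z0 : 'M[F]_(n, m)) :
  #|[set z | S *m z == S *m z0]| = (#|F| ^ (m * (n - \rank S)))%N.
Proof.
rewrite -mxrank_tr -mxrank_ker -card_submx.
have inj : injective (fun z : 'M[F]_(n, m) => (z - z0)^T).
  by move=> x y /trmx_inj /addIr.
rewrite -(card_imset _ inj); apply: eq_card => Z; rewrite !inE sub_kermx.
rewrite -[Z in RHS]trmxK -trmx_mul -trmx0 (inj_eq (@trmx_inj _ _ _)).
apply/imsetP/eqP => [[z]|e].
  by rewrite inE => /eqP e ->; rewrite trmxK mulmxBr e subrr.
exists (Z^T + z0); last by rewrite addrK trmxK.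
by rewrite inE mulmxDr e add0r.
Qed.

(** The left kernel of the block row is the intersection of the two left kernels; the second term is
    rank-nullity for [B] on [kermx C]. *)
Lemma rank_row_mx m n p (B : 'M[F]_(m, n)) (C : 'M[F]_(m, p)) :
  \rank (row_mx B C) = (\rank C + \rank (kermx C *m B))%N.
Proof.
have := mxrank_mul_ker (kermx C) B; rewrite mxrank_ker.
have -> : \rank (kermx C :&: kermx B) = (m - \rank (row_mx B C))%N.
  rewrite -mxrank_ker; apply/eqmx_rank/andP; split; last first.
    rewrite sub_capmx !sub_kermx; have := mulmx_ker (row_mx B C).
    rewrite mul_mx_row -[X in _ = X]row_mx0 => /eq_row_mx[e1 e2]. by rewrite e1 e2 !eqxx.
  have /sub_kermxP e1 := capmxSl (kermx C) (kermx B).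
  have /sub_kermxP e2 := capmxSr (kermx C) (kermx B).
  by rewrite sub_kermx mul_mx_row e1 e2 row_mx0.
have := rank_leq_row (row_mx B C); have := rank_leq_row C; lia.
Qed.

Lemma rank_col_mx m1 m2 n (A : 'M[F]_(m1, n)) (B : 'M[F]_(m2, n)) :
  \rank (col_mx A B) = \rank (A + B)%MS.
Proof. by rewrite addsmxE. Qed.

Lemma rank_col_row m n (A : 'M[F]_(m, n)) (b : 'rV[F]_n) :
  \rank (col_mx b A) = (\rank A + ~~ (b <= A)%MS)%N.
Proof.
rewrite rank_col_mx; have [bA|nbA] /= := boolP (b <= A)%MS.
  by rewrite addn0 (addsmx_idPr bA).
apply/eqP; rewrite eqn_leq; apply/andP; split.
  rewrite addnC; apply: leq_trans (mxrank_adds_leqif _ _) _.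
  by rewrite leq_add2r rank_leq_row.
rewrite addn1 ltn_neqAle mxrankS ?addsmxSr // andbT.
rewrite (mxrank_leqif_sup (addsmxSr b A)).2.
by apply: contra nbA; apply: submx_trans (addsmxSl b A).
Qed.

Section InRing.
Variable K : comNzRingType.
Local Notation q := (#|F|%:R : K).

Lemma sum_rV_submx m n (A : 'M[F]_(m, n)) (u v : K) :
  \sum_(b : 'rV_n) (if (b <= A)%MS then u else v) =
  q ^+ \rank A * u + (q ^+ n - q ^+ \rank A) * v.
Proof.
have cA : \sum_(b : 'rV_n | (b <= A)%MS) 1 = q ^+ \rank A.
  by rewrite sumr_const -cardsE card_submx mul1n natrX.
have cT : \sum_(b : 'rV[F]_n) 1 = q ^+ n.
  by rewrite sumr_const -[#|_|]/#|{: 'rV_n}| card_mx mul1n natrX.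
rewrite (bigID (fun b : 'rV_n => (b <= A)%MS)) /=.
rewrite (eq_bigr (fun _ => 1 * u)) => [|b ->]; last by rewrite mul1r.
rewrite [X in _ + X](eq_bigr (fun _ => 1 * v)) => [|b /negPf->]; last by rewrite mul1r.
rewrite -!mulr_suml cA; congr (_ + _ * _); rewrite -cT -cA.
by rewrite [X in _ = X - _](bigID (fun b : 'rV_n => (b <= A)%MS)) /= addrAC subrr add0r.
Qed.

(** Modulo the row space of [A] the rows of [B] have to span a space of dimension [n - \rank A], and
    each of them has [q ^+ \rank A] lifts. The induction moves the rows of [B] to [A] one at a
    time. *)
Lemma card_row_full_col_mx p m n (A : 'M[F]_(m, n)) :
  \sum_(B : 'M_(p, n) | row_full (col_mx A B)) 1 =
  q ^+ (p * \rank A) * \prod_(j < n - \rank A) (q ^+ p - q ^+ j).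
Proof.
elim: p m A => [|p IH] m A; rewrite big_mkcond.
  rewrite mul0n mul1r (big_pred1 0) /= => [|B]; last by rewrite /= [B]flatmx0 eqxx.
  rewrite /row_full flatmx0 rank_col_mx0; have := rank_leq_col A.
  rewrite leq_eqVlt; case: eqP => [->|_] /=; first by rewrite subnn big_ord0.
  by rewrite -subn_gt0; case: (n - _)%N => // s _; rewrite big_ord_recl subrr mul0r.
rewrite (sum_col_mx (m1 := 1)) /=.
transitivity (\sum_(b : 'rV_n) if (b <= A)%MS then
   q ^+ (p * \rank A) * \prod_(j < n - \rank A) (q ^+ p - q ^+ j) else
   q ^+ (p * (\rank A).+1) * \prod_(j < n - (\rank A).+1) (q ^+ p - q ^+ j)).
  apply: eq_bigr => b _.
  transitivity (\sum_(B : 'M_(p, n) | row_full (col_mx (col_mx b A) B)) (1 : K)).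
    rewrite [RHS]big_mkcond; apply: eq_bigr => B _.
    rewrite /row_full !rank_col_mx -(adds_eqmx (eqmx_refl A) (addsmxE b B)).
    by rewrite -(adds_eqmx (addsmxE b A) (eqmx_refl B)) addsmxA (addsmxC b).
  by rewrite IH rank_col_row; case: ifP => /= _; rewrite ?addn0 ?addn1.
rewrite sum_rV_submx; have := rank_leq_col A; move: (\rank A) => r le_rn.
have [s ->] : exists s, n = (r + s)%N by exists (n - r)%N; rewrite subnKC.
rewrite addKn mulSn; case: s => [|s].
  by rewrite addn0 subrr mul0r addr0 !big_ord0 !mulr1 -exprD.
have -> : (r + s.+1 - r.+1 = s)%N by lia.
rewrite [in LHS]big_ord_recr [in RHS]big_ord_recl /=.
have -> : \prod_(i < s) (q ^+ p.+1 - q ^+ bump 0 i) = q ^+ s * \prod_(i < s) (q ^+ p - q ^+ i).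
  have -> : q ^+ s = \prod_(i < s) q by rewrite prodr_const card_ord.
  rewrite -big_split /=; apply: eq_bigr => i _.
  by rewrite /bump /= add1n !exprS mulrBr.
rewrite mulnS !exprD !exprS; set P := \prod_(i < s) _; set a := q ^+ p; set b := q ^+ r; set c := q ^+ (p * r); set d := q ^+ s.
ring.
Qed.

Lemma card_row_free_col_mx p l n (A : 'M[F]_(l, n)) :
  row_free A ->
  \sum_(B : 'M_(p, n) | row_free (col_mx A B)) 1 =
  \prod_(l <= j < l + p) (q ^+ n - q ^+ j).
Proof.
elim: p l A => [|p IH] l A fA; rewrite big_mkcond.
  rewrite [RHS]big_geq ?addn0 // (big_pred1 0) /= => [|B]; last by rewrite /= [B]flatmx0 eqxx.
  by rewrite /row_free rank_col_mx0 (eqP fA) addn0 eqxx.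
rewrite (sum_col_mx (m1 := 1)) /= [RHS]big_ltn ?addnS ?ltnS ?leq_addr //.
transitivity (\sum_(b : 'rV_n) if (b <= A)%MS then 0 else
   \prod_(l.+1 <= j < l.+1 + p) (q ^+ n - q ^+ j)).
  apply: eq_bigr => b _; rewrite -big_mkcond /=.
  have eB (B : 'M_(p, n)) : row_free (col_mx A (col_mx b B)) = row_free (col_mx (col_mx b A) B).
    rewrite /row_free !rank_col_mx -(adds_eqmx (eqmx_refl A) (addsmxE b B)).
    by rewrite -(adds_eqmx (addsmxE b A) (eqmx_refl B)) addsmxA (addsmxC b) addnA addn1.
  have rb := rank_col_row A b; rewrite (eqP fA) in rb.
  case: ifPn rb => [bA|nbA] rb /=.
    apply: big1 => B; rewrite eB /row_free rank_col_mx => /eqP e.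
    have := (mxrank_adds_leqif (col_mx b A) B).1; rewrite e rb addn0.
    by rewrite add1n; have := rank_leq_row B; lia.
  rewrite (eq_bigl _ _ eB) IH ?add1n // /row_free rb addn1 //.
by rewrite sum_rV_submx mulr0 add0r (eqP fA) addSnnS.
Qed.

(** A change of basis makes [al] consist of the first [l] unit vectors, so that [be] prescribes the
    first [l] rows of an invertible matrix. *)
Lemma card_unitmx_mul l m (al be : 'M[F]_(l, m)) :
  row_free al -> row_free be ->
  \sum_(a : 'M_m | (a \in unitmx) && (al *m a == be)) 1 =
  \prod_(l <= j < m) (q ^+ m - q ^+ j).
Proof.
move=> fal fbe; have lm : (l <= m)%N by rewrite -(eqP fal) rank_leq_col.
have [s e] : exists s, m = (l + s)%N by exists (m - l)%N; rewrite subnKC.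
subst m; rewrite -(card_row_free_col_mx s fbe).
have [P uP eP] : exists2 P, P \in unitmx & al = (row_mx 1%:M 0 : 'M_(l, l + s)) *m P.
  have eal : (row_mx 1%:M 0 : 'M_(l, l + s)) *m col_mx al (0 : 'M_(s, _)) = al.
    by rewrite mul_row_col mul1mx mul0mx addr0.
  have [|P uP eP] := @complete_unitmx _ _ _ (row_mx 1%:M 0 : 'M_(l, l + s)) (col_mx al (0 : 'M_(s, _))).
    by rewrite eal rank_row_mx0 mxrank1 (eqP fal).
  by exists P; rewrite // -eP eal.
rewrite (reindex (mulmx (invmx P))) /=; last first.
  by exists (mulmx P) => a _; rewrite ?mulKmx ?mulKVmx.
rewrite big_mkcond sum_col_mx [RHS]big_mkcond (bigD1 be) //= [X in _ + X]big1 => [|A nA].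
  rewrite addr0; apply: eq_bigr => B _.
  rewrite unitmx_mul unitmx_inv uP /= eP -mulmxA mulKVmx // mul_row_col mul1mx mul0mx addr0.
  by rewrite eqxx andbT row_free_unit.
apply: big1 => B _; rewrite eP -mulmxA mulKVmx // mul_row_col mul1mx mul0mx addr0.
by rewrite (negPf nA) andbF.
Qed.
End InRing.

(** * Bases adapted to a chain of subspaces, and pivot rows *)

Definition rowsmx n (f : nat -> 'rV[F]_n) k := \matrix_(i < k) f i.

Lemma adapted_rows n B (U : nat -> 'M[F]_n) :
  (forall k, (k < B)%N -> (U k <= U k.+1)%MS) ->
  exists f, forall k, (k <= B)%N -> (rowsmx f (\rank (U k)) :=: U k)%MS.
Proof.
elim: B => [|B IH] Uinc.
  exists (fun i => if insub i is Some j then row j (row_base (U 0%N)) else 0) => k.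
  rewrite leqn0 => /eqP->; apply: eqmx_trans (eq_row_base _).
  rewrite [X in (X :=: _)%MS](_ : _ = row_base (U 0%N)) //.
  by apply/row_matrixP => i; rewrite rowK valK.
have {IH}[|f IH] := IH; first by move=> k kB; apply: Uinc; apply: ltnW.
pose d := \rank (U B); pose W := (U B.+1 :\: U B)%MS.
exists (fun i => if (i < d)%N then f i else
          if insub (i - d)%N is Some j then row j (row_base W) else 0) => k.
rewrite leq_eqVlt ltnS => /orP[/eqP->|kB]; last first.
  rewrite [X in (X :=: _)%MS](_ : _ = rowsmx f (\rank (U k))); first exact: IH.
  apply/row_matrixP => i; rewrite !rowK; case: ifP => // /negP[].
  apply: leq_trans (ltn_ord i) _; apply: mxrankS.
  elim: B k kB Uinc {IH d W i} => [|B IH] k.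
    by rewrite leqn0 => /eqP->.
  rewrite leq_eqVlt => /orP[/eqP->//|kB] Uinc.
  by apply: submx_trans (IH _ kB _) (Uinc _ _) => // j jB; apply: Uinc; apply: ltnW.
have UB : (U B <= U B.+1)%MS by apply: Uinc.
have eB := addsmx_diff_cap_eq (U B.+1) (U B).
have cB : (U B.+1 :&: U B :=: U B)%MS by apply: capmx_idPr.
have -> : \rank (U B.+1) = (d + \rank W)%N.
  by rewrite -(mxrank_cap_compl (U B.+1) (U B)) (cB.1).
rewrite [X in (X :=: _)%MS](_ : _ = col_mx (rowsmx f d) (row_base W)).
  apply: eqmx_trans _ eB; rewrite addsmxC; apply: eqmx_trans (eqmx_sym (addsmxE _ _)) _.
  apply: adds_eqmx (eq_row_base _); apply: eqmx_trans (IH _ _) (eqmx_sym cB) => //.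
apply/row_matrixP => i; rewrite rowK; case: (split_ordP i) => j ->.
  by rewrite /= rowKu rowK.
have -> : (rshift d j - d)%N = j by rewrite /= addKn.
by rewrite valK rowKd.
Qed.

(** Rows are zeroed instead of dropped, so that the type does not depend on [k]. *)
Definition toprows m n k (C : 'M[F]_(m, n)) : 'M_(m, n) := (pid_mx k : 'M_m) *m C.

Lemma toprowsE m n k (C : 'M[F]_(m, n)) i j :
  toprows k C i j = if (i < k)%N then C i j else 0.
Proof.
rewrite mxE (bigD1 i) //= big1 ?addr0 => [|l nl]; last first.
  by rewrite mxE eq_sym (negPf nl : (l == i :> nat) = false) mul0r.
by rewrite mxE eqxx /=; case: ifP; rewrite ?mul1r ?mul0r.
Qed.

Lemma adapted_basis n B (U : nat -> 'M[F]_n) :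
  (forall k, (k < B)%N -> (U k <= U k.+1)%MS) ->
  exists2 Q, Q \in unitmx & forall k, (k <= B)%N -> (toprows (\rank (U k)) Q :=: U k)%MS.
Proof.
(* The full space is appended to the chain so that the adapted rows form a basis. *)
move=> Uinc; pose U' k := if (k <= B)%N then U k else 1%:M.
have [|f fP] := @adapted_rows n B.+1 U'.
  by rewrite /U' => k kB; rewrite -ltnS kB; case: ifP => kB'; rewrite ?submx1 ?Uinc.
exists (rowsmx f n).
  have := fP B.+1 (leqnn _); rewrite /U' ltnn mxrank1 => e.
  by rewrite -row_full_unit /row_full e mxrank1.
move=> k kB; have := fP k (leqW kB); rewrite /U' kB; apply: eqmx_trans.
have := rank_leq_row (U k); move: (\rank (U k)) => d dn.
apply/eqmxP/andP; split; apply/row_subP => i.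
  have [id|di] := ltnP i d.
    suff -> : row i (toprows d (rowsmx f n)) = row (Ordinal id) (rowsmx f d) by apply: row_sub.
    by apply/rowP => j; rewrite mxE toprowsE id !mxE /=.
  suff -> : row i (toprows d (rowsmx f n)) = 0 by rewrite sub0mx.
  by apply/rowP => j; rewrite mxE toprowsE ltnNge di /= mxE.
suff -> : row i (rowsmx f d) = row (widen_ord dn i) (toprows d (rowsmx f n)) by apply: row_sub.
by apply/rowP => j; rewrite [RHS]mxE toprowsE /= ltn_ord !mxE.
Qed.

Lemma toprows_col_mx m1 m2 n k (A : 'M[F]_(m1, n)) (B : 'M[F]_(m2, n)) :
  (k <= m1)%N -> toprows k (col_mx A B) = col_mx (toprows k A) 0.
Proof.
move=> km; apply/matrixP => i j; rewrite toprowsE.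
case: (split_ordP i) => i' -> /=; rewrite ?col_mxEu ?col_mxEd ?toprowsE //.
by rewrite ltnNge (leq_trans km) ?leq_addr // mxE.
Qed.

Lemma toprows_id m n k (C : 'M[F]_(m, n)) : (m <= k)%N -> toprows k C = C.
Proof.
move=> mk; apply/matrixP => i j; rewrite toprowsE.
by rewrite (leq_trans (ltn_ord i) mk).
Qed.

Lemma toprows0 m n (C : 'M[F]_(m, n)) : toprows 0 C = 0.
Proof. by apply/matrixP => i j; rewrite toprowsE mxE. Qed.

Lemma toprows_row_sub m n k (C : 'M[F]_(m, n)) (i : 'I_m) :
  (i < k)%N -> (row i C <= toprows k C)%MS.
Proof.
move=> ik; suff -> : row i C = row i (toprows k C) by apply: row_sub.
by apply/rowP => j; rewrite mxE [RHS]mxE toprowsE ik.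
Qed.

Lemma toprows_sub m n k l (C : 'M[F]_(m, n)) :
  (k <= l)%N -> (toprows k C <= toprows l C)%MS.
Proof.
move=> kl; apply/row_subP => i; have [ik|ki] := ltnP i k.
  suff -> : row i (toprows k C) = row i C.
    by apply: toprows_row_sub; apply: leq_trans ik kl.
  by apply/rowP => j; rewrite mxE toprowsE ik mxE.
suff -> : row i (toprows k C) = 0 by rewrite sub0mx.
by apply/rowP => j; rewrite mxE toprowsE ltnNge ki /= mxE.
Qed.

Lemma toprowsM m n p k (C : 'M[F]_(m, n)) (D : 'M[F]_(n, p)) :
  toprows k C *m D = toprows k (C *m D).
Proof. by rewrite /toprows mulmxA. Qed.

Definition pivots m n (C : 'M[F]_(m, n)) : {set 'I_m} :=
  [set i : 'I_m | \rank (toprows i C) < \rank (toprows i.+1 C)]%N.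

Lemma rank_toprowsS m n (C : 'M[F]_(m, n)) (i : 'I_m) :
  \rank (toprows i.+1 C) = (\rank (toprows i C) + (i \in pivots C))%N.
Proof.
rewrite inE; case: ltnP => [lt|le] /=; last first.
  by rewrite addn0; apply/eqP; rewrite eqn_leq le mxrankS ?toprows_sub.
apply/eqP; rewrite addn1 eqn_leq lt andbT.
have e : (toprows i.+1 C <= row i C + toprows i C)%MS.
  apply/row_subP => l; have [li|il] := ltnP l i.
    apply: submx_trans (addsmxSr _ _).
    suff -> : row l (toprows i.+1 C) = row l C by apply: toprows_row_sub.
    by apply/rowP => j; rewrite mxE toprowsE ltnS (ltnW li) mxE.
  have [e|ne] := eqVneq l i.
    apply: submx_trans (addsmxSl _ _); rewrite e.
    suff -> : row i (toprows i.+1 C) = row i C by apply: submx_refl.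
    by apply/rowP => j; rewrite mxE toprowsE ltnS leqnn mxE.
  suff -> : row l (toprows i.+1 C) = 0 by rewrite sub0mx.
  apply/rowP => j; rewrite mxE toprowsE ltnNge mxE ltn_neqAle il andbT eq_sym.
  by rewrite (negPf ne : (l == i :> nat) = false).
apply: leq_trans (mxrankS e) _; apply: leq_trans (mxrank_adds_leqif _ _) _.
by rewrite -[X in (_ <= X)%N]add1n leq_add2r rank_leq_row.
Qed.

Lemma rank_toprows m n (C : 'M[F]_(m, n)) k : (k <= m)%N ->
  \rank (toprows k C) = (\sum_(i < m | i < k) (i \in pivots C))%N.
Proof.
elim: k => [|k IH] km; first by rewrite toprows0 mxrank0 big1.
have := rank_toprowsS C (Ordinal km); rewrite /= => ->; rewrite (IH (ltnW km)) addnC.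
rewrite [RHS](bigD1 (Ordinal km)) /= ?ltnSn //.
congr (_ + _)%N; apply: eq_bigl => i; rewrite -[i != _]/(i != k :> nat) ltnS.
by rewrite andbC -ltn_neqAle.
Qed.

Lemma card_pivots m n (C : 'M[F]_(m, n)) : #|pivots C| = \rank C.
Proof.
rewrite -{2}(toprows_id C (leqnn m)) rank_toprows // -sum1_card big_mkcond.
rewrite [RHS]big_mkcond; apply: eq_bigr => i _; rewrite ltn_ord.
by case: (i \in _).
Qed.

Lemma pivots_col_mx m n (C : 'M[F]_(m, n)) (c : 'rV[F]_n) (T : pred nat) :
  (pivots (col_mx C c) == [set i : 'I_(m + 1) | T i]) =
  (pivots C == [set i : 'I_m | T i]) && (T m == ~~ (c <= C)%MS).
Proof.
have pl (i : 'I_m) : (lshift 1 i \in pivots (col_mx C c)) = (i \in pivots C).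
  rewrite !inE /= !toprows_col_mx ?(ltnW (ltn_ord i)) //.
  by rewrite !rank_col_mx0.
have pr (i : 'I_1) : (rshift m i \in pivots (col_mx C c)) = ~~ (c <= C)%MS.
  rewrite inE ord1 /= addn0 toprows_col_mx // toprows_id // toprows_id ?addn1 //.
  rewrite rank_col_mx0 rank_col_mx addsmxC -rank_col_mx rank_col_row.
  by case: (c <= C)%MS; rewrite ?addn0 ?ltnn // addn1 leqnn.
apply/eqP/andP => [/setP e|[/eqP/setP e1 /eqP e2]].
  split; last by have := e (rshift m 0); rewrite pr inE /= addn0 => ->.
  by apply/eqP/setP => i; have := e (lshift 1 i); rewrite pl !inE.
apply/setP => i; case: (split_ordP i) => j ->; first by rewrite pl e1 !inE.
by rewrite pr inE /= ord1 addn0 e2.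
Qed.

Section PivotSums.
Variable K : comNzRingType.
Local Notation q := (#|F|%:R : K).

(** A pivot row avoids the span of the rows above it and any other row lies in that span, whose
    dimension is the number of earlier pivots. [T] is a predicate on [nat] so that it serves all [m]
    in the induction. *)
Lemma card_pivots_eq m n (T : pred nat) :
  \sum_(C : 'M_(m, n) | pivots C == [set i : 'I_m | T i]) 1 =
  \prod_(i < m) (if T i then q ^+ n - q ^+ (\sum_(j < i) T j)
                 else q ^+ (\sum_(j < i) T j)).
Proof.
elim: m => [|m IH].
  rewrite big_ord0 (big_pred1 0) // => C /=; rewrite [C]flatmx0 eqxx.
  by apply/eqP/setP => -[].
pose g i : K := if T i then q ^+ n - q ^+ (\sum_(j < i) T j) else q ^+ (\sum_(j < i) T j).
rewrite -[RHS]/(\prod_(i < m.+1) g i) -addn1 big_mkcond sum_col_mx.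
have -> : \prod_(i < m + 1) g i = (\prod_(i < m) g i) * g m by rewrite addn1 big_ord_recr.
rewrite -IH mulr_suml /g.
rewrite [RHS]big_mkcond; apply: eq_bigr => C _.
transitivity (\sum_(c : 'rV_n) if pivots C == [set i : 'I_m | T i] then
    (if (c <= C)%MS then (~~ T m)%:R else (T m)%:R) else 0 : K).
  apply: eq_bigr => c _; rewrite pivots_col_mx; case: eqP => //= _.
  by case: (c <= C)%MS; case: (T m).
case: eqP => [e|_]; last by rewrite big1.
rewrite sum_rV_submx -card_pivots e mul1r.
have -> : #|[set i : 'I_m | T i]| = (\sum_(j < m) T j)%N.
  by rewrite -sum1_card big_mkcond; apply: eq_bigr => i _; rewrite inE; case: (T i).
by case: (T m); rewrite ?mulr1 ?mulr0 ?add0r ?addr0.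
Qed.

(** The other rows contribute one [q] for each pair of a pivot [j] and a later row that is not a
    pivot. There are [m - j.+1] rows after [j], and for [c] pivots ['C(c, 2)] pairs consist of two
    pivots, so the exponents add up to [m * c]. *)
Lemma pivot_prod m n (T : pred nat) :
  \prod_(i < m) (if T i then q ^+ n - q ^+ (\sum_(j < i) T j)
                 else q ^+ (\sum_(j < i) T j)) *
  q ^+ (\sum_(j < m | T j) j.+1 + 'C(\sum_(j < m) T j, 2)) =
  \prod_(j < \sum_(j < m) T j) (q ^+ n - q ^+ j) * q ^+ (m * \sum_(j < m) T j).
Proof.
elim: m => [|m IH]; first by rewrite !big_ord0.
have -> : (\sum_(j < m.+1 | T j) j.+1 = \sum_(j < m | T j) j.+1 + T m * m.+1)%N.
  by rewrite big_mkcond big_ord_recr -big_mkcond /=; case: (T m); rewrite ?mul1n.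
rewrite !(big_ord_recr m) /=.
move: IH; set P := \prod_(i < m) _; set s := (\sum_(j < m | T j) _)%N.
set c := (\sum_(j < m) T j)%N => IH; case: (T m) => /=; last first.
  by rewrite mul0n !addn0 mulrAC IH mulSn addnC exprD mulrA.
rewrite mul1n addn1 big_ord_recr /= binS bin1.
transitivity (P * q ^+ (s + 'C(c, 2)) * ((q ^+ n - q ^+ c) * q ^+ (m.+1 + c))).
  by rewrite !exprD; ring.
by rewrite IH mulnS mulSn !exprD; ring.
Qed.
End PivotSums.

Lemma sum_full_pivots (K : fieldType) m n (f : {set 'I_m} -> K) :
  #|F|%:R != 0 :> K ->
  \sum_(C : 'M_(m, n) | \rank C == n) f (pivots C) =
  \prod_(j < n) (#|F|%:R ^+ n - #|F|%:R ^+ j) * #|F|%:R ^+ (m * n) *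
  \sum_(T : {set 'I_m} | #|T| == n)
     f T / #|F|%:R ^+ (\sum_(i in T) i.+1 + 'C(n, 2)).
Proof.
move=> q0; rewrite (partition_big (@pivots m n) (fun T => #|T| == n)) /=; last first.
  by move=> C; rewrite card_pivots.
rewrite mulr_sumr; apply: eq_bigr => T /eqP cT.
pose T' : pred nat := fun k => if insub k is Some i then i \in T else false.
have T'E (i : 'I_m) : T' i = (i \in T) by rewrite /T' valK.
have eT : T = [set i : 'I_m | T' i] by apply/setP => i; rewrite inE T'E.
rewrite (eq_bigl (fun C => pivots C == [set i : 'I_m | T' i])) => [|C]; last first.
  by rewrite -eT; apply: andb_idl => /eqP e; rewrite -card_pivots e cT.
rewrite (eq_bigr (fun _ => 1 * f T)) => [|C /eqP->]; last by rewrite -eT mul1r.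
rewrite -mulr_suml card_pivots_eq.
have sT : (\sum_(j < m) T' j)%N = n.
  by rewrite -cT -sum1_card [RHS]big_mkcond; apply: eq_bigr => i _; rewrite T'E; case: (i \in T).
have := pivot_prod K m n T'; rewrite sT (eq_bigl _ _ T'E) => <-.
set P := \prod_(i < m) _; set e := (_ + _)%N.
by rewrite -mulrA [#|F|%:R ^+ e * _]mulrC divfK // expf_neq0.
Qed.
End Counting.

(** * Extensions of nilpotent matrices and their centralizers *)

Section Extensions.
Variable F : finFieldType.
Implicit Types m n p : nat.

(* Row vectors of length [m + p] are pairs [(w, v)]; [extmx A Y] sends [(w, v)] *)
(* to [(v A, v Y)], so it kills the first [m] coordinates and induces [Y] on    *)
(* the quotient by them.                                                        *)
Definition extmx m p (A : 'M[F]_(p, m)) (Y : 'M[F]_p) : 'M[F]_(m + p) :=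
  col_mx 0 (row_mx A Y).

Lemma mul_extmx m n p (w : 'M[F]_(n, m)) (v : 'M[F]_(n, p)) A Y :
  row_mx w v *m extmx A Y = row_mx (v *m A) (v *m Y).
Proof. by rewrite mul_row_col mulmx0 add0r mul_mx_row. Qed.

Lemma extmx_exp m p (A : 'M[F]_(p, m)) (Y : 'M[F]_p) k :
  extmx A Y ^+ k.+1 = col_mx 0 (Y ^+ k *m row_mx A Y).
Proof.
elim: k => [|k IH]; first by rewrite expr1 expr0 mul1mx.
rewrite exprSr IH -mulmxE mul_col_mx mul0mx; congr col_mx.
by rewrite mul_mx_row mul_extmx -mul_mx_row exprSr -mulmxE.
Qed.

Lemma rank_extmx_exp m p (A : 'M[F]_(p, m)) (Y : 'M[F]_p) k :
  \rank (extmx A Y ^+ k.+1) = \rank (Y ^+ k *m row_mx A Y).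
Proof. by rewrite extmx_exp rank_col_0mx. Qed.

(** The first [m] vectors of the new basis span the kernel of [Y]; row freeness says that nothing
    else is killed. *)
Lemma extmx_exists m p (Y : 'M[F]_(m + p)) : \rank Y = p ->
  exists2 Q, Q \in unitmx & exists A : 'M[F]_(p, m), exists Y' : 'M[F]_p,
    Q *m Y = extmx A Y' *m Q /\ row_free (row_mx A Y').
Proof.
move=> rY; have [Q uQ /(_ 0%N (leqnn 0)) eQ] :=
  @adapted_basis F (m + p) 0 (fun => kermx Y) (fun k => ltac:(by [])).
rewrite mxrank_ker rY addnK in eQ; exists Q => //.
pose Z := Q *m Y *m invmx Q; have eZ : Z *m Q = Q *m Y by rewrite mulmxKV.
have uZ : usubmx Z = 0.
  suff: usubmx Q *m Y = 0 by move=> e; rewrite /Z -!mul_usub_mx e mul0mx.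
  apply/sub_kermxP/row_subP => i; rewrite -eQ.
  suff -> : row i (usubmx Q) = row (lshift p i) Q by apply: toprows_row_sub => /=; apply: ltn_ord.
  by apply/rowP => j; rewrite !mxE.
exists (lsubmx (dsubmx Z)), (rsubmx (dsubmx Z)); rewrite /extmx hsubmxK -uZ vsubmxK.
split=> //; rewrite /row_free -(rank_col_0mx m) -uZ vsubmxK.
by rewrite mxrankMfree ?row_free_unit ?unitmx_inv // eqmxMfull ?row_full_unit // rY.
Qed.

Lemma conj_exp n (Q Y Z : 'M[F]_n) k : Q *m Y = Z *m Q -> Q *m Y ^+ k = Z ^+ k *m Q.
Proof.
move=> e; elim: k => [|k IH]; first by rewrite !expr0 mul1mx mulmx1.
by rewrite exprS -mulmxE mulmxA e -mulmxA IH mulmxA mulmxE -exprS.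
Qed.

Lemma rank_conj n (Q Y Z : 'M[F]_n) : Q \in unitmx -> Q *m Y = Z *m Q -> \rank Y = \rank Z.
Proof.
move=> uQ e; rewrite -[RHS](mxrankMfree Z (_ : row_free Q)) ?row_free_unit // -e.
by rewrite eqmxMfull ?row_full_unit.
Qed.

Lemma mulmx_colspan m n p (Y : 'M[F]_(n, p)) (D : 'M[F]_(n, m)) :
  kermx Y *m D = 0 -> exists c, D = Y *m c.
Proof.
move=> e; exists (pinvmx Y *m D); apply/eqP; rewrite -subr_eq0 mulmxA -{1}[D]mul1mx -mulmxBl.
have /submxP[X ->] : (1%:M - Y *m pinvmx Y <= kermx Y)%MS.
  by rewrite sub_kermx mulmxBl mul1mx mulmxKpV // subrr.
by rewrite -mulmxA e mulmx0.
Qed.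

Section Centralizers.
Variable K : comNzRingType.
Local Notation q := (#|F|%:R : K).

(** The number of lifts of an intertwiner from the quotients to the extensions; [m] is the dimension
    of the killed space and [l] that of the kernel in the quotient. *)
Definition layer_weight m l : K := q ^+ (m * l) * \prod_(l <= j < m) (q ^+ m - q ^+ j).

(** Row freeness forces an intertwiner to be block triangular, with blocks [a], [c], [g] such that
    [Y2 *m c = g *m A1 - A2 *m a]. Multiplied by the kernel of [Y2], this prescribes the images
    under [a] of [p - \rank Y2] independent vectors; then [c] ranges over a coset of the solutions
    of [Y2 *m c = 0]. *)
Lemma card_intertwine_ext m p (A1 A2 : 'M[F]_(p, m)) (Y1 Y2 : 'M[F]_p) :
  row_free (row_mx A1 Y1) -> row_free (row_mx A2 Y2) ->
  \sum_(g | (g \in unitmx) && (g *m extmx A1 Y1 == extmx A2 Y2 *m g)) 1 =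
  layer_weight m (p - \rank Y2) *
  \sum_(g | (g \in unitmx) && (g *m Y1 == Y2 *m g)) 1.
Proof.
move=> f1 f2; rewrite big_mkcond sum_col_mx sum_row_mx.
pose P (a : 'M[F]_m) (c : 'M[F]_(p, m)) (g : 'M[F]_p) :=
  [&& a \in unitmx, g \in unitmx, g *m Y1 == Y2 *m g & Y2 *m c == g *m A1 - A2 *m a].
transitivity (\sum_(a : 'M_m) \sum_(c : 'M_(p, m)) \sum_(g : 'M_p) (P a c g)%:R : K).
  apply: eq_bigr => a _; rewrite (bigD1 0) //= [X in _ + X]big1 => [|b nb]; last first.
    rewrite sum_row_mx big1 // => c _; rewrite big1 // => g _.
    rewrite mul_col_mx !mul_extmx mul_col_mx mul0mx.
    case: ifP => // /andP[_ /eqP/eq_col_mx[e _]]; case/eqP: nb.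
    by apply: (row_free_inj f1); rewrite /= mul0mx mul_mx_row e.
  rewrite addr0 sum_row_mx; apply: eq_bigr => c _; apply: eq_bigr => g _.
  rewrite -/(block_mx a 0 c g) [_ \in unitmx]unitmxE det_lblock unitrM -!unitmxE /P.
  rewrite mul_col_mx !mul_extmx !mul0mx row_mx0 mul_col_mx mul0mx.
  rewrite mul_row_block mulmx0 add0r -andbA.
  suff -> : (col_mx 0 (row_mx (g *m A1) (g *m Y1)) ==
      col_mx 0 (row_mx (A2 *m a + Y2 *m c) (Y2 *m g)) :> 'M_(m + p)) =
      (g *m Y1 == Y2 *m g) && (Y2 *m c == g *m A1 - A2 *m a).
    by case: ifP.
  apply/eqP/andP => [/eq_col_mx[_ /eq_row_mx[-> ->]]|[/eqP-> /eqP->]].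
    by rewrite addrC addKr !eqxx.
  by rewrite addrCA subrr addr0.
transitivity (\sum_(g | (g \in unitmx) && (g *m Y1 == Y2 *m g)) layer_weight m (p - \rank Y2)); last first.
  by rewrite mulr_sumr; apply: eq_bigr => g _; rewrite mulr1.
rewrite (eq_bigr _ (fun a _ => exchange_big _ _ _ _ _ _)) exchange_big /= [RHS]big_mkcond.
apply: eq_bigr => g _; case: ifP => [/andP[ug /eqP eg]|ng]; last first.
  rewrite big1 // => a _; rewrite big1 // => c _; rewrite /P.
  by rewrite [(g \in _) && _]andbA ng andbF.
pose R := row_base (kermx Y2).
have RY : R *m Y2 = 0 by apply/sub_kermxP; rewrite eq_row_base.
have freeR : row_free R by apply: row_base_free.
have fal : row_free (R *m A2).
  rewrite /row_free -(rank_row_mx0 p) -RY -mul_mx_row mxrankMfree //.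
have fbe : row_free (R *m g *m A1).
  have e0 : R *m g *m Y1 = 0 by rewrite -mulmxA eg mulmxA RY mul0mx.
  rewrite /row_free -(rank_row_mx0 p) -e0 -mul_mx_row.
  by rewrite mxrankMfree // mxrankMfree ?row_free_unit.
rewrite /layer_weight -mxrank_ker -(card_unitmx_mul _ fal fbe) mulr_sumr [RHS]big_mkcond.
apply: eq_bigr => a _; rewrite /P ug eg eqxx /=; case: (a \in unitmx) => /=; last by rewrite big1.
case: eqP => [e|ne]; last first.
  rewrite big1 // => c _; case: eqP => // e; case: ne.
  have : R *m (Y2 *m c) = 0 by rewrite mulmxA RY mul0mx.
  by rewrite e mulmxBr !mulmxA => /subr0_eq.
have [c0 e0] : exists c, g *m A1 - A2 *m a = Y2 *m c.
  apply: mulmx_colspan; have /submxP[X ->] : (kermx Y2 <= R)%MS by rewrite eq_row_base.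
  by rewrite -mulmxA mulmxBr !mulmxA e subrr mulmx0.
rewrite mulr1 mxrank_ker e0 -natrX -(card_mulmx_eq Y2 c0) -sum1_card natr_sum [RHS]big_mkcond /=.
by apply: eq_bigr => c _; rewrite inE; case: eqP.
Qed.

(** Peeling off kernels leaves a count that depends on the ranks of the powers only. It is the order
    of the centralizer if [Y1 = Y2], and as it is not zero it also proves conjugacy. *)
Lemma card_intertwine B n (Y1 Y2 : 'M[F]_n) :
  Y1 ^+ B = 0 -> (forall k, \rank (Y1 ^+ k) = \rank (Y2 ^+ k)) ->
  \sum_(g | (g \in unitmx) && (g *m Y1 == Y2 *m g)) 1 =
  \prod_(k < B) layer_weight (\rank (Y1 ^+ k) - \rank (Y1 ^+ k.+1))
                             (\rank (Y1 ^+ k.+1) - \rank (Y1 ^+ k.+2)).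
Proof.
elim: B n Y1 Y2 => [|B IH] n Y1 Y2 nil eqr.
  have n0 : n = 0%N by have := mxrank1 F n; rewrite -[1%:M](expr0 Y1) nil mxrank0.
  subst n; rewrite big_ord0 (big_pred1 0) // => g /=; rewrite [g]flatmx0 eqxx.
  by rewrite unitmxE det_mx00 unitr1 /=; apply/eqP; rewrite !mul0mx mulmx0.
have [p r1] : exists p, \rank Y1 = p by exists (\rank Y1).
have r2 : \rank Y2 = p by rewrite -r1; have := eqr 1%N; rewrite !expr1.
have [m em] : exists m, n = (m + p)%N.
  by exists (n - p)%N; rewrite subnK // -r1 rank_leq_row.
subst n.
have [Q1 u1 [A1 [Z1 [e1 f1]]]] := extmx_exists r1.
have [Q2 u2 [A2 [Z2 [e2 f2]]]] := extmx_exists r2.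
have rZ1 k : \rank (Y1 ^+ k.+1) = \rank (Z1 ^+ k).
  by rewrite (rank_conj u1 (conj_exp _ e1)) rank_extmx_exp mxrankMfree.
have rZ2 k : \rank (Y2 ^+ k.+1) = \rank (Z2 ^+ k).
  by rewrite (rank_conj u2 (conj_exp _ e2)) rank_extmx_exp mxrankMfree.
transitivity (\sum_(g | (g \in unitmx) && (g *m extmx A1 Z1 == extmx A2 Z2 *m g)) (1 : K)).
  rewrite (reindex (fun g => invmx Q2 *m g *m Q1)) /=; last first.
    exists (fun g => Q2 *m g *m invmx Q1) => g _.
      by rewrite !mulmxA mulmxV // mul1mx mulmxK.
    by rewrite !mulmxA mulVmx // mul1mx mulmxKV.
  apply: eq_bigl => g; rewrite !unitmx_mul unitmx_inv u1 u2 andbT /=; congr (_ && _).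
  have -> : invmx Q2 *m g *m Q1 *m Y1 = invmx Q2 *m (g *m extmx A1 Z1) *m Q1.
    by rewrite -!mulmxA e1.
  have -> : Y2 *m (invmx Q2 *m g *m Q1) = invmx Q2 *m (extmx A2 Z2 *m g) *m Q1.
    by rewrite !mulmxA; congr (_ *m _ *m _); rewrite -[Y2](mulKmx u2) e2 !mulmxA mulmxK.
  apply/eqP/eqP => [|->//] e.
  by have := congr1 (fun h => Q2 *m h *m invmx Q1) e; rewrite !mulmxA !mulmxK // !mulmxV // !mul1mx.
rewrite card_intertwine_ext // big_ord_recl /= expr0 mxrank1; congr (layer_weight _ _ * _).
- by rewrite expr1 r1 addnK.
- by rewrite expr1 r1 eqr rZ2 expr1.
rewrite (IH _ Z1 Z2).
- by apply: eq_bigr => k _; rewrite /bump /= !add1n !rZ1.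
- by apply/eqP; rewrite -mxrank_eq0 -rZ1 nil mxrank0.
by move=> k; rewrite -rZ1 -rZ2.
Qed.
End Centralizers.
End Extensions.

(** * Symmetrized Hall-Littlewood sums *)

Section AdjacentSwap.
Variables (N : nat) (a b : 'I_N).
Hypothesis ab : b = a.+1 :> nat.
Local Notation s := (tperm a b).

(** An adjacent transposition keeps the order of every pair other than the one that it swaps. *)
Lemma adjacent_swap_lt (i j : 'I_N) :
  ((s i < s j)%N && ((s i, s j) != (a, b))) = ((i < j)%N && ((i, j) != (a, b))).
Proof.
have vs (k : 'I_N) : s k = (if k == a :> nat then b : nat else if k == b :> nat then a : nat else k) :> nat.
  case: tpermP => [->|->|/eqP ka /eqP kb].
  - by rewrite eqxx.
  - by rewrite eqxx; case: eqP.
  by rewrite (negPf (ka : k != a :> nat)) (negPf (kb : k != b :> nat)).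
rewrite !xpair_eqE -!(inj_eq val_inj) /= !vs ab.
by case: eqP; case: eqP; case: eqP; case: eqP; lia.
Qed.

Lemma big_adjacent_swap (R : Type) (idx : R) (op : Monoid.com_law idx) (h : 'I_N -> 'I_N -> R) :
  \big[op/idx]_(i < N) \big[op/idx]_(j < N | (i < j)%N) h i j =
  op (h a b) (\big[op/idx]_(p : 'I_N * 'I_N | (p.1 < p.2)%N && (p != (a, b))) h p.1 p.2).
Proof.
by rewrite pair_big_dep /= (bigD1 (a, b)) //= ab.
Qed.

Lemma big_adjacent_swap_rest (R : Type) (idx : R) (op : Monoid.com_law idx)
    (h : 'I_N -> 'I_N -> R) :
  \big[op/idx]_(p : 'I_N * 'I_N | (p.1 < p.2)%N && (p != (a, b))) h (s p.1) (s p.2) =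
  \big[op/idx]_(p : 'I_N * 'I_N | (p.1 < p.2)%N && (p != (a, b))) h p.1 p.2.
Proof.
rewrite [RHS](reindex (fun p => (s p.1, s p.2))) /=; last first.
  by exists (fun p => (s p.1, s p.2)) => -[i j] _; rewrite /= !tpermK.
by apply: eq_bigl => -[i j]; rewrite /= adjacent_swap_lt.
Qed.
End AdjacentSwap.

Section SymmetrizedSums.
Variables (K : fieldType) (N : nat) (x : 'I_N -> K) (t : K).
Implicit Types (mu nu la : 'I_N -> nat) (T : {set 'I_N}).

(** The sum in [hall_littlewood] without its constant, for exponents in any order and with values of
    the variables in any field. *)
Definition hl_sum nu : K :=
  \sum_(w : 'S_N)
    (\prod_(i < N) x (w i) ^+ nu i) *
    (\prod_(i < N) \prod_(j < N | (i < j)%N)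
       ((x (w i) - t * x (w j)) / (x (w i) - x (w j)))).

Lemma eq_hl_sum mu nu : mu =1 nu -> hl_sum mu = hl_sum nu.
Proof.
move=> e; apply: eq_bigr => w _; congr (_ * _).
by apply: eq_bigr => i _; rewrite e.
Qed.

Hypothesis inj_x : injective x.
Hypothesis two_neq0 : 2%:R != 0 :> K.

(* The terms of [w] and of [w] composed with the transposition are added up;    *)
(* the remaining factors are symmetric in the two variables, and               *)
(*   y (x - t y) / (x - y) + x (y - t x) / (y - x) = t (x + y),                *)
(*   x (x - t y) / (x - y) + y (y - t x) / (y - x) = x + y.                    *)
Lemma hl_sum_swap nu (a b : 'I_N) : b = a.+1 :> nat -> nu b = (nu a).+1 ->
  hl_sum nu = t * hl_sum (nu \o tperm a b).
Proof.
move=> ab nuab; set s := tperm a b.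
have dbl mu : 2%:R * hl_sum mu = \sum_(w : 'S_N)
    ((\prod_(i < N) x (w i) ^+ mu i) *
     (\prod_(i < N) \prod_(j < N | (i < j)%N)
        ((x (w i) - t * x (w j)) / (x (w i) - x (w j)))) +
     (\prod_(i < N) x (w i) ^+ mu (s i)) *
     (\prod_(i < N) \prod_(j < N | (i < j)%N)
        ((x (w (s i)) - t * x (w (s j))) / (x (w (s i)) - x (w (s j)))))).
  rewrite mulr_natl mulr2n big_split /=; congr (_ + _).
  rewrite /hl_sum (reindex_inj (mulgI s)) /=; apply: eq_bigr => w _; congr (_ * _).
    rewrite (reindex_inj (@perm_inj _ s)) /=; apply: eq_bigr => i _.
    by rewrite permM tpermK.
  by apply: eq_bigr => i _; apply: eq_bigr => j _; rewrite !permM.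
apply: (mulfI two_neq0); rewrite mulrCA !dbl mulr_sumr; apply: eq_bigr => w _.
have nba : b != a by apply/eqP => e; have := congr1 val e; rewrite /= ab; lia.
pose f i j := (x (w i) - t * x (w j)) / (x (w i) - x (w j)).
rewrite !(big_adjacent_swap ab) /=.
rewrite (big_adjacent_swap_rest ab _ (fun i j => f i j)).
rewrite -/(f a b) -/(f (s a) (s b)) tpermL tpermR.
set E := \prod_(p : 'I_N * 'I_N | (p.1 < p.2)%N && (p != (a, b))) _.
have mono (mu : 'I_N -> nat) : \prod_(i < N) x (w i) ^+ mu i =
    x (w a) ^+ mu a * (x (w b) ^+ mu b * \prod_(i < N | (i != a) && (i != b)) x (w i) ^+ mu i).
  by rewrite (bigD1 a) //= (bigD1 b).
rewrite !mono /= !tpermL !tpermR !tpermL nuab.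
pose R := \prod_(i < N | (i != a) && (i != b)) x (w i) ^+ nu i.
have -> : \prod_(i < N | (i != a) && (i != b)) x (w i) ^+ nu (s i) = R.
  by apply: eq_bigr => i /andP[ia ib]; rewrite tpermD // eq_sym.
have -> : \prod_(i < N | (i != a) && (i != b)) x (w i) ^+ nu (s (s i)) = R.
  by apply: eq_bigr => i _; rewrite tpermK.
rewrite -/R /f !exprS.
have ne : x (w a) - x (w b) != 0.
  by rewrite subr_eq0; apply: contra nba => /eqP/inj_x/perm_inj->.
have ne' : x (w b) - x (w a) != 0 by rewrite -opprB oppr_eq0.
set X := x (w a) in ne ne' *; set Y := x (w b) in ne ne' *.
move: (X ^+ nu a) (Y ^+ nu a) => A B; field.
by rewrite ne ne'.
Qed.

Definition esum m : K := \sum_(T : {set 'I_N} | #|T| == m) \prod_(i in T) x i.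

(** As [esum] is symmetric, in the term of [w] it can be written in the permuted variables, where
    each [T] raises the exponents in [T] by one. *)
Lemma hl_sum_pieri mu m :
  esum m * hl_sum mu =
  \sum_(T : {set 'I_N} | #|T| == m) hl_sum (fun i => mu i + (i \in T))%N.
Proof.
rewrite exchange_big mulr_sumr /=; apply: eq_bigr => w _.
rewrite -mulr_suml mulrA; congr (_ * _).
rewrite /esum (reindex_inj (imset_inj (@perm_inj _ w))) /= mulr_suml.
rewrite [LHS](eq_bigl (fun T : {set 'I_N} => #|T| == m)) => [|T]; last first.
  by rewrite card_imset //; apply: perm_inj.
apply: eq_bigr => T _; rewrite big_imset /= => [|i j _ _]; last exact: perm_inj.
rewrite [X in X * _]big_mkcond -big_split /=; apply: eq_bigr => i _.
by case: (i \in T); rewrite ?mul1r ?addn0 // addn1 exprS.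
Qed.
End SymmetrizedSums.

(** * Straightening of exponents *)

Section Sorting.
Variable N : nat.
Implicit Types (mu nu la : 'I_N -> nat) (T : {set 'I_N}).

Definition decreasing nu := forall i j : 'I_N, (i <= j)%N -> (nu j <= nu i)%N.
(** Holds for a partition plus a vertical strip. Ascents are then by exactly one, as [hl_sum_swap]
    requires. *)
Definition almost_decreasing nu := forall i j : 'I_N, (i <= j)%N -> (nu j <= (nu i).+1)%N.
(** For a Jordan type this is the rank of the [k]-th power; all these numbers together determine the
    multiset of entries. *)
Definition tails nu k := (\sum_(i < N) (nu i - k))%N.
Definition inversions nu := (\sum_(i < N) \sum_(j < N | i < j) (nu i < nu j))%N.
(** A formula for [part_n] that makes sense for unsorted exponents and is invariant under
    permutations. *)
Definition min_sum nu := (\sum_(i < N) \sum_(j < N | i < j) minn (nu i) (nu j))%N.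

Lemma tails_card nu k : (tails nu k = #|[set i | k < nu i]| + tails nu k.+1)%N.
Proof.
rewrite -sum1_card big_mkcond -big_split /=; apply: eq_bigr => i _; rewrite inE.
by case: ifP; lia.
Qed.

Lemma card_ord_lt k : (k <= N)%N -> #|[set j : 'I_N | (j < k)%N]| = k.
Proof.
move=> kN; rewrite -sum1_card (eq_bigl (fun j : 'I_N => j < k)%N) => [|j]; last by rewrite inE.
by rewrite (big_ord_narrow kN) sum1_card card_ord.
Qed.

Lemma decreasing_lt nu k (i : 'I_N) : decreasing nu ->
  (k < nu i)%N = (i < #|[set j | k < nu j]%N|)%N.
Proof.
move=> dec; apply/idP/idP => [ki|lt].
  rewrite -[X in (X <= _)%N](card_ord_lt (ltn_ord i)).
  by apply: subset_leq_card; apply/subsetP => j; rewrite !inE => ji; apply: leq_trans ki (dec _ _ _).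
rewrite ltnNge; apply: contraL lt => ik; rewrite -leqNgt.
rewrite -[X in (_ <= X)%N](card_ord_lt (ltnW (ltn_ord i))).
apply: subset_leq_card; apply/subsetP => j; rewrite !inE => kj; rewrite ltnNge.
by apply/negP => /dec le; have := leq_trans kj (leq_trans le ik); rewrite ltnn.
Qed.

Lemma decreasing_tails_inj mu nu : decreasing mu -> decreasing nu ->
  (forall k, tails mu k = tails nu k) -> mu =1 nu.
Proof.
move=> dmu dnu e i.
have lt k : (k < mu i)%N = (k < nu i)%N.
  rewrite !decreasing_lt //; congr (_ < _)%N.
  by have := e k; rewrite (tails_card mu k) (tails_card nu k) e => /addIn.
apply/eqP; rewrite eqn_leq; apply/andP; split; rewrite leqNgt.
  by rewrite lt ltnn.
by rewrite -lt ltnn.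
Qed.

Lemma ascent_exists nu : inversions nu != 0%N ->
  exists a b : 'I_N, b = a.+1 :> nat /\ (nu a < nu b)%N.
Proof.
move=> inv; case: (pickP (fun p : 'I_N * 'I_N => (p.2 == p.1.+1 :> nat) && (nu p.1 < nu p.2)%N)).
  by move=> [a b] /andP[/eqP]; exists a, b.
move=> no; case/eqP: inv.
suff dec : decreasing nu.
  by rewrite /inversions big1 // => i _; rewrite big1 // => j /ltnW/dec; rewrite leqNgt => /negPf->.
move=> i [j jN] /=; elim: j jN => [|j IH] jN.
  by rewrite leqn0 => /eqP i0; rewrite (_ : Ordinal jN = i) //; apply: val_inj.
rewrite leq_eqVlt => /orP[/eqP e|]; first by rewrite (_ : Ordinal jN = i) //; apply: val_inj.
rewrite ltnS => ij; apply: leq_trans _ (IH (ltnW jN) ij); rewrite leqNgt.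
by have := no (Ordinal (ltnW jN), Ordinal jN); rewrite /= eqxx => /= ->.
Qed.

Lemma inversions0 nu : inversions nu = 0%N -> decreasing nu.
Proof.
move=> e i j; rewrite leq_eqVlt => /orP[/eqP/val_inj->//|ij]; rewrite leqNgt.
move/eqP: e; rewrite sum_nat_eq0 => /forallP/(_ i)/implyP/(_ isT).
by rewrite sum_nat_eq0 => /forallP/(_ j)/implyP/(_ ij); case: (_ < _)%N.
Qed.

(** For [i < j] one has [nu j <= (nu i).+1], so the minimum and the inversion indicator add up to
    [nu j]; for [mu] the minimum is [mu j]. Each [j] occurs in [j] such pairs. *)
Lemma add_strip_sum mu T : decreasing mu ->
  let nu i := (mu i + (i \in T))%N in
  (min_sum nu + inversions nu = min_sum mu + \sum_(i in T) i)%N.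
Proof.
move=> dec nu; have -> : (\sum_(i in T) i = \sum_(i < N) \sum_(j < N | i < j) (j \in T))%N.
  rewrite (exchange_big_dep xpredT) //= big_mkcond; apply: eq_bigr => j _.
  rewrite sum_nat_const -[in RHS]sum1_card (big_ord_narrow (ltnW (ltn_ord j))) sum1_card card_ord.
  by case: (j \in T); rewrite ?muln1 ?muln0.
rewrite -!big_split; apply: eq_bigr => i _; rewrite -!big_split; apply: eq_bigr => j ij /=.
by have := dec _ _ (ltnW ij); rewrite /nu; case: (i \in T); case: (j \in T); lia.
Qed.

Section Straightening.
Variables (K : fieldType) (x : 'I_N -> K) (q : K).
Hypotheses (inj_x : injective x) (two_neq0 : 2%:R != 0 :> K) (q_neq0 : q != 0).

(** Swapping an ascent costs a factor [q^-1] and removes exactly one inversion, while [min_sum] does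
    not change. *)
Lemma hl_sum_sort nu la : almost_decreasing nu -> decreasing la ->
  (forall k, tails nu k = tails la k) ->
  q ^+ (min_sum nu + inversions nu) * hl_sum x q^-1 nu = q ^+ min_sum la * hl_sum x q^-1 la.
Proof.
move En : (inversions nu) => n; elim: n nu En => [|n IH] nu En adec dec et.
  rewrite addn0; have e := decreasing_tails_inj (inversions0 En) dec et.
  rewrite (eq_hl_sum _ _ e); congr (_ ^+ _ * _).
  by apply: eq_bigr => i _; apply: eq_bigr => j _; rewrite !e.
have [|a [b [ab lt]]] := @ascent_exists nu; first by rewrite En.
have nab : nu b = (nu a).+1.
  by apply/eqP; rewrite eqn_leq lt andbT adec // ab.
rewrite (@hl_sum_swap _ _ _ _ inj_x two_neq0 _ _ _ ab nab).
have swap_min : min_sum (nu \o tperm a b) = min_sum nu.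
  rewrite /min_sum !(big_adjacent_swap ab) /= tpermL tpermR minnC.
  by rewrite (big_adjacent_swap_rest ab _ (fun i j => minn (nu i) (nu j))).
have swap_inv : inversions nu = (inversions (nu \o tperm a b)).+1.
  rewrite /inversions !(big_adjacent_swap ab) /= tpermL tpermR lt ltnNge (ltnW lt) /=.
  by rewrite (big_adjacent_swap_rest ab _ (fun i j => (nu i < nu j)%N : nat)) add0n add1n.
rewrite -(IH (nu \o tperm a b)) //.
- by rewrite swap_min !addnS exprS; field.
- by move: En; rewrite swap_inv => -[].
- move=> i j; rewrite leq_eqVlt => /orP[/eqP/val_inj->//|ij] /=.
  have [[-> ->]|ne] := eqVneq (i, j) (a, b); first by rewrite tpermL tpermR ltnW // ltnW.
  apply: adec; apply: ltnW; suff: (tperm a b i < tperm a b j)%N && ((tperm a b i, tperm a b j) != (a, b)).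
    by case/andP.
  by rewrite adjacent_swap_lt // ij.
move=> k; rewrite -et /tails (reindex_inj (@perm_inj _ (tperm a b))) /=.
by apply: eq_bigr => i _; rewrite tpermK.
Qed.
End Straightening.
End Sorting.

(** * Lagrange interpolation and the sum for the empty partition *)

Lemma lagrange_lead_coef (K : fieldType) n (y : 'I_n.+1 -> K) (p : {poly K}) :
  injective y -> (size p <= n.+1)%N ->
  p`_n = \sum_i p.[y i] / \prod_(j | j != i) (y i - y j).
Proof.
move=> inj_y sp; pose L i := \prod_(j | j != i) ('X - (y j)%:P).
have nz i : \prod_(j | j != i) (y i - y j) != 0.
  by apply/prodf_neq0 => j ji; rewrite subr_eq0 (inj_eq inj_y) eq_sym.
have L_E i k : (L i).[y k] = if k == i then \prod_(j | j != i) (y i - y j) else 0.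
  rewrite horner_prod; case: eqP => [->|/eqP ki].
    by apply: eq_bigr => j _; rewrite hornerXsubC.
  by rewrite (bigD1 k) //= hornerXsubC subrr mul0r.
have sL i : size (L i) = n.+1.
  rewrite /L -big_filter size_prod_XsubC size_filter -sum1_count sum1_card.
  by rewrite cardC1 card_ord.
have mL i : (L i)`_n = 1.
  by have /monicP := monic_prod_XsubC [seq j <- index_enum 'I_n.+1 | j != i] predT y;
    rewrite lead_coefE big_filter -/(L i) sL.
pose D := p - \sum_i (p.[y i] / \prod_(j | j != i) (y i - y j)) *: L i.
have D0 : D = 0.
  apply: (@roots_geq_poly_eq0 _ _ [seq y i | i <- enum 'I_n.+1]).
  - apply/allP => _ /mapP[k _ ->]; rewrite rootE hornerD hornerN horner_sum (bigD1 k) //=.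
    rewrite [X in _ - (_ + X)]big1 => [|i ik]; last by rewrite hornerZ L_E eq_sym (negPf ik) mulr0.
    by rewrite addr0 hornerZ L_E eqxx divfK // subrr.
  - by rewrite map_inj_uniq // enum_uniq.
  rewrite size_map size_enum_ord (leq_trans (size_polyD _ _)) // size_polyN geq_max sp /=.
  apply: leq_trans (size_sum _ _ _) _; apply/bigmax_leqP => i _.
  by rewrite (leq_trans (size_scale_leq _ _)) ?sL.
move/eqP: D0; rewrite subr_eq0 => /eqP e; rewrite [in LHS]e coef_sum.
by apply: eq_bigr => i _; rewrite coefZ mL mulr1.
Qed.

Section ConstantTerm.
Variables (K : fieldType) (t : K).
Hypothesis t_neq1 : 1 - t != 0.

(** The monic polynomial with roots [t * x j] is interpolated at [0] and the [x i]. The node [0]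
    contributes [t ^+ n] and the others [1 - t] times the sum; together they give the leading
    coefficient 1. *)
Lemma sum_prod_ratio n (x : 'I_n -> K) : injective x -> (forall i, x i != 0) ->
  \sum_i \prod_(j | j != i) ((x i - t * x j) / (x i - x j)) = \sum_(0 <= j < n) t ^+ j.
Proof.
move=> inj_x x0; pose p : {poly K} := \prod_j ('X - (t * x j)%:P).
pose y (i : 'I_n.+1) := if unlift ord0 i is Some j then x j else 0.
have y0 : y ord0 = 0 by rewrite /y unlift_none.
have yS i : y (lift ord0 i) = x i by rewrite /y liftK.
have inj_y : injective y.
  move=> i j; case: (unliftP ord0 i) => [i' ->|->]; case: (unliftP ord0 j) => [j' ->|->] //.
  - by rewrite !yS => /inj_x ->.
  - by rewrite yS y0 => e; have := x0 i'; rewrite e eqxx.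
  by rewrite yS y0 => e; have := x0 j'; rewrite -e eqxx.
have sp : size p = n.+1.
  by rewrite size_prod_XsubC -[RHS]/(n.+1) /index_enum -enumT size_enum_ord.
have lp : p`_n = 1.
  by have /monicP := monic_prod_XsubC (index_enum 'I_n) predT (fun j => t * x j);
    rewrite lead_coefE sp.
have := lagrange_lead_coef inj_y (eq_leq sp); rewrite lp big_ord_recl y0.
have -> : p.[0] / \prod_(j < n.+1 | j != ord0) (0 - y j) = t ^+ n.
  rewrite big_mkcond big_ord_recl /= mul1r.
  rewrite horner_prod -prodf_div (eq_bigr (fun=> t)) ?prodr_const ?card_ord // => i _.
  by rewrite hornerXsubC yS !sub0r invrN mulrNN mulfK.
rewrite (eq_bigr (fun i => (1 - t) * \prod_(j | j != i) ((x i - t * x j) / (x i - x j)))) => [|i _]; last first.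
  rewrite yS horner_prod (bigD1 i) //= hornerXsubC [X in _ / X]big_mkcond big_ord_recl /= y0 subr0.
  under [X in _ / (_ * X)]eq_bigr => j _ do rewrite (inj_eq lift_inj) yS.
  rewrite -big_mkcond /= prodf_div.
  rewrite (eq_bigr (fun j => x i - t * x j)) => [|j _]; last by rewrite hornerXsubC.
  set A := \prod_(j | _) (_ - t * _); set B := \prod_(j | _) _.
  have B0 : B != 0.
    by apply/prodf_neq0 => j ji; rewrite subr_eq0 (inj_eq inj_x) eq_sym.
  by field; rewrite B0 x0.
rewrite -mulr_sumr => e; apply: (mulfI t_neq1).
have -> : (1 - t) * (\sum_(0 <= j < n) t ^+ j) = 1 - t ^+ n.
  by rewrite big_mkord -[1 - t]opprB mulNr -subrX1 opprB.
by apply/eqP; rewrite eq_sym subr_eq addrC -e.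
Qed.

(** Permutations are sorted by the image [i] of the first index: its factors give the term of [i] in
    [sum_prod_ratio], and the others the same sum in one variable less. *)
Lemma hl_sum0 n (x : 'I_n -> K) : injective x -> (forall i, x i != 0) ->
  hl_sum x t (fun=> 0%N) = HL_v t n.
Proof.
elim: n x => [|n IH] x inj_x x0.
  rewrite /hl_sum /HL_v big_geq // (big_pred1 1%g) => [|w]; first by rewrite !big_ord0 mulr1.
  by apply/esym/eqP/permP => -[].
rewrite /HL_v big_nat_recr //= -/(HL_v t n) -(sum_prod_ratio inj_x x0) mulr_sumr.
pose f (p : 'I_n.+1 * 'S_n) : 'S_n.+1 := lift_perm ord0 p.1 p.2.
have bij_f : bijective f.
  apply: inj_card_bij => [[i v] [j w] /= /permP e|]; last first.
    by rewrite card_prod card_ord !card_Sn factS.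
  have eij : i = j by have := e ord0; rewrite !lift_perm_id.
  rewrite -{}eij in e *; congr (_, _); apply/permP => k; apply: (@lift_inj _ i).
  by have := e (lift ord0 k); rewrite !lift_perm_lift.
rewrite /hl_sum (reindex f) /=; last by case: bij_f => g fg gf; exists g => ? _.
rewrite -(pair_bigA _ (fun i (w : 'S_n) =>
  (\prod_(j < n.+1) x (lift_perm ord0 i w j) ^+ 0) *
  \prod_(j < n.+1) \prod_(k < n.+1 | (j < k)%N)
     ((x (lift_perm ord0 i w j) - t * x (lift_perm ord0 i w k)) /
      (x (lift_perm ord0 i w j) - x (lift_perm ord0 i w k))))) /=.
apply: eq_bigr => i _; rewrite -(IH (fun j => x (lift i j))); first last.
- by move=> j.
- by move=> j k /inj_x/lift_inj.
rewrite /hl_sum mulr_suml; apply: eq_bigr => w _.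
rewrite [X in X * _ = _]big1 // mul1r [X in _ = X * _ * _]big1 // mul1r.
rewrite big_ord_recl mulrC; congr (_ * _).
  apply: eq_bigr => j _; rewrite big_mkcond big_ord_recl /= mul1r -big_mkcond.
  by apply: eq_bigr => k _; rewrite !lift_perm_lift.
rewrite big_mkcond big_ord_recl /= mul1r lift_perm_id.
pose g k := (x i - t * x k) / (x i - x k).
transitivity (\prod_(k in [set lift i j | j : 'I_n]) g k).
  rewrite big_imset /= => [|j k _ _]; last exact: lift_inj.
  by rewrite [RHS](reindex_inj (@perm_inj _ w)) /=; apply: eq_bigr => k _; rewrite lift_perm_lift.
apply: eq_bigl => k; apply/imsetP/idP => [[j _ ->]|]; first by rewrite eq_sym neq_lift.
by case: (unliftP i k) => [j ->|->]; [exists j | rewrite eqxx].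
Qed.
End ConstantTerm.

(** * Flags of Krylov subspaces *)

Section Krylov.
Variable F : finFieldType.
Implicit Types m n p N : nat.

(** The [F[Y]]-submodule generated by the rows of [M]. Matrices over [F] form a finite type, so all
    the stable subspaces can be intersected at once. *)
Definition krylov n N (Y : 'M[F]_n) (M : 'M[F]_(N, n)) : 'M[F]_n :=
  (\bigcap_(U : 'M[F]_n | (M <= U)%MS && (U *m Y <= U)%MS) U)%MS.

Lemma krylov_sub n N (Y : 'M[F]_n) (M : 'M[F]_(N, n)) : (M <= krylov Y M)%MS.
Proof. by apply/sub_bigcapmxP => U /andP[]. Qed.

Lemma krylov_stable n N (Y : 'M[F]_n) (M : 'M[F]_(N, n)) :
  (krylov Y M *m Y <= krylov Y M)%MS.
Proof.
apply/sub_bigcapmxP => U hU; have /andP[_ sU] := hU.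
by apply: submx_trans sU; apply: submxMr; apply: (bigcapmx_inf U).
Qed.

Lemma krylov_min n N m (Y : 'M[F]_n) (M : 'M[F]_(N, n)) (U : 'M[F]_(m, n)) :
  (M <= U)%MS -> (U *m Y <= U)%MS -> (krylov Y M <= U)%MS.
Proof.
move=> MU sU; apply: submx_trans (_ : <<U>>%MS <= U)%MS; last by rewrite genmxE.
apply: (bigcapmx_inf <<U>>%MS) => //.
by rewrite genmxE MU (eqmxMr _ (genmxE U)) genmxE sU.
Qed.

Lemma krylovS n N1 N2 (Y : 'M[F]_n) (M1 : 'M[F]_(N1, n)) (M2 : 'M[F]_(N2, n)) :
  (M1 <= M2)%MS -> (krylov Y M1 <= krylov Y M2)%MS.
Proof.
by move=> s; apply: krylov_min (krylov_stable _ _); apply: submx_trans s (krylov_sub _ _).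
Qed.

Lemma krylov_eq n N (Y : 'M[F]_n) (M : 'M[F]_(N, n)) :
  (krylov Y M <= krylov Y M *m Y + M)%MS.
Proof.
apply: krylov_min; first exact: addsmxSr.
apply: submx_trans (addsmxSl _ _); apply: submxMr.
by rewrite addsmx_sub krylov_stable krylov_sub.
Qed.

Lemma krylov_conj n N (Q Y Z : 'M[F]_n) (M : 'M[F]_(N, n)) :
  Q \in unitmx -> Q *m Y = Z *m Q -> \rank (krylov Z M) = \rank (krylov Y (M *m Q)).
Proof.
move=> uQ e; rewrite -(mxrankMfree (krylov Z M) (_ : row_free Q)) ?row_free_unit //.
apply/eqmx_rank/andP; split; last first.
  apply: krylov_min; first by rewrite submxMr ?krylov_sub.
  by rewrite -mulmxA e mulmxA submxMr ?krylov_stable.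
rewrite -[X in (_ <= X)%MS](mulmxKV uQ) submxMr //; apply: krylov_min.
  by rewrite -[X in (X <= _)%MS](mulmxK uQ M) submxMr ?krylov_sub.
have -> : krylov Y (M *m Q) *m invmx Q *m Z = krylov Y (M *m Q) *m Y *m invmx Q.
  by rewrite -!mulmxA; congr (_ *m _); rewrite -[Y](mulKmx uQ) e mulmxA mulmxK.
by rewrite submxMr ?krylov_stable.
Qed.

Section Relations.
Variables (m p N : nat) (A : 'M[F]_(p, m)) (Y : 'M[F]_p) (MW : 'M[F]_(N, m)) (M : 'M[F]_(N, p)).

(* [(c, a)] is a relation when [c M + a Y = 0]; evaluated in an extension it    *)
(* yields the vector [c MW + a A] of the kernel of the projection.              *)
Definition relations i : 'M[F]_(N + p) :=
  (block_mx (pid_mx i : 'M_N) 0 0 (krylov Y (toprows i M)) :&: kermx (col_mx M Y))%MS.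

Lemma relationsS i j : (i <= j)%N -> (relations i <= relations j)%MS.
Proof.
move=> ij; apply: capmxS => //; apply/row_subP => r; case: (split_ordP r) => k ->.
  have -> : row (lshift p k) (block_mx (pid_mx i : 'M_N) 0 0 (krylov Y (toprows i M))) =
            row_mx (row k (toprows i 1%:M)) 0 by rewrite /toprows mulmx1 rowKu row_row_mx row0.
  have -> : block_mx (pid_mx j : 'M_N) 0 0 (krylov Y (toprows j M)) =
            block_mx (toprows j 1%:M) 0 0 (krylov Y (toprows j M)) by rewrite /toprows mulmx1.
  have /submxP[u eu] := submx_trans (row_sub k _) (@toprows_sub F _ _ i j 1%:M ij).
  apply/submxP; exists (row_mx u 0); rewrite mul_row_block !mulmx0 !mul0mx !addr0.
  by rewrite -eu.
have /submxP[u eu] := submx_trans (row_sub k _) (krylovS Y (toprows_sub M ij)).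
apply/submxP; exists (row_mx 0 u); rewrite mul_row_block !mulmx0 !mul0mx !add0r -eu.
by rewrite rowKd row_row_mx row0.
Qed.

(** The map sending [(c, a)] to [c M + a Y] is onto from the sum of [F^i] and the Krylov space to
    the Krylov space, by [krylov_eq]; so its kernel has dimension [i]. *)
Lemma rank_relations i : (i <= N)%N -> \rank (relations i) = i.
Proof.
move=> iN; have := mxrank_mul_ker (block_mx (pid_mx i : 'M_N) 0 0 (krylov Y (toprows i M))) (col_mx M Y).
rewrite -/(relations i) rank_diag_block_mx rank_pid_mx //.
rewrite mul_block_col !mul0mx addr0 add0r -/(toprows i M).
suff -> : \rank (col_mx (toprows i M) (krylov Y (toprows i M) *m Y)) = \rank (krylov Y (toprows i M)).
  by rewrite addnC => /addIn.
rewrite rank_col_mx; apply/eqmx_rank/andP; split.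
  by rewrite addsmx_sub krylov_sub krylov_stable.
by rewrite addsmxC krylov_eq.
Qed.

Definition proj_ext : 'M[F]_(m + p, p) := col_mx 0 1%:M.
Local Notation V i := (krylov (extmx A Y) (toprows i (row_mx MW M))).
Local Notation V' i := (krylov Y (toprows i M)).

Lemma proj_extE r (w : 'M[F]_(r, m)) (v : 'M[F]_(r, p)) : row_mx w v *m proj_ext = v.
Proof. by rewrite mul_row_col mulmx0 add0r mulmx1. Qed.

Lemma extmx_factor : extmx A Y = proj_ext *m row_mx A Y.
Proof. by rewrite mul_col_mx mul0mx mul1mx. Qed.

Lemma krylov_ext_proj i : (V i *m proj_ext :=: V' i)%MS.
Proof.
have Ypr : extmx A Y *m proj_ext = proj_ext *m Y by rewrite extmx_factor -mulmxA proj_extE.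
have Mpr : toprows i (row_mx MW M) *m proj_ext = toprows i M by rewrite toprowsM proj_extE.
apply/eqmxP/andP; split; last first.
  apply: krylov_min; first by rewrite -Mpr submxMr ?krylov_sub.
  by rewrite -mulmxA -Ypr mulmxA submxMr ?krylov_stable.
(* [U] is the preimage of [V' i] under the projection; it is stable and contains the generators. *)
rewrite submxE -mulmxA -sub_kermx; set U := kermx _.
have Upr : (U *m proj_ext <= V' i)%MS by rewrite submxE -mulmxA mulmx_ker.
apply: krylov_min; first by rewrite sub_kermx mulmxA Mpr -submxE krylov_sub.
have : (U *m proj_ext *m Y <= V' i)%MS.
  by apply: submx_trans (submxMr _ Upr) _; apply: krylov_stable.
rewrite submxE sub_kermx => /eqP e.
by rewrite mulmxA -(mulmxA U) Ypr (mulmxA U) e.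
Qed.

(** By [krylov_eq] a vector of [V i] is a combination of generators plus the image of a vector of
    [V i]. It projects to zero exactly when the coefficients and the projection of that vector form
    a relation. *)
Lemma rank_krylov_ext_ker i :
  \rank (V i :&: kermx proj_ext) = \rank (relations i *m col_mx MW A).
Proof.
have relD : relations i *m col_mx M Y = 0 by apply/sub_kermxP/capmxSr.
rewrite -(rank_row_mx0 p (relations i *m _)) -relD -mul_mx_row.
have eD : row_mx (col_mx MW A) (col_mx M Y) = col_mx (row_mx MW M) (row_mx A Y).
  by rewrite -block_mxEh -block_mxEv.
have Dpr : col_mx (row_mx MW M) (row_mx A Y) *m proj_ext = col_mx M Y.
  by rewrite mul_col_mx !proj_extE.
rewrite eD; apply/eqmx_rank/andP; split; last first.
  rewrite sub_capmx sub_kermx -mulmxA Dpr relD eqxx andbT.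
  apply: submx_trans (submxMr _ (capmxSl _ _)) _.
  rewrite mul_block_col !mul0mx addr0 add0r col_mx_sub krylov_sub /=.
  rewrite -(eqmxMr _ (krylov_ext_proj i)).
  by rewrite -mulmxA -extmx_factor krylov_stable.
have /sub_addsmxP[[X1 X2] /= eU] : (V i :&: kermx proj_ext <=
    V i *m extmx A Y + toprows i (row_mx MW M))%MS.
  by apply: submx_trans (capmxSl _ _) _; apply: krylov_eq.
have /submxP[X3 e3] : (V i *m proj_ext <= V' i)%MS by rewrite krylov_ext_proj.
have eR : (V i :&: kermx proj_ext)%MS =
    row_mx X2 (X1 *m X3) *m block_mx (pid_mx i : 'M_N) 0 0 (V' i) *m
    col_mx (row_mx MW M) (row_mx A Y).
  rewrite mul_row_block !mulmx0 addr0 add0r mul_row_col -!mulmxA eU addrC.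
  by congr (_ + _ *m _); rewrite mulmxA -e3 -mulmxA -extmx_factor.
rewrite [X in (X <= _)%MS]eR submxMr // sub_capmx submxMl sub_kermx.
by rewrite -Dpr mulmxA -eR -sub_kermx capmxSr.
Qed.

Lemma rank_krylov_ext i :
  \rank (V i) = (\rank (V' i) + \rank (relations i *m col_mx MW A))%N.
Proof.
by rewrite -(mxrank_mul_ker (V i) proj_ext) krylov_ext_proj rank_krylov_ext_ker.
Qed.

Lemma sub_pid_mx n r k (v : 'M[F]_(r, n)) :
  (v <= (pid_mx k : 'M_n))%MS = (v *m (copid_mx k : 'M_n) == 0).
Proof.
apply/idP/eqP => [/submxP[X ->]|e]; last first.
  by rewrite -[v]mulmx1 -(subrK (pid_mx k) 1%:M) mulmxDr e add0r submxMl.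
have [kn|nk] := leqP k n; first by rewrite -mulmxA mul_pid_mx_copid // mulmx0.
have -> : copid_mx k = 0 :> 'M[F]_n.
  by apply/matrixP => i j; rewrite !mxE (ltn_trans (ltn_ord i) nk) andbT subrr.
by rewrite mulmx0.
Qed.

(** The span of the first [m + k] coordinates contains the kernel of the projection, so intersecting
    with it affects only the term of the quotient. *)
Lemma rank_krylov_ext_pid i k :
  \rank (V i :&: (pid_mx (m + k) : 'M_(m + p))) =
  (\rank (V' i :&: (pid_mx k : 'M_p)) + \rank (relations i *m col_mx MW A))%N.
Proof.
have pidE r (w : 'M[F]_(r, m)) (v : 'M[F]_(r, p)) :
    (row_mx w v <= (pid_mx (m + k) : 'M_(m + p)))%MS = (v <= (pid_mx k : 'M_p))%MS.
  rewrite !sub_pid_mx /copid_mx.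
  have -> : 1%:M - pid_mx (m + k) = block_mx 0 0 0 (1%:M - pid_mx k) :> 'M[F]_(m + p).
    apply/matrixP => i1 j1; have eqE (a b : 'I_(m + p)) : (a == b) = (a == b :> nat) by [].
    case: (split_ordP i1) => i2 e1; case: (split_ordP j1) => j2 e2;
      rewrite e1 e2 ?block_mxEul ?block_mxEur ?block_mxEdl ?block_mxEdr !mxE !eqE /= ?eqn_add2l ?ltn_add2l.
    - have -> : (i2 < m + k)%N by apply: leq_trans (ltn_ord i2) (leq_addr _ _).
      by rewrite andbT; apply: subrr.
    - by rewrite ltn_eqF ?subrr // (leq_trans (ltn_ord i2)) ?leq_addr.
    - by rewrite gtn_eqF ?subrr // (leq_trans (ltn_ord j2)) ?leq_addr.
    by [].
  rewrite mul_row_block !mulmx0 !add0r.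
  by rewrite -[X in _ == X]row_mx0; apply/eqP/eqP => [/eq_row_mx[_]|->].
rewrite -(mxrank_mul_ker _ proj_ext); congr (_ + _)%N.
  apply/eqmx_rank/andP; split.
    rewrite sub_capmx; apply/andP; split.
      by rewrite -krylov_ext_proj submxMr // capmxSl.
    set W := (_ :&: _)%MS; have : (W <= (pid_mx (m + k) : 'M_(m + p)))%MS by apply: capmxSr.
    by rewrite -{1}[W]hsubmxK pidE -[rsubmx W](proj_extE (lsubmx W)) hsubmxK.
  set W := (_ :&: _)%MS; have /submxP[X eX] : (W <= V i *m proj_ext)%MS.
    by rewrite krylov_ext_proj capmxSl.
  rewrite eX mulmxA submxMr // sub_capmx submxMl /= -[X *m V i]hsubmxK pidE.
  by rewrite -[rsubmx _](proj_extE (lsubmx (X *m V i))) hsubmxK -mulmxA -eX capmxSr.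
rewrite -rank_krylov_ext_ker -capmxA; apply: eqmx_rank; apply/andP; split.
  by apply: capmxS => //; apply: capmxSr.
apply: capmxS => //; rewrite sub_capmx submx_refl andbT.
set W := kermx _; rewrite -[X in (X <= _)%MS]hsubmxK pidE.
by rewrite -[rsubmx W](proj_extE (lsubmx W)) hsubmxK mulmx_ker sub0mx.
Qed.
End Relations.

(** * Flag sums and their average over extensions *)

Section FlagSums.
Variables (K : comNzRingType) (N : nat) (y : 'I_N -> K).
Local Notation q := (#|F|%:R : K).

Definition flag_dim n (Y : 'M[F]_n) (M : 'M[F]_(N, n)) i := \rank (krylov Y (toprows i M)).

Definition flag_weight n (Y : 'M[F]_n) (M : 'M[F]_(N, n)) : K :=
  \prod_(i < N) y i ^+ (flag_dim Y M i.+1 - flag_dim Y M i).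

Definition flag_sum n (Y : 'M[F]_n) : K :=
  \sum_(M : 'M_(N, n) | \rank (krylov Y M) == n) flag_weight Y M.

Lemma flag_sum_conj n (Q Y Z : 'M[F]_n) : Q \in unitmx -> Q *m Y = Z *m Q ->
  flag_sum Y = flag_sum Z.
Proof.
move=> uQ e; rewrite /flag_sum (reindex (mulmxr Q)) /=; last first.
  by exists (mulmxr (invmx Q)) => M _ /=; rewrite ?mulmxK ?mulmxKV.
apply: eq_big => [M|M _]; first by rewrite -(krylov_conj _ uQ e).
by apply: eq_bigr => i _; rewrite /flag_dim -!toprowsM -!(krylov_conj _ uQ e).
Qed.

(** For fixed [M], let [Q] be a basis of [F^(N + p)] adapted to the chain of relations. In it the
    matrix with blocks [MW] and [A] becomes a uniform one: its first [i] rows measure the growth of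
    [V_i], so its pivots give the additional weight, and its last [p] rows are free, whence
    [q ^+ (p * m)]. *)
Lemma flag_sum_ext m p (Y : 'M[F]_p) :
  \sum_(A : 'M_(p, m)) flag_sum (extmx A Y) =
  q ^+ (p * m) * (\sum_(C : 'M[F]_(N, m) | \rank C == m) \prod_(i in pivots C) y i) *
  flag_sum Y.
Proof.
pose W (A : 'M[F]_(p, m)) MW (M : 'M[F]_(N, p)) : K :=
  if \rank (krylov (extmx A Y) (row_mx MW M)) == (m + p)%N
  then flag_weight (extmx A Y) (row_mx MW M) else 0.
transitivity (\sum_(M : 'M_(N, p)) \sum_(B : 'M_(N + p, m)) W (dsubmx B) (usubmx B) M).
  rewrite (eq_bigr (fun A => \sum_M \sum_MW W A MW M)) => [|A _]; last first.
    by rewrite /flag_sum big_mkcond sum_row_mx exchange_big.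
  rewrite exchange_big /=; apply: eq_bigr => M _; rewrite sum_col_mx exchange_big /=.
  by apply: eq_bigr => MW _; apply: eq_bigr => A _; rewrite col_mxKu col_mxKd.
rewrite [flag_sum Y]big_mkcond mulr_sumr /=; apply: eq_bigr => M _.
have [Q uQ eQ] := adapted_basis (B := N)
  (fun k (_ : (k < N)%N) => relationsS Y M (leqnSn k)).
rewrite (reindex (mulmx (invmx Q))) /=; last first.
  by exists (mulmx Q) => C _; rewrite ?mulKmx ?mulKVmx.
rewrite sum_col_mx.
have key (C1 : 'M[F]_(N, m)) C2 i (B := invmx Q *m col_mx C1 C2) : (i <= N)%N ->
    \rank (krylov (extmx (dsubmx B) Y) (toprows i (row_mx (usubmx B) M))) =
    (flag_dim Y M i + \rank (toprows i C1))%N.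
  move=> iN; rewrite rank_krylov_ext vsubmxK; congr (_ + _)%N.
  have := eQ i iN; rewrite rank_relations // => e.
  by rewrite -(eqmxMr _ e) toprowsM mulKVmx // toprows_col_mx // rank_col_mx0.
transitivity (\sum_(C1 : 'M[F]_(N, m)) \sum_(C2 : 'M[F]_(p, m))
   if (\rank C1 == m) && (\rank (krylov Y M) == p)
   then \prod_(i in pivots C1) y i * flag_weight Y M else 0).
  apply: eq_bigr => C1 _; apply: eq_bigr => C2 _; rewrite /W.
  have := key C1 C2 N (leqnn N); rewrite /flag_dim !toprows_id // => ->.
  have r1 := rank_leq_col C1; have r2 := rank_leq_col (krylov Y M).
  have -> : (\rank (krylov Y M) + \rank C1 == m + p)%N =
            (\rank C1 == m) && (\rank (krylov Y M) == p).
    by apply/eqP/andP => [e|[/eqP-> /eqP->]]; [split; apply/eqP|]; lia.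
  case: ifP => // _; rewrite /flag_weight [X in _ = X * _]big_mkcond -big_split /=.
  apply: eq_bigr => i _; rewrite /flag_dim !key ?ltn_ord //; last exact: ltnW.
  rewrite rank_toprowsS -/(flag_dim Y M i.+1) -/(flag_dim Y M i).
  have le : (flag_dim Y M i <= flag_dim Y M i.+1)%N.
    by rewrite mxrankS // krylovS // toprows_sub.
  have -> : (flag_dim Y M i.+1 + (\rank (toprows i C1) + (i \in pivots C1)) -
     (flag_dim Y M i + \rank (toprows i C1)) =
     (i \in pivots C1) + (flag_dim Y M i.+1 - flag_dim Y M i))%N by lia.
  by rewrite exprD; case: (i \in _); rewrite ?expr1 ?expr0.
case: eqP => [_|_]; last by rewrite mulr0 big1 // => C1 _; rewrite big1 // => C2 _; rewrite andbF.
rewrite [in RHS]big_mkcond mulr_sumr mulr_suml; apply: eq_bigr => C1 _.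
rewrite sumr_const card_mx andbT; case: eqP => _; last by rewrite mul0rn mulr0 mul0r.
by rewrite -mulrA -natrX mulr_natl.
Qed.
End FlagSums.
End Krylov.

(** * Jordan types of extensions *)

Section Shapes.
Variable F : finFieldType.

Section Shape.
Variables (n : nat) (Y : 'M[F]_n).

Definition nullity_step k := (\rank (Y ^+ k) - \rank (Y ^+ k.+1))%N.

(* The parts of the Jordan type of a nilpotent [Y]: its conjugate partition is  *)
(* given by the [nullity_step k].                                               *)
Definition shape i := #|[set k : 'I_n | (i < nullity_step k)%N]|.

Lemma rank_expS k : (\rank (Y ^+ k.+1) <= \rank (Y ^+ k))%N.
Proof. by rewrite exprS -mulmxE mxrankS ?submxMl. Qed.

Lemma nullity_stepS k : (nullity_step k.+1 <= nullity_step k)%N.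
Proof.
have := mxrank_Frobenius Y (Y ^+ k) Y; rewrite !mulmxE -exprS -!exprSr.
rewrite /nullity_step; have := rank_expS k; have := rank_expS k.+1.
by move: (\rank (Y ^+ k)) (\rank (Y ^+ k.+1)) (\rank (Y ^+ k.+2)) => a b c; lia.
Qed.

Lemma nullity_step_anti k l : (k <= l)%N -> (nullity_step l <= nullity_step k)%N.
Proof.
elim: l => [|l IH]; first by rewrite leqn0 => /eqP->.
rewrite leq_eqVlt => /orP[/eqP->//|kl]; exact: leq_trans (nullity_stepS l) (IH kl).
Qed.

Lemma nullity_step0 : nullity_step 0 = (n - \rank Y)%N.
Proof. by rewrite /nullity_step expr0 expr1 mxrank1. Qed.

Lemma shape_leq i : (shape i <= n)%N.
Proof. by rewrite -[X in (_ <= X)%N]card_ord max_card. Qed.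

Lemma shape_decreasing N : decreasing (fun i : 'I_N => shape i).
Proof.
move=> i j ij; apply: subset_leq_card; apply/subsetP => k; rewrite !inE.
exact: leq_ltn_trans.
Qed.

Lemma lt_shape k i : (k < n)%N -> (k < shape i)%N = (i < nullity_step k)%N.
Proof.
move=> kn; rewrite [RHS](@decreasing_lt n (fun k : 'I_n => nullity_step k) i (Ordinal kn)) //.
by move=> a b; apply: nullity_step_anti.
Qed.

Lemma nilpotent_exp B : Y ^+ B = 0 -> Y ^+ n = 0.
Proof.
move=> nil; have stop k l : nullity_step k = 0%N -> (k <= l)%N -> \rank (Y ^+ l) = \rank (Y ^+ k).
  move=> d0; elim: l => [|l IH]; first by rewrite leqn0 => /eqP->.
  rewrite leq_eqVlt => /orP[/eqP->//|]; rewrite ltnS => kl; rewrite -(IH kl).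
  have := nullity_step_anti kl; rewrite d0 leqn0 /nullity_step => /eqP.
  by have := rank_expS l; lia.
have nz k : \rank (Y ^+ k) != 0%N -> nullity_step k != 0%N.
  apply: contra => /eqP d0; have [kB|Bk] := leqP k B.
    by rewrite -(stop _ _ d0 kB) nil mxrank0.
  by rewrite -(subnK (ltnW Bk)) exprD nil mulr0 mxrank0.
have step k : (\rank (Y ^+ k) == 0%N) || (\rank (Y ^+ k) + k <= n)%N.
  elim: k => [|k IH]; first by rewrite expr0 mxrank1 addn0 leqnn orbT.
  have := nz k; have := rank_expS k; rewrite /nullity_step; lia.
apply/eqP; rewrite -mxrank_eq0; have := step n; lia.
Qed.

(** [shape] is conjugate to [nullity_step], so exactly [nullity_step Y k] of its entries exceed [k].
    The bound on [N] leaves room for all nonzero entries. The induction descends from [k = n], where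
    both sides vanish. *)
Lemma tails_shape N k : Y ^+ n = 0 -> (n - \rank Y <= N)%N ->
  tails (fun i : 'I_N => shape i) k = \rank (Y ^+ k).
Proof.
move=> nil lN; have [kn|nk] := leqP n k.
  rewrite -(subnK kn) exprD nil mulr0 mxrank0 /tails big1 // => i _.
  by apply/eqP; rewrite subn_eq0 (leq_trans (shape_leq _)) // subnK.
have [j ->] : exists j, k = (n - j)%N by exists (n - k)%N; rewrite subKn // ltnW.
elim: j {k nk} => [|j IH].
  rewrite subn0 nil mxrank0 /tails big1 // => i _.
  by apply/eqP; rewrite subn_eq0 shape_leq.
have [jn|nj] := leqP n j.
  by move: IH; have -> : (n - j = n - j.+1)%N by lia.
pose k := (n - j.+1)%N; have ek : (n - j = k.+1)%N by rewrite /k; lia.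
have kn : (k < n)%N by rewrite /k; lia.
rewrite -/k tails_card; rewrite ek in IH; rewrite IH.
have -> : #|[set i : 'I_N | (k < shape i)%N]| = nullity_step k.
  rewrite -[RHS](@card_ord_lt N); first by apply: eq_card => i; rewrite !inE lt_shape.
  by apply: leq_trans (nullity_step_anti (leq0n k)) _; rewrite nullity_step0.
by rewrite /nullity_step subnK // rank_expS.
Qed.
End Shape.

Lemma eq_shape n (Y Z : 'M[F]_n) : (forall k, \rank (Y ^+ k) = \rank (Z ^+ k)) -> shape Y =1 shape Z.
Proof. by move=> e i; apply: eq_card => k; rewrite !inE /nullity_step !e. Qed.

Lemma tails_strip N (mu : 'I_N -> nat) (T : {set 'I_N}) k :
  tails (fun i => mu i + (i \in T))%N k.+1 =
  (tails mu k.+1 + \sum_(i < N | k < mu i) (i \in T))%N.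
Proof.
rewrite /tails [X in (_ = _ + X)%N]big_mkcond -big_split; apply: eq_bigr => i _ /=.
by case: ifP; case: (i \in T); lia.
Qed.

Lemma tails_strip0 N (mu : 'I_N -> nat) (T : {set 'I_N}) :
  tails (fun i => mu i + (i \in T))%N 0 = (tails mu 0 + #|T|)%N.
Proof.
rewrite -sum1_card [in RHS]big_mkcond -big_split; apply: eq_bigr => i _ /=.
by rewrite !subn0; case: (i \in T).
Qed.

(** The intersection of the kernel of [Y] with the image of [Y ^+ k]. *)
Definition socle n (Y : 'M[F]_n) k : 'M[F]_n := kermx (Y ^+ k.+1) *m Y ^+ k.

Lemma rank_socle n (Y : 'M[F]_n) k : \rank (socle Y k) = nullity_step Y k.
Proof.
have := mxrank_mul_ker (kermx (Y ^+ k.+1)) (Y ^+ k); rewrite -/(socle Y k) mxrank_ker.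
have -> : (kermx (Y ^+ k.+1) :&: kermx (Y ^+ k) :=: kermx (Y ^+ k))%MS.
  by apply: capmx_idPr; rewrite sub_kermx exprSr -mulmxE mulmxA mulmx_ker mul0mx.
rewrite mxrank_ker /nullity_step.
have := rank_expS Y k; have := rank_leq_row (Y ^+ k); have := rank_leq_row (Y ^+ k.+1); lia.
Qed.

Lemma socleS n (Y : 'M[F]_n) k : (socle Y k.+1 <= socle Y k)%MS.
Proof.
rewrite /socle [X in (_ *m X <= _)%MS]exprS -mulmxE mulmxA submxMr //.
by apply/sub_kermxP; rewrite -mulmxA mulmxE -exprS -mulmxE mulmx_ker.
Qed.

(** Hence the Jordan type of an extension depends only on the ranks of [A] on the socles of [Y]. *)
Lemma rank_extmx_socle m p (A : 'M[F]_(p, m)) (Y : 'M[F]_p) k :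
  \rank (extmx A Y ^+ k.+1) = (\rank (Y ^+ k.+1) + \rank (socle Y k *m A))%N.
Proof. by rewrite rank_extmx_exp mul_mx_row rank_row_mx mulmxE -exprSr /socle mulmxA. Qed.

Lemma socle_basis p (Y : 'M[F]_p) : exists2 Q, Q \in unitmx &
  forall k m (A : 'M[F]_(p, m)), (k <= p)%N ->
    \rank (socle Y k *m A) = \rank (toprows (nullity_step Y k) (Q *m A)).
Proof.
(* The socles decrease with [k], hence the reversed index. *)
have [|Q uQ eQ] := @adapted_basis F p p (fun j => socle Y (p - j)).
  move=> j jp; have -> : (p - j = (p - j.+1).+1)%N by lia.
  exact: socleS.
exists Q => // k m A kp; have := eQ (p - k)%N (leq_subr _ _).
by rewrite subKn // rank_socle => e; rewrite -toprowsM (eqmxMr _ e).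
Qed.
End Shapes.

(** * The Hall-Littlewood side of the recursion *)

Section HallLittlewoodSums.
Variables (F : finFieldType) (K : fieldType).
Hypothesis charK : forall k, (k%:R == 0 :> K) = (k == 0%N).
Local Notation q := (#|F|%:R : K).

Lemma q_neq0 : q != 0.
Proof. by rewrite charK -lt0n (cardD1 0). Qed.

Lemma two_neq0 : 2%:R != 0 :> K.
Proof. by rewrite charK. Qed.

Lemma natr_inj_char0 : injective (fun k => k%:R : K).
Proof.
move=> a b /eqP; wlog ab : a b / (a <= b)%N.
  by move=> H e; case: (leqP a b) => [|/ltnW] ab; [|apply/esym]; apply: H; rewrite // eq_sym.
rewrite eq_sym -subr_eq0 -natrB // charK subn_eq0 => ba.
by apply/eqP; rewrite eqn_leq ab.
Qed.

Lemma expq_inj : injective (fun k => q ^+ k).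
Proof.
move=> a b /=; rewrite -!natrX => /natr_inj_char0/eqP; rewrite eqn_exp2l; first by move/eqP.
exact: card_finNzRing_gt1.
Qed.

Section Sums.
Variables (N : nat) (x : 'I_N -> K).

(** For nilpotent [Y] these are the tuples generating [F^n] as an [F[Y]]-module, by Nakayama's
    lemma. *)
Definition full_count n (Y : 'M[F]_n) : K :=
  \sum_(B : 'M_(N, n) | row_full (col_mx Y B)) 1.

Definition hl_shape n (Y : 'M[F]_n) : K :=
  q ^+ min_sum (fun i : 'I_N => shape Y i) * hl_sum x q^-1 (fun i : 'I_N => shape Y i).

Definition hl_count n (Y : 'M[F]_n) : K := full_count Y * hl_shape Y.

Lemma full_countE n (Y : 'M[F]_n) :
  full_count Y = q ^+ (N * \rank Y) * \prod_(j < n - \rank Y) (q ^+ N - q ^+ j).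
Proof. exact: card_row_full_col_mx. Qed.

Lemma full_count0 n (Y : 'M[F]_n) : (N < n - \rank Y)%N -> full_count Y = 0.
Proof.
by move=> lN; rewrite full_countE (bigD1 (Ordinal lN)) //= subrr mul0r mulr0.
Qed.

Lemma eq_hl_shape n (Y Z : 'M[F]_n) :
  (forall k, \rank (Y ^+ k) = \rank (Z ^+ k)) -> hl_shape Y = hl_shape Z.
Proof.
move=> /eq_shape e; have e' : (fun i : 'I_N => shape Y i) =1 (fun i => shape Z i) by move=> i; apply: e.
rewrite /hl_shape (eq_hl_sum _ _ e').
congr (_ ^+ _ * _); apply: eq_bigr => i _; apply: eq_bigr => j _; by rewrite !e.
Qed.

Lemma eq_hl_count n (Y Z : 'M[F]_n) :
  (forall k, \rank (Y ^+ k) = \rank (Z ^+ k)) -> hl_count Y = hl_count Z.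
Proof.
move=> e; rewrite /hl_count (eq_hl_shape e) !full_countE.
by have := e 1%N; rewrite !expr1 => ->.
Qed.
End Sums.

(** In a basis adapted to the socles, the type of the extension depends only on the first
    [l = p - \rank Y] rows [A1] of [A]. Its [full_count] is a constant times the number of
    completions [B] of [A1] to a matrix of rank [m] with [N] rows. The pivots of this matrix are the
    strip by which the shape of [Y] grows, up to sorting; [sum_full_pivots] and the Pieri rule then
    sum over strips. *)
Lemma hl_count_ext N (x : 'I_N -> K) m p (Y : 'M[F]_p) : injective x -> Y ^+ p = 0 ->
  \sum_(A : 'M_(p, m)) hl_count x (extmx A Y) =
  q ^+ (p * m) *
  (\prod_(j < m) (q ^+ m - q ^+ j) * q ^+ (N * m) / q ^+ (m + 'C(m, 2))) * esum x m *
  hl_count x Y.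
Proof.
move=> inj_x nil; have q0 := q_neq0.
have [lN|Nl] := leqP (p - \rank Y) N; last first.
  rewrite /hl_count [full_count _ Y]full_count0 // mul0r mulr0 big1 // => A _.
  rewrite full_count0 ?mul0r // -[extmx A Y]expr1 rank_extmx_socle expr1.
  by have := rank_leq_col (socle Y 0 *m A); lia.
have [s rY] : exists s, \rank Y = s by exists (\rank Y).
have [l el] : exists l, p = (l + s)%N.
  by exists (p - s)%N; rewrite subnK // -rY rank_leq_row.
subst p; rewrite rY addnK in lN.
have [s' eN] : exists s', N = (l + s')%N by exists (N - l)%N; rewrite subnKC.
subst N; have [Q uQ eQ] := socle_basis Y.
have d0 : nullity_step Y 0 = l by rewrite nullity_step0 rY addnK.
have ek k (A1 : 'M_(l, m)) (A2 : 'M_(s, m)) : (k <= l + s)%N ->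
    \rank (extmx (invmx Q *m col_mx A1 A2) Y ^+ k.+1) =
    (\rank (Y ^+ k.+1) + \rank (toprows (nullity_step Y k) A1))%N.
  move=> kp; rewrite rank_extmx_socle eQ // mulKVmx // toprows_col_mx ?rank_col_mx0 //.
  by have := nullity_step_anti Y (leq0n k); rewrite d0.
pose mu (i : 'I_(l + s')) := shape Y i.
have tmu k : tails mu k = \rank (Y ^+ k) by apply: tails_shape => //; rewrite rY addnK.
(* By [add_strip_sum] this exponent is [min_sum] plus [inversions] of the exponents with the strip
   added, as in [hl_sum_sort]. *)
pose f (T : {set 'I_(l + s')}) :=
  q ^+ (min_sum mu + \sum_(i in T) i) * hl_sum x q^-1 (fun i => mu i + (i \in T))%N.
have hE (A1 : 'M_(l, m)) (A2 : 'M_(s, m)) (B : 'M_(s', m)) : row_full (col_mx A1 B) ->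
    hl_shape x (extmx (invmx Q *m col_mx A1 A2) Y) = f (pivots (col_mx A1 B)).
  move=> full; set Z := extmx _ Y; set T := pivots _.
  have nilZ : Z ^+ (m + (l + s)) = 0.
    apply: (@nilpotent_exp _ _ _ (l + s).+1).
    by rewrite extmx_exp nil mul0mx col_mx0.
  have rZ : \rank Z = (s + \rank A1)%N.
    by rewrite -[Z]expr1 ek // expr1 rY d0 toprows_id.
  have rA : (m <= \rank A1 + s')%N.
    rewrite -[m in (m <= _)%N](eqP full) rank_col_mx.
    apply: leq_trans (mxrank_adds_leqif _ _) _.
    by rewrite leq_add2l rank_leq_row.
  have tZ k : tails (fun i : 'I_(l + s') => shape Z i) k = \rank (Z ^+ k).
    by apply: tails_shape => //; rewrite rZ; lia.
  rewrite /f -add_strip_sum; last exact: shape_decreasing.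
  rewrite (@hl_sum_sort _ _ _ _ inj_x two_neq0 q0 _ (fun i => shape Z i)) //.
  - move=> i j ij; have := shape_decreasing (N := l + s') Y ij; rewrite /mu.
    by case: (i \in T); case: (j \in T); lia.
  - exact: shape_decreasing.
  case=> [|k]; rewrite tZ; first by rewrite tails_strip0 tmu !expr0 !mxrank1 card_pivots (eqP full) addnC.
  rewrite tails_strip tmu; have [kp|pk] := leqP (l + s)%N k.
    rewrite -[in RHS](subnK kp) -addnS exprD extmx_exp nil mul0mx col_mx0 mulr0 mxrank0.
    rewrite -[in LHS](subnK kp) -addSn exprD nil mulr0 mxrank0 big1 // => i ki.
    by have := leq_trans ki (shape_leq Y i); lia.
  rewrite ek ?(ltnW pk) //; congr (_ + _)%N.
  have dl : (nullity_step Y k <= l)%N by have := nullity_step_anti Y (leq0n k); rewrite d0.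
  have := rank_toprows (col_mx A1 B) (leq_trans dl (leq_addr s' l)).
  rewrite toprows_col_mx // rank_col_mx0 => ->.
  (* The rows of length greater than [k] are the first [nullity_step Y k] ones. *)
  by apply: eq_bigl => i; rewrite lt_shape.
rewrite (reindex (mulmx (invmx Q))) /=; last first.
  by exists (mulmx Q) => C _; rewrite ?mulKmx ?mulKVmx.
rewrite sum_col_mx.
transitivity (\sum_(A1 : 'M[F]_(l, m)) \sum_(A2 : 'M[F]_(s, m))
    full_count (l + s') Y * q ^+ (l * m) *
    \sum_(B : 'M[F]_(s', m) | row_full (col_mx A1 B)) f (pivots (col_mx A1 B))).
  apply: eq_bigr => A1 _; apply: eq_bigr => A2 _.
  transitivity (full_count (l + s') Y * q ^+ (l * m) *
     (\sum_(B : 'M[F]_(s', m) | row_full (col_mx A1 B)) 1) *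
     hl_shape x (extmx (invmx Q *m col_mx A1 A2) Y)); last first.
    rewrite -[LHS]mulrA; congr (_ * _); rewrite mulr_suml; apply: eq_bigr => B full.
    by rewrite mul1r; apply: hE.
  rewrite /hl_count card_row_full_col_mx !full_countE; congr (_ * _).
  have rZ : \rank (extmx (invmx Q *m col_mx A1 A2) Y) = (s + \rank A1)%N.
    by rewrite -[extmx _ _]expr1 ek // expr1 rY d0 toprows_id.
  have := rank_leq_col A1; rewrite rZ rY addnK; move: (\rank A1) => a am.
  have -> : (m + (l + s) - (s + a) = l + (m - a))%N by lia.
  rewrite big_split_ord /=.
  have -> : \prod_(i < m - a) (q ^+ (l + s') - q ^+ (l + i)) =
     q ^+ (l * (m - a)) * \prod_(i < m - a) (q ^+ s' - q ^+ i).
    have -> : q ^+ (l * (m - a)) = \prod_(i < m - a) q ^+ l by rewrite prodr_const card_ord exprM.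
    by rewrite -big_split /=; apply: eq_bigr => i _; rewrite !exprD mulrBr.
  set P1 := \prod_(i < l) _; set P2 := \prod_(i < m - a) _.
  have e : q ^+ ((l + s') * (s + a)) * q ^+ (l * (m - a)) =
           q ^+ ((l + s') * s) * q ^+ (l * m) * q ^+ (s' * a).
    by rewrite -!exprD; congr (_ ^+ _); nia.
  transitivity (q ^+ ((l + s') * (s + a)) * q ^+ (l * (m - a)) * (P1 * P2)); first by ring.
  by rewrite e; ring.
rewrite (eq_bigr (fun A1 => q ^+ (s * m) * (full_count (l + s') Y * q ^+ (l * m) *
    \sum_(B : 'M[F]_(s', m) | row_full (col_mx A1 B)) f (pivots (col_mx A1 B))))) => [|A1 _]; last first.
  by rewrite sumr_const card_mx -[q ^+ (s * m)]natrX mulr_natl.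
rewrite -!mulr_sumr.
have -> : \sum_(A1 : 'M[F]_(l, m)) \sum_(B : 'M[F]_(s', m) | row_full (col_mx A1 B)) f (pivots (col_mx A1 B)) =
    \sum_(C : 'M[F]_(l + s', m) | \rank C == m) f (pivots C).
  by rewrite [RHS]big_mkcond sum_col_mx; apply: eq_bigr => A1 _; rewrite [LHS]big_mkcond.
rewrite sum_full_pivots //.
have -> : \sum_(T : {set 'I_(l + s')} | #|T| == m) f T / q ^+ (\sum_(i in T) i.+1 + 'C(m, 2)) =
    (esum x m * hl_shape x Y) / q ^+ (m + 'C(m, 2)).
  rewrite /hl_shape mulrCA hl_sum_pieri mulr_sumr mulr_suml; apply: eq_bigr => T /eqP cT.
  have -> : (\sum_(i in T) i.+1 = \sum_(i in T) i + m)%N.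
    by rewrite -cT -sum1_card -big_split; apply: eq_bigr => i _; rewrite /= addn1.
  rewrite /f !exprD; have := expf_neq0 (\sum_(i in T) i)%N q0.
  have := expf_neq0 'C(m, 2) q0; have := expf_neq0 m q0.
  move: (q ^+ m) (q ^+ 'C(m, 2)) (q ^+ (\sum_(i in T) i)%N) (q ^+ min_sum mu) (hl_sum _ _ _).
  by move=> a b c d e a0 b0 c0; field; rewrite a0 b0 c0.
rewrite /hl_count (mulnDl l s m) (exprD q (l * m)); move: (\prod_(j < m) _) (q ^+ (m + 'C(m, 2)))^-1 (full_count _ _) (hl_shape _ _) (esum _ _).
move: (q ^+ (l * m)) (q ^+ (s * m)) (q ^+ ((l + s') * m)).
by move=> a b c P v G h e; ring.
Qed.
End HallLittlewoodSums.

(** * Comparison of the two recursions *)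

Section FlagSumFormula.
Variables (F : finFieldType) (K : fieldType).
Hypothesis charK : forall k, (k%:R == 0 :> K) = (k == 0%N).
Local Notation q := (#|F|%:R : K).

Lemma q_sub_neq0 m j : (j < m)%N -> q ^+ m - q ^+ j != 0.
Proof.
by move=> jm; rewrite subr_eq0; apply/eqP => /(expq_inj charK) e; rewrite e ltnn in jm.
Qed.

Lemma layer_weight_neq0 m l : layer_weight F K m l != 0.
Proof.
rewrite mulf_neq0 ?expf_neq0 ?q_neq0 // prodf_seq_neq0.
by apply/allP => j; rewrite mem_index_iota => /andP[_]; apply: q_sub_neq0.
Qed.

(** The number of invertible intertwiners is a product of nonzero factors, so there is one. *)
Lemma nilpotent_conj B n (Y Z : 'M[F]_n) : Y ^+ B = 0 ->
  (forall k, \rank (Y ^+ k) = \rank (Z ^+ k)) ->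
  exists2 g, g \in unitmx & g *m Y = Z *m g.
Proof.
move=> nil e; have := card_intertwine K nil e.
case: (pickP (fun g => (g \in unitmx) && (g *m Y == Z *m g))) => [g /andP[ug /eqP eg] _|no].
  by exists g.
rewrite big_pred0 // => /esym/eqP/prodf_eq0[k _].
by rewrite (negPf (layer_weight_neq0 _ _)).
Qed.

Lemma extmx_nilpotent m p (A : 'M[F]_(p, m)) (Y : 'M[F]_p) :
  Y ^+ p = 0 -> extmx A Y ^+ (m + p) = 0.
Proof.
by move=> nil; apply: (@nilpotent_exp _ _ _ p.+1); rewrite extmx_exp nil mul0mx col_mx0.
Qed.

Variables (N : nat) (x : 'I_N -> K).
Hypotheses (inj_x : injective x) (x_neq0 : forall i, x i != 0).

(* The [j]-th vector of a tuple generating a flag is taken in [V_(j+1)], so that *)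
(* a jump at [i] multiplies the number of these tuples by [q ^ (N - i)].         *)
Definition flag_var (i : 'I_N) : K := x i / q ^+ (N - i).

(** The denominator [q ^+ (N - i)] of [flag_var] and [q ^+ i.+1] from [sum_full_pivots] multiply to
    [q ^+ N.+1], which does not depend on [i]; so an elementary symmetric polynomial remains. *)
Lemma sum_full_flag_var m :
  \sum_(C : 'M[F]_(N, m) | \rank C == m) \prod_(i in pivots C) flag_var i =
  \prod_(j < m) (q ^+ m - q ^+ j) / q ^+ (m + 'C(m, 2)) * esum x m.
Proof.
have q0 := q_neq0 F charK.
rewrite (@sum_full_pivots F K N m (fun T => \prod_(i in T) flag_var i)) // -!mulrA; congr (_ * _).
rewrite !mulr_sumr; apply: eq_bigr => T /eqP cT.
have -> : \prod_(i in T) flag_var i =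
    (\prod_(i in T) x i) * q ^+ (\sum_(i in T) i.+1) / q ^+ (N * m + m).
  have -> : (N * m + m = \sum_(i in T) (i.+1 + (N - i)))%N.
    rewrite (eq_bigr (fun=> N.+1)) => [|i _]; last by have := ltn_ord i; lia.
    by rewrite sum_nat_const cT; lia.
  rewrite -prodrXr -prodrXr -mulrA -prodfV -!big_split /=; apply: eq_bigr => i _.
  rewrite /flag_var exprD; have := expf_neq0 i.+1 q0; have := expf_neq0 (N - i) q0.
  by move: (x i) (q ^+ _) (q ^+ _) => a b c c0 b0; field; rewrite b0 c0.
rewrite !exprD; move: (expf_neq0 (N * m) q0) (expf_neq0 m q0) (expf_neq0 'C(m, 2) q0).
move: (expf_neq0 (\sum_(i in T) i.+1)%N q0).
move: (q ^+ (N * m)) (q ^+ m) (q ^+ 'C(m, 2)) (q ^+ (\sum_(i in T) i.+1)%N) (\prod_(i in T) x i).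
by move=> a b c d P d0 a0 b0 c0; field; rewrite a0 b0 c0 d0.
Qed.

(** [HL_v q^-1 N] is the value of [hl_sum] at [n = 0], and [q ^+ (n * N)] makes up for the factor
    [q ^+ (N * m)] that [hl_count_ext] has and [flag_sum_ext] has not. *)
Lemma flag_sumE n (Y : 'M[F]_n) : Y ^+ n = 0 ->
  flag_sum flag_var Y * q ^+ (n * N) * HL_v q^-1 N = hl_count x Y.
Proof.
have q0 := q_neq0 F charK; pose v := HL_v q^-1 N.
elim/ltn_ind: n Y => -[|n] IHn Y nil.
  rewrite mul0n mulr1 /hl_count full_countE /hl_shape /flag_sum.
  have sh i : shape Y i = 0%N by apply/eqP; rewrite -leqn0 shape_leq.
  have -> : \rank Y = 0%N by apply/eqP; rewrite -leqn0 rank_leq_row.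
  rewrite muln0 big_ord0 !mul1r (eq_hl_sum _ _ (fun i : 'I_N => sh i)) hl_sum0 //; last first.
    have q1 := q_sub_neq0 (ltn0Sn 0); rewrite expr1 expr0 in q1.
    by rewrite subr_eq0 eq_sym invr_eq1 -subr_eq0.
  rewrite (_ : min_sum _ = 0%N) ?mul1r; last first.
    by rewrite /min_sum big1 // => i _; rewrite big1 // => j _; rewrite !sh.
  rewrite (big_pred1 0) => [|M]; last by rewrite /= [M]thinmx0 eqxx; apply/eqP/eqP; rewrite -leqn0 rank_leq_row.
  rewrite /flag_weight big1 ?mul1r // => i _; rewrite (_ : _ - _ = 0)%N //.
  by apply/eqP; rewrite subn_eq0 (leq_trans (rank_leq_row _)).
(* The inner induction on the rank disposes of the extensions of the same size with a larger
   kernel. *)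
move: {2}(\rank Y).+1 (ltnSn (\rank Y)) => r.
elim: r Y nil => [//|r IHr] Y nil; rewrite ltnS => rYr.
have [p rY] : exists p, \rank Y = p by exists (\rank Y).
have lt_rn : (p < n.+1)%N.
  rewrite -rY ltn_neqAle rank_leq_row andbT; apply/negP => /eqP full.
  have uY : Y \in unitmx by rewrite -row_full_unit /row_full full.
  have uk k : Y ^+ k \in unitmx.
    by elim: k => [|k IHk]; rewrite ?expr0 ?unitmx1 // exprS -mulmxE unitmx_mul uY.
  by have := uk n.+1; rewrite nil -row_free_unit /row_free mxrank0.
have [m en] : exists m, n.+1 = (m + p)%N by exists (n.+1 - p)%N; rewrite subnK // ltnW.
move: (n.+1) en IHn Y nil IHr rY rYr lt_rn => n' -> IHn Y nil IHr rY rYr lt_rn.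
have [Q uQ [A0 [Z [eQ freeA0]]]] := extmx_exists rY.
have rQ k : \rank (Y ^+ k) = \rank (extmx A0 Z ^+ k) by apply: rank_conj uQ (conj_exp k eQ).
rewrite (flag_sum_conj _ uQ eQ) (eq_hl_count x rQ).
have nilZ : Z ^+ p = 0.
  have : Z ^+ (m + p) = 0.
    apply/eqP; rewrite -mxrank_eq0 -(mxrankMfree _ freeA0) -rank_extmx_exp -rQ.
    by rewrite exprSr nil mul0r mxrank0.
  exact: nilpotent_exp.
(* The defect of the identity at the extension by [A]. *)
pose D (A : 'M[F]_(p, m)) :=
  flag_sum flag_var (extmx A Z) * q ^+ ((m + p) * N) * v - hl_count x (extmx A Z).
apply/eqP; rewrite -subr_eq0 -/v -/(D A0).
have sumD : \sum_A D A = 0.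
  rewrite /D sumrB -!mulr_suml flag_sum_ext hl_count_ext // sum_full_flag_var.
  rewrite -(IHn p lt_rn Z nilZ) -/v; set P := \prod_(j < m) _; apply/eqP; rewrite subr_eq0; apply/eqP.
  rewrite (mulnDl m p N) (mulnC m N) (exprD _ (N * m)).
  move: (q ^+ (p * m)) (q ^+ (m + 'C(m, 2)))^-1 (q ^+ (N * m)) (q ^+ (p * N)) => a b c d.
  by move: (flag_sum _ _) (esum _ _) => e f; ring.
have freeD (A : 'M_(p, m)) : D A = if row_free (row_mx A Z) then D A0 else 0.
  case: ifP => freeA.
    have rA k : \rank (extmx A Z ^+ k) = \rank (extmx A0 Z ^+ k).
      by case: k => [|k]; rewrite ?expr0 // !rank_extmx_exp !mxrankMfree.
    have [g ug eg] := nilpotent_conj (extmx_nilpotent A nilZ) rA.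
    by rewrite /D (flag_sum_conj _ ug eg) (eq_hl_count x rA).
  apply/eqP; rewrite subr_eq0; apply/eqP; apply: IHr; first exact: extmx_nilpotent.
  rewrite -[extmx A Z]expr1 rank_extmx_exp expr0 mul1mx (leq_trans _ rYr) // rY.
  by rewrite ltn_neqAle rank_leq_row andbT -/(row_free _) freeA.
(* The defect is constant on the nonempty set of row free extensions and zero elsewhere; its sum is
   zero, hence so is the constant in characteristic zero. *)
move: sumD; rewrite (eq_bigr _ (fun A _ => freeD A)) -big_mkcond sumr_const => /eqP.
rewrite -mulr_natl mulf_eq0 charK => /orP[|//].
by move=> /eqP/card0_eq/(_ A0); rewrite -[A0 \in _]/(row_free (row_mx A0 Z)) freeA0.
Qed.
End FlagSumFormula.

(** * Profiles and colorings *)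

Section Tail.
Variable n : nat.

Definition tail_edge (gamma : indiff_graph n.+1) : rel 'I_n :=
  fun i j => gamma (lift ord0 i) (lift ord0 j).

Program Definition tail_graph (gamma : indiff_graph n.+1) : indiff_graph n :=
  @IndiffGraph n (tail_edge gamma) _ _ _.
Next Obligation. exact: edge_sym. Qed.
Next Obligation. exact: edge_irr. Qed.
Next Obligation.
by apply: (edge_indiff H); rewrite /= /bump !add1n.
Qed.

Variable gamma : indiff_graph n.+1.

Definition degree0 := #|[set i : 'I_n | gamma ord0 (lift ord0 i)]|.

Lemma degree0_leq : (degree0 <= n)%N.
Proof. by rewrite -[X in (_ <= X)%N]card_ord max_card. Qed.

(** By indifference the neighbors of the first vertex form an initial segment. *)
Lemma edge0 (i : 'I_n) : gamma ord0 (lift ord0 i) = (i < degree0)%N.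
Proof.
have := @decreasing_lt n (fun i => gamma ord0 (lift ord0 i) : nat) 0 i.
rewrite lt0b => -> //; last first.
  move=> j k; rewrite leq_eqVlt => /orP[/eqP/val_inj->//|jk].
  case: (boolP (gamma ord0 (lift ord0 k))) => //= e.
  by rewrite (edge_indiff e) //= /bump /= !add1n ltnS ltnW.
by congr (_ < _)%N; apply: eq_card => j; rewrite !inE lt0b.
Qed.
End Tail.

Section Colorings.
Variables (F : finFieldType) (N : nat).

Definition lower_mx n (gamma : indiff_graph n) : {set 'M[F]_n} :=
  [set Y : 'M[F]_n | [forall i : 'I_n, forall j : 'I_n, ((i <= j)%N || gamma j i) ==> (Y i j == 0)]].

Lemma lower_mxP n (gamma : indiff_graph n) (Y : 'M[F]_n) :
  reflect (forall i j : 'I_n, (i <= j)%N || gamma j i -> Y i j = 0) (Y \in lower_mx gamma).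
Proof.
rewrite inE; apply: (iffP forallP) => [H i j ij|H i].
  by have /forallP/(_ j)/implyP/(_ ij)/eqP := H i.
by apply/forallP => j; apply/implyP => ij; rewrite H.
Qed.

Lemma lower_mx_ext n (gamma : indiff_graph n.+1) (b : 'M[F]_(n, 1)) (Y : 'M[F]_n) :
  (extmx b Y \in lower_mx gamma) =
  (Y \in lower_mx (tail_graph gamma)) && (toprows (degree0 gamma) b == 0).
Proof.
have l0 : ord0 = lshift n (ord0 : 'I_1) :> 'I_(1 + n) by apply: val_inj.
have lS i : lift ord0 i = rshift 1 i :> 'I_(1 + n) by apply: val_inj.
have ext00 j : extmx b Y ord0 j = 0 by rewrite [X in extmx b Y X]l0 [LHS]col_mxEu mxE.
have ext0 i : extmx b Y (lift ord0 i) ord0 = b i ord0.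
  by rewrite lS [X in extmx b Y _ X]l0 [LHS]col_mxEd row_mxEl.
have extS i j : extmx b Y (lift ord0 i) (lift ord0 j) = Y i j.
  by rewrite !lS [LHS]col_mxEd row_mxEr.
apply/lower_mxP/andP => [H|[/lower_mxP HY /eqP hb] i j].
  split; first by apply/lower_mxP => i j ij; rewrite -extS H.
  apply/eqP/matrixP => i j; rewrite toprowsE mxE ord1.
  by case: ifP => // ik; rewrite -ext0 H // edge0 ik orbT.
case: (unliftP ord0 i) => [i' ->|-> _]; last exact: ext00.
case: (unliftP ord0 j) => [j' ->|->]; first by rewrite extS; apply: HY.
rewrite /= edge0 ext0 => ik; have := congr1 (fun B : 'M_(n, 1) => B i' ord0) hb.
by rewrite toprowsE ik mxE.
Qed.

(** A neighbor [i] of the first vertex is joined to every vertex in between, so that the whole row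
    [i] vanishes. *)
Lemma toprows_lower n (gamma : indiff_graph n.+1) (Y : 'M[F]_n) :
  Y \in lower_mx (tail_graph gamma) -> toprows (degree0 gamma) Y = 0.
Proof.
move=> /lower_mxP H; apply/matrixP => i j; rewrite toprowsE mxE; case: ifP => // ik.
apply: H; case: leqP => //= ji; rewrite /tail_edge.
have e : gamma ord0 (lift ord0 i) by rewrite edge0.
by apply: (edge_indiff e) => //=; rewrite /bump /= !add1n ltnS.
Qed.

Lemma lower_nilpotent n (gamma : indiff_graph n) (Y : 'M[F]_n) :
  Y \in lower_mx gamma -> Y ^+ n = 0.
Proof.
elim: n gamma Y => [|n IH] gamma Y; first by move=> _; rewrite [LHS]flatmx0 [RHS]flatmx0.
move=> HY; pose Z : 'M[F]_(1 + n) := Y.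
have eY : Z = extmx (dlsubmx Z) (drsubmx Z).
  rewrite /extmx /dlsubmx /drsubmx hsubmxK -{1}[Z]vsubmxK; congr (col_mx _ _).
  by apply/matrixP => i j; rewrite !mxE; move/lower_mxP: HY; apply; rewrite ord1.
rewrite -[Y]/Z in HY *.
move: HY; rewrite eY lower_mx_ext => /andP[/IH nil _].
by apply: (extmx_nilpotent (m := 1)).
Qed.

(** The inequality [kappa j < i] means that [j] is the last nonzero coordinate of some vector of
    [V_i]; dimensions of intersections with the coordinate flag express this. *)
Definition profile n (Y : 'M[F]_n) (M : 'M[F]_(N, n)) (kappa : 'I_n -> 'I_N) :=
  [forall i : 'I_N.+1, forall k : 'I_n.+1,
    \rank (krylov Y (toprows i M) :&: (pid_mx k : 'M_n))%MS ==
    #|[set j : 'I_n | (j < k)%N && (kappa j < i)%N]|].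

Lemma profileP n (Y : 'M[F]_n) (M : 'M[F]_(N, n)) (kappa : 'I_n -> 'I_N) :
  reflect (forall i k, (i <= N)%N -> (k <= n)%N ->
     \rank (krylov Y (toprows i M) :&: (pid_mx k : 'M_n))%MS =
     #|[set j : 'I_n | (j < k)%N && (kappa j < i)%N]|) (profile Y M kappa).
Proof.
apply: (iffP forallP) => [H i k iN kn|H i].
  by have /forallP/(_ (Ordinal (kn : k < n.+1)%N))/eqP := H (Ordinal (iN : i < N.+1)%N).
by apply/forallP => k; rewrite H // -ltnS.
Qed.

Lemma card_head_tail n (kappa : 'I_n.+1 -> 'I_N) i k :
  #|[set j : 'I_n.+1 | (j < k.+1)%N && (kappa j < i)%N]| =
  ((kappa ord0 < i) + #|[set j : 'I_n | (j < k)%N && (kappa (lift ord0 j) < i)%N]|)%N.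
Proof.
rewrite -!sum1_card [LHS]big_mkcond big_ord_recl inE /= [in RHS]big_mkcond.
congr (_ + _)%N.
by apply: eq_bigr => j _; rewrite !inE /= /bump add1n ltnS.
Qed.

(** The first coordinate spans the kernel of the projection, so the color of the first vertex is
    read off from the values of the relations. *)
Lemma profile_ext n (b : 'M[F]_(n, 1)) (Y : 'M[F]_n) (MW : 'M[F]_(N, 1)) (M : 'M[F]_(N, n))
    (kappa : 'I_n.+1 -> 'I_N) :
  profile (extmx b Y) (row_mx MW M) kappa =
  profile Y M (fun j => kappa (lift ord0 j)) &&
  [forall i : 'I_N.+1, \rank (relations Y M i *m col_mx MW b) == (kappa ord0 < i)%N :> nat].
Proof.
have e i k := rank_krylov_ext_pid b Y MW M i k.
apply/profileP/andP => [H|[/profileP H1 /forallP H2] i k iN].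
  have H2 i : (i <= N)%N -> \rank (relations Y M i *m col_mx MW b) = (kappa ord0 < i)%N :> nat.
    move=> iN; have := etrans (esym (H i 1%N iN isT)) (e i 0%N).
    have -> : (pid_mx 0 : 'M[F]_n) = 0 by apply/matrixP => r s; rewrite !mxE andbF.
    rewrite capmx0 mxrank0 add0n card_head_tail => <-.
    by rewrite [X in (_ + X)%N]eq_card0 ?addn0 // => j; rewrite inE.
  split; last by apply/forallP => i; rewrite H2 // -ltnS.
  apply/profileP => i k iN kn; have := etrans (esym (H i k.+1 iN kn)) (e i k).
  by rewrite card_head_tail H2 // addnC => /addIn.
case: k => [|k] kn.
  have -> : (pid_mx 0 : 'M[F]_n.+1) = 0 by apply/matrixP => r s; rewrite !mxE andbF.
  by rewrite capmx0 mxrank0 eq_card0 // => j; rewrite inE.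
apply: etrans (e i k) _; rewrite card_head_tail H1 // addnC; congr (_ + _)%N.
by apply/eqP; have := H2 (Ordinal (iN : i < N.+1)%N).
Qed.

(* The vectors [z] killed by the relations of [V_i] and vanishing on the first  *)
(* [k] coordinates of [b]; [toprows k Y = 0] makes the relations that only      *)
(* involve these coordinates trivial.                                           *)
Lemma card_relations_kill n k (Y : 'M[F]_n) (M : 'M[F]_(N, n)) i :
  toprows k Y = 0 -> (i <= N)%N -> (k <= n)%N ->
  #|[set z : 'M[F]_(N + n, 1) | (toprows k (dsubmx z) == 0) && (relations Y M i *m z == 0)]| =
  (#|F| ^ (N + n + \rank (krylov Y (toprows i M) :&: (pid_mx k : 'M_n))%MS - (i + k)))%N.
Proof.
move=> kY iN kn; pose E : 'M[F]_(n, N + n) := row_mx 0 (pid_mx k).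
pose S := col_mx (relations Y M i) E.
transitivity #|[set z : 'M[F]_(N + n, 1) | S *m z == S *m 0]|.
  apply: eq_card => z; rewrite !inE mulmx0 /S mul_col_mx.
  have -> : E *m z = toprows k (dsubmx z).
    by rewrite -{1}[z]vsubmxK /E mul_row_col mul0mx add0r.
  rewrite -[X in _ = (_ == X)]col_mx0 andbC.
  by apply/andP/eqP => [[/eqP-> /eqP->]//|/eq_col_mx[-> ->]]; rewrite !eqxx.
rewrite card_mulmx_eq mul1n; congr (_ ^ _)%N.
have := mxrank_sum_cap (relations Y M i) E; rewrite -rank_col_mx -/S rank_relations //.
have -> : \rank E = k by rewrite /E rank_row_0mx rank_pid_mx.
have -> : \rank (relations Y M i :&: E) = \rank (krylov Y (toprows i M) :&: (pid_mx k : 'M_n))%MS.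
  rewrite -[RHS](rank_row_0mx N); apply/eqmx_rank/andP; split.
    set U := (_ :&: E)%MS; have /submxP[X eX] : (U <= E)%MS by apply: capmxSr.
    have : (U <= block_mx (pid_mx i : 'M_N) 0 0 (krylov Y (toprows i M)))%MS.
      exact: submx_trans (capmxSl _ _) (capmxSl _ _).
    case/submxP=> X'; rewrite -[X']hsubmxK mul_row_block !mulmx0 addr0 add0r => eX'.
    have : X *m E = row_mx (lsubmx X' *m pid_mx i) (rsubmx X' *m krylov Y (toprows i M)).
      by rewrite -eX -eX'.
    rewrite mul_mx_row => /eq_row_mx[_ e]; have sW : (X *m (pid_mx k : 'M_n) <= krylov Y (toprows i M) :&: (pid_mx k : 'M_n))%MS.
      by rewrite sub_capmx submxMl andbT e submxMl.
    by rewrite eX mul_mx_row mulmx0; case/submxP: sW => Z ->; rewrite -[0](mulmx0 _ Z) -mul_mx_row submxMl.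
  set W := (_ :&: (pid_mx k : 'M_n))%MS.
  have /submxP[X eX] : (W <= krylov Y (toprows i M))%MS by apply: capmxSl.
  have /submxP[X' eX'] : (W <= (pid_mx k : 'M_n))%MS by apply: capmxSr.
  rewrite !sub_capmx sub_kermx mul_row_col mul0mx add0r; apply/andP; split; first apply/andP; first split.
  - have -> : row_mx 0 W = row_mx 0 X *m block_mx (pid_mx i : 'M_N) 0 0 (krylov Y (toprows i M)).
      by rewrite mul_row_block !mulmx0 mul0mx addr0 add0r -eX.
    exact: submxMl.
  - by rewrite eX' -mulmxA -/(toprows k Y) kY mulmx0.
  by rewrite eX' -[0](mulmx0 _ X') -mul_mx_row submxMl.
by move=> e; have := rank_leq_col S; lia.
Qed.

Lemma card_lt_step n (kappa : 'I_n -> 'I_N) i (k : 'I_n) :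
  #|[set j : 'I_n | (j < k.+1)%N && (kappa j < i)%N]| =
  (#|[set j : 'I_n | (j < k)%N && (kappa j < i)%N]| + (kappa k < i)%N)%N.
Proof.
rewrite -!sum1_card [LHS](bigID (pred1 k)) /= addnC; congr (_ + _)%N.
  apply: eq_bigl => j; rewrite !inE ltnS [(j < k)%N]ltn_neqAle -[j != k]/(j != k :> nat).
  by rewrite andbC andbA.
rewrite (eq_bigl (fun j => (j == k) && (kappa k < i)%N)); last first.
  by move=> j; rewrite inE andbC; case: eqP => //= ->; rewrite ltnS leqnn.
case: (_ < _)%N; first by rewrite (eq_bigl _ _ (fun j => andbT _)) big_pred1_eq.
by rewrite (eq_bigl _ _ (fun j => andbF _)) big_pred0_eq.
Qed.

Lemma profile_full n (Y : 'M[F]_n) (M : 'M[F]_(N, n)) (kappa : 'I_n -> 'I_N) :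
  profile Y M kappa -> \rank (krylov Y M) = n.
Proof.
move=> /profileP/(_ N n (leqnn N) (leqnn n)); rewrite toprows_id // pid_mx_1.
rewrite (capmx_idPl (submx1 _)) => ->; rewrite -[RHS]card_ord; apply: eq_card => j.
by rewrite !inE !ltn_ord.
Qed.

Lemma profile_inj n (Y : 'M[F]_n) (M : 'M[F]_(N, n)) (kappa1 kappa2 : 'I_n -> 'I_N) :
  profile Y M kappa1 -> profile Y M kappa2 -> kappa1 =1 kappa2.
Proof.
move=> /profileP H1 /profileP H2 j.
have lt i : (i <= N)%N -> (kappa1 j < i)%N = (kappa2 j < i)%N.
  move=> iN; have := card_lt_step kappa2 i j; rewrite -!H2 ?(ltnW (ltn_ord j)) //.
  rewrite !H1 ?(ltnW (ltn_ord j)) // card_lt_step => /addnI.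
  by case: (_ < _)%N; case: (_ < _)%N.
apply: val_inj; apply/eqP; rewrite /= eqn_leq; apply/andP; split.
  by have := lt (kappa2 j).+1 (ltn_ord _); rewrite !ltnS leqnn.
by have := lt (kappa1 j).+1 (ltn_ord _); rewrite !ltnS leqnn => <-.
Qed.

Lemma profile_exists n (Y : 'M[F]_n) (M : 'M[F]_(N, n)) :
  \rank (krylov Y M) = n -> exists kappa : 'I_n -> 'I_N, profile Y M kappa.
Proof.
move=> full; pose V i := krylov Y (toprows i M).
(* [c i j] is 1 if [j] is the last nonzero coordinate of a vector of [V i], and 0 otherwise. It
   increases with [i] from 0 to 1. *)
pose c i (j : 'I_n) := \rank ((V i :&: (pid_mx j.+1 : 'M_n))%MS *m (delta_mx j 0 : 'cV_n)).
have step i (j : 'I_n) : \rank (V i :&: (pid_mx j.+1 : 'M_n))%MS =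
    (\rank (V i :&: (pid_mx j : 'M_n))%MS + c i j)%N.
  rewrite -(mxrank_mul_ker _ (delta_mx j 0 : 'cV_n)) addnC; congr (_ + _)%N.
  have pidP r (v : 'M[F]_(r, n)) k : (v <= (pid_mx k : 'M_n))%MS =
      [forall a, forall b : 'I_n, (k <= b)%N ==> (v a b == 0)].
    apply/submxP/forallP => [[X ->] a|H].
      apply/forallP => b; apply/implyP => kb; rewrite mxE big1 // => l _.
      by rewrite mxE; case: eqP => [->|_]; rewrite /= ?(leq_gtF kb) mulr0.
    exists v; apply/matrixP => a b; rewrite mxE (bigD1 b) //= big1 ?addr0 => [|l lb].
      rewrite mxE eqxx /=; case: ltnP => kb; rewrite ?mulr1 ?mulr0 //.
      by have /forallP/(_ b)/implyP/(_ kb)/eqP := H a.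
    by rewrite mxE (negPf (lb : l != b :> nat)) mulr0.
  have colP r (v : 'M[F]_(r, n)) : v *m (delta_mx j 0 : 'cV_n) = col j v by rewrite colE.
  apply/eqmx_rank/andP; split; rewrite !sub_capmx; last first.
    rewrite capmxSl /= sub_kermx colP; apply/andP; split.
      have := capmxSr (V i) (pid_mx j : 'M_n); rewrite !pidP => /forallP H.
      apply/forallP => a; apply/forallP => b; apply/implyP => jb.
      by have /forallP/(_ b)/implyP := H a; apply; apply: ltnW.
    have := capmxSr (V i) (pid_mx j : 'M_n); rewrite pidP => /forallP H.
    apply/eqP/matrixP => a b; rewrite mxE [RHS]mxE.
    by have /forallP/(_ j)/implyP/(_ (leqnn j))/eqP := H a.
  set W := (_ :&: kermx _)%MS; have W1 : (W <= V i :&: (pid_mx j.+1 : 'M_n))%MS by apply: capmxSl.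
  have : W *m (delta_mx j 0 : 'cV_n) = 0 by apply/sub_kermxP/capmxSr.
  move: W1; rewrite sub_capmx pidP colP => /andP[-> /forallP H] /matrixP W0 /=.
  rewrite pidP; apply/forallP => a; apply/forallP => b; apply/implyP.
  rewrite leq_eqVlt => /orP[/eqP/val_inj<-|jb].
    by have := W0 a 0; rewrite !mxE => ->.
  by have /forallP/(_ b)/implyP := H a; apply.
have cmono j i1 i2 : (i1 <= i2)%N -> (c i1 j <= c i2 j)%N.
  by move=> i12; apply/mxrankS/submxMr/capmxS => //; apply/krylovS/toprows_sub.
have c0 j : c 0%N j = 0%N.
  apply/eqP; rewrite mxrank_eq0 /V toprows0.
  suff -> : krylov Y (0 : 'M[F]_(N, n)) = 0 by rewrite cap0mx mul0mx.
  by apply/eqP; rewrite -submx0; apply: krylov_min; rewrite ?mul0mx sub0mx.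
have cN j : c N j = 1%N.
  have r k : (k <= n)%N -> \rank (V N :&: (pid_mx k : 'M_n))%MS = k.
    move=> kn; rewrite (capmx_idPr _) ?rank_pid_mx //.
    by apply: submx_full; rewrite /row_full /V toprows_id // full.
  by have := step N j; rewrite !r ?(ltnW (ltn_ord j)) // -addn1 => /addnI.
have c1 i j : (c i j <= 1)%N by apply: rank_leq_col.
(* The color of [j] is the number of [i] with [c i.+1 j = 0]. These form an initial segment, to
   which [decreasing_lt] applies through the indicator [nu j]. *)
pose nu j (i : 'I_N) := (c i.+1 j == 0%N : nat).
have nuP j (i : 'I_N) : (c i.+1 j == 0)%N = (i < #|[set i : 'I_N | 0 < nu j i]%N|)%N.
  rewrite -decreasing_lt ?lt0b // => i1 i2 i12; rewrite /nu.
  by have := cmono j i1.+1 i2.+1 i12; case: (c i1.+1 j); case: (c i2.+1 j).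
have ltN j : (#|[set i : 'I_N | 0 < nu j i]%N| < N)%N.
  have N0 : (0 < N)%N.
    by case: (posnP N) => // e; have := congr1 (c^~ j) e; rewrite cN c0.
  have lt : (N.-1 < N)%N by rewrite prednK.
  rewrite ltnNge; apply/negP => NS; have := nuP j (Ordinal lt); rewrite /= prednK // cN.
  by rewrite NS.
exists (fun j => Ordinal (ltN j)); apply/profileP => i k iN.
elim: k => [|k IH] kn.
  have -> : (pid_mx 0 : 'M[F]_n) = 0 by apply/matrixP => r s; rewrite !mxE andbF.
  by rewrite capmx0 mxrank0 eq_card0 // => j; rewrite inE.
apply: etrans (step i (Ordinal kn)) _; rewrite [X in (X + _)%N](IH (ltnW kn)).
apply/esym; apply: etrans (card_lt_step _ _ (Ordinal kn)) _; congr (_ + _)%N.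
set j := Ordinal kn; case: i iN {IH} => [|i] iN; first by rewrite c0.
have e := nuP j (Ordinal iN); rewrite /= in e; rewrite /= ltnS leqNgt -e.
by have := c1 i.+1 j; case: (c i.+1 j) => [|[|]].
Qed.
End Colorings.

(** * The number of pairs with a given coloring *)

Section ColoringCount.
Variables (F : finFieldType) (N : nat) (K : fieldType).
Hypothesis charK : forall k, (k%:R == 0 :> K) = (k == 0%N).
Local Notation q := (#|F|%:R : K).

Lemma sum_lower_mx n (gamma : indiff_graph n.+1) (f : 'M[F]_n.+1 -> K) :
  \sum_(Y in lower_mx F gamma) f Y =
  \sum_(Y in lower_mx F (tail_graph gamma))
    \sum_(b : 'M[F]_(n, 1) | toprows (degree0 gamma) b == 0) f (extmx b Y).
Proof.
rewrite big_mkcond (@sum_col_mx F _ 1 n (1 + n)) (bigD1 0) //= [X in _ + X]big1 => [|u nu].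
  rewrite addr0 (@sum_row_mx F _ n 1 n) exchange_big [RHS]big_mkcond /=.
  apply: eq_bigr => Y _; rewrite [in RHS]big_mkcond; case: ifP => HY.
    by apply: eq_bigr => b _; rewrite lower_mx_ext HY.
  by rewrite big1 // => b _; rewrite lower_mx_ext HY.
rewrite big1 // => B _; case: ifP => // /lower_mxP H; case/eqP: nu.
apply/matrixP => i j; rewrite mxE -(col_mxEu u B i j); apply: H.
by rewrite ord1.
Qed.

Lemma card_killed n (gamma : indiff_graph n.+1) :
  \sum_(b : 'M[F]_(n, 1) | toprows (degree0 gamma) b == 0) (1 : K) = q ^+ (n - degree0 gamma).
Proof.
have := card_mulmx_eq (pid_mx (degree0 gamma) : 'M[F]_n) (0 : 'M_(n, 1)).
rewrite mul1n rank_pid_mx ?degree0_leq // => e; rewrite sumr_const -natrX -e.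
by congr _%:R; apply: eq_card => b; rewrite !inE mulmx0 unfold_in.
Qed.

Lemma sum_bool_set (T : finType) (P Q : pred T) : (forall z, Q z -> P z) ->
  \sum_(z | P z && ~~ Q z) (1 : K) = #|[set z | P z]|%:R - #|[set z | Q z]|%:R.
Proof.
move=> QP; rewrite -!sum1_card !natr_sum; apply/eqP; rewrite eq_sym subr_eq; apply/eqP.
rewrite (eq_bigl P) => [|z]; last by rewrite inE.
rewrite [X in _ = _ + X](eq_bigl Q) => [|z]; last by rewrite inE.
rewrite (bigID Q) /= addrC; congr (_ + _); apply: eq_bigl => z.
by apply: andb_idl; apply: QP.
Qed.

(** Stated for functions instead of [{ffun}], so that colorings restrict to the tail by
    composition. *)
Definition proper n (gamma : indiff_graph n) (kappa : 'I_n -> 'I_N) :=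
  [forall i, forall j, gamma i j ==> (kappa i != kappa j)].

Definition descents n (gamma : indiff_graph n) (kappa : 'I_n -> 'I_N) (i : 'I_n) :=
  #|[set j : 'I_n | [&& (i < j)%N, gamma i j & (kappa j < kappa i)%N]]|.

Lemma proper_tail n (gamma : indiff_graph n.+1) (kappa : 'I_n.+1 -> 'I_N) :
  proper gamma kappa = proper (tail_graph gamma) (fun j => kappa (lift ord0 j)) &&
    [forall j : 'I_n, (j < degree0 gamma)%N ==> (kappa (lift ord0 j) != kappa ord0)].
Proof.
apply/forallP/andP => [H|[/forallP H1 /forallP H2] i].
  split; apply/forallP => i.
    by apply/forallP => j; have /forallP/(_ (lift ord0 j)) := H (lift ord0 i).
  by have /forallP/(_ (lift ord0 i)) := H ord0; rewrite edge0 eq_sym.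
apply/forallP => j; case: (unliftP ord0 i) => [i' ->|->]; case: (unliftP ord0 j) => [j' ->|->].
- by have /forallP/(_ j') := H1 i'.
- by rewrite edge_sym edge0; apply: H2.
- by rewrite edge0 eq_sym; apply: H2.
by rewrite edge_irr.
Qed.

Lemma descents_tail n (gamma : indiff_graph n.+1) (kappa : 'I_n.+1 -> 'I_N) (i : 'I_n) :
  descents gamma kappa (lift ord0 i) =
  descents (tail_graph gamma) (fun j => kappa (lift ord0 j)) i.
Proof.
rewrite /descents -!sum1_card [LHS]big_mkcond big_ord_recl inE /= add0n [RHS]big_mkcond.
by apply: eq_bigr => j _; rewrite !inE /= /bump !add1n ltnS.
Qed.

Lemma descents0 n (gamma : indiff_graph n.+1) (kappa : 'I_n.+1 -> 'I_N) :
  descents gamma kappa ord0 =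
  #|[set j : 'I_n | (j < degree0 gamma)%N && (kappa (lift ord0 j) < kappa ord0)%N]|.
Proof.
rewrite /descents -!sum1_card [LHS]big_mkcond big_ord_recl inE /= add0n [RHS]big_mkcond.
by apply: eq_bigr => j _; rewrite !inE /= edge0.
Qed.

(** The block column [z] of [MW] and [b] has to be killed by [relations Y M c] and not by
    [relations Y M c.+1]; [card_relations_kill] counts both conditions. The neighbors of the first
    vertex form a clique, so at most one of them has color [c]. If there is one, the two counts
    agree; otherwise their ratio is [q], which gives the factor [q - 1]. *)
Lemma card_color_ext n (gamma : indiff_graph n.+1) (kappa : 'I_n.+1 -> 'I_N)
    (Y : 'M[F]_n) (M : 'M[F]_(N, n)) :
  Y \in lower_mx F (tail_graph gamma) ->
  profile Y M (fun j => kappa (lift ord0 j)) ->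
  proper (tail_graph gamma) (fun j => kappa (lift ord0 j)) ->
  \sum_(b : 'M[F]_(n, 1) | toprows (degree0 gamma) b == 0) \sum_(MW : 'M[F]_(N, 1))
     ([forall i : 'I_N.+1, \rank (relations Y M i *m col_mx MW b) == (kappa ord0 < i)%N :> nat])%:R =
  if [forall j : 'I_n, (j < degree0 gamma)%N ==> (kappa (lift ord0 j) != kappa ord0)]
  then q ^+ (n - degree0 gamma) * ((q - 1) * q ^+ (N.-1 - kappa ord0) * q ^+ descents gamma kappa ord0)
  else 0 :> K.
Proof.
move=> HY prof prop; set k := degree0 gamma; set c := kappa ord0.
pose P i (z : 'M[F]_(N + n, 1)) := (toprows k (dsubmx z) == 0) && (relations Y M i *m z == 0).
have PS i j z : (i <= j)%N -> P j z -> P i z.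
  move=> ij /andP[kz /eqP e]; rewrite /P kz /=.
  by have /submxP[X ->] := relationsS Y M ij; rewrite -mulmxA e mulmx0.
transitivity (\sum_(z | P c z && ~~ P c.+1 z) (1 : K)).
  rewrite [RHS]big_mkcond sum_col_mx [RHS]exchange_big [LHS]big_mkcond /=; apply: eq_bigr => b _.
  case: ifP => kb; last by rewrite big1 // => MW _; rewrite /P col_mxKd kb.
  apply: eq_bigr => MW _; rewrite {1 2}/P col_mxKd kb /=; set z := col_mx MW b.
  have r1 i : (\rank (relations Y M i *m z) <= 1)%N by apply: rank_leq_col.
  have -> : [forall i : 'I_N.+1, \rank (relations Y M i *m z) == (c < i)%N :> nat] =
      (relations Y M c *m z == 0) && (relations Y M c.+1 *m z != 0).
    apply/forallP/andP => [H|[/eqP e0 e1] i].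
      have c1 : (c < N.+1)%N by apply: leqW.
      have c2 : (c.+1 < N.+1)%N by rewrite ltnS.
      have := H (Ordinal c1); have := H (Ordinal c2); rewrite /= ltnn ltnSn.
      by rewrite -!mxrank_eq0 => /eqP-> /eqP->.
    have Pz j : P j z = (relations Y M j *m z == 0) by rewrite /P col_mxKd kb.
    case: ltnP => ci /=.
      rewrite eqn_leq r1 lt0n mxrank_eq0 -Pz; apply: contra e1; rewrite -Pz; exact: PS.
    by rewrite mxrank_eq0 -Pz (PS _ c) // Pz e0.
  by case: ifP.
rewrite sum_bool_set; last by move=> z; apply: PS.
have kn := degree0_leq gamma; rewrite -/k in kn.
have cN := ltn_ord c.
rewrite !card_relations_kill ?toprows_lower // ?(ltnW cN) //.
rewrite !(profileP _ _ _ prof) ?(ltnW cN) //.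
rewrite descents0 -/c -/k; set d := #|_|.
(* Among the neighbors of the first vertex, [d] have a color less than [c], [d'] a color at most
   [c], and [e] the color [c]. *)
set d' := #|_|; pose e := #|[set j : 'I_n | (j < k)%N && (kappa (lift ord0 j) == c)]|.
have ed : (d' = d + e)%N.
  rewrite -cardsUI [X in (_ + X)%N](_ : _ = 0%N) ?addn0.
    by apply: eq_card => j; rewrite !inE -andb_orr ltnS [(_ <= c)%N]leq_eqVlt orbC.
  by apply: eq_card0 => j; rewrite !inE; case: eqP => [->|]; rewrite ?ltnn ?andbF.
have e1 : (e <= 1)%N.
  rewrite leqNgt; apply/negP => /card_gt1P[i [j []]]; rewrite !inE.
  move=> /andP[ik /eqP ei] /andP[jk /eqP ej] ij.
  have adj (a b : 'I_n) : (a < b)%N -> (b < k)%N -> tail_graph gamma a b.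
    move=> ab bk; have g : gamma ord0 (lift ord0 b) by rewrite edge0.
    by apply: (edge_indiff g) => //=; rewrite /bump /= !add1n ltnS.
  have /forallP H := prop; case: (ltngtP i j) => [lt|lt|/val_inj eij].
  - by have /forallP/(_ j)/implyP := H i; rewrite ei ej eqxx => /(_ (adj _ _ lt jk)).
  - by have /forallP/(_ i)/implyP := H j; rewrite ei ej eqxx => /(_ (adj _ _ lt ik)).
  by rewrite eij eqxx in ij.
have dk : (d <= k)%N.
  rewrite -[X in (_ <= X)%N](card_ord_lt kn); apply: subset_leq_card.
  by apply/subsetP => j; rewrite !inE => /andP[].
have -> : [forall j : 'I_n, (j < k)%N ==> (kappa (lift ord0 j) != c)] = (e == 0%N).
  rewrite cards_eq0; apply/forallP/eqP => [H|/setP H j].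
    by apply/setP => j; rewrite !inE; have := H j; case: (j < k)%N => //= /negPf.
  by have := H j; rewrite !inE; case: (j < k)%N => //= ->.
rewrite ed; case: eqP => [->|ne]; last first.
  have -> : e = 1%N by lia.
  have -> : (N + n + (d + 1) - (c.+1 + k) = N + n + d - (c + k))%N by lia.
  by rewrite subrr.
rewrite addn0 !natrX.
have -> : (N + n + d - (c.+1 + k) = (n - k) + (N.-1 - c) + d)%N by lia.
have -> : (N + n + d - (c + k) = ((n - k) + (N.-1 - c) + d).+1)%N by lia.
by rewrite exprS !exprD; ring.
Qed.

Lemma card_profile n (gamma : indiff_graph n) (kappa : 'I_n -> 'I_N) :
  \sum_(Y in lower_mx F gamma) \sum_(M : 'M[F]_(N, n)) (profile Y M kappa)%:R =
  if proper gamma kappa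
  then #|lower_mx F gamma|%:R *
       \prod_i ((q - 1) * q ^+ (N.-1 - kappa i) * q ^+ descents gamma kappa i)
  else 0 :> K.
Proof.
elim: n gamma kappa => [|n IH] gamma kappa.
  have -> : proper gamma kappa by apply/forallP => -[].
  rewrite big_ord0 mulr1 -[RHS]sumr_const; apply: eq_bigr => Y _.
  rewrite (big_pred1 0) => [|M]; last by rewrite /= [M]thinmx0 eqxx.
  have -> // : profile Y 0 kappa.
  apply/profileP => i k _ _; rewrite [LHS](_ : _ = 0%N); last by apply/eqP; rewrite -leqn0 rank_leq_row.
  by rewrite eq_card0 // => -[].
pose kappa' j := kappa (lift ord0 j).
rewrite sum_lower_mx proper_tail.
have cL : #|lower_mx F gamma|%:R = #|lower_mx F (tail_graph gamma)|%:R * q ^+ (n - degree0 gamma) :> K.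
  have cE m (g : indiff_graph m) : #|lower_mx F g|%:R = \sum_(Y in lower_mx F g) 1 :> K by rewrite sumr_const.
  rewrite !cE sum_lower_mx mulr_suml; apply: eq_bigr => Y _.
  by rewrite card_killed mul1r.
pose w := if [forall j : 'I_n, (j < degree0 gamma)%N ==> (kappa' j != kappa ord0)]
  then q ^+ (n - degree0 gamma) * ((q - 1) * q ^+ (N.-1 - kappa ord0) * q ^+ descents gamma kappa ord0)
  else 0 : K.
transitivity (\sum_(Y in lower_mx F (tail_graph gamma)) \sum_(M : 'M[F]_(N, n))
   (profile Y M kappa')%:R * (if proper (tail_graph gamma) kappa' then w else
     \sum_(b : 'M[F]_(n, 1) | toprows (degree0 gamma) b == 0) \sum_(MW : 'M[F]_(N, 1))
     ([forall i : 'I_N.+1, \rank (relations Y M i *m col_mx MW b) == (kappa ord0 < i)%N :> nat])%:R)).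
  apply: eq_bigr => Y HY.
  transitivity (\sum_(M : 'M[F]_(N, n)) \sum_(b : 'M[F]_(n, 1) | toprows (degree0 gamma) b == 0)
      \sum_(MW : 'M[F]_(N, 1)) (profile (extmx b Y) (row_mx MW M) kappa)%:R : K).
    rewrite [RHS]exchange_big /=; apply: eq_bigr => b _.
    by rewrite (@sum_row_mx F _ N 1 n) exchange_big.
  apply: eq_bigr => M _.
  transitivity ((profile Y M kappa')%:R * \sum_(b : 'M[F]_(n, 1) | toprows (degree0 gamma) b == 0)
      \sum_(MW : 'M[F]_(N, 1))
     ([forall i : 'I_N.+1, \rank (relations Y M i *m col_mx MW b) == (kappa ord0 < i)%N :> nat])%:R : K).
    rewrite mulr_sumr; apply: eq_bigr => b _; rewrite mulr_sumr; apply: eq_bigr => MW _.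
    by rewrite profile_ext -mulnb natrM.
  case: (boolP (profile Y M kappa')) => [prof|_]; last by rewrite !mul0r.
  by congr (_ * _); case: ifP => // prop; rewrite card_color_ext.
case: (boolP (proper (tail_graph gamma) kappa')) => [pr|npr] /=.
  under eq_bigr => Y _ do rewrite -mulr_suml.
  rewrite -mulr_suml IH pr /w cL big_ord_recl; case: ifP => _; last by rewrite mulr0.
  rewrite -!mulrA; congr (_ * _); rewrite mulrC -!mulrA; do 4!congr (_ * _).
  by apply: eq_bigr => i _; rewrite descents_tail -!mulrA.
(* If the restriction is not proper, the induction hypothesis is a vanishing sum of natural numbers,
   so that no pair has profile [kappa']. *)
have := IH (tail_graph gamma) kappa'; rewrite (negPf npr) => no.
have noprof Y M : Y \in lower_mx F (tail_graph gamma) -> profile Y M kappa' = false.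
  move=> HY; have /eqP : (\sum_(Y in lower_mx F (tail_graph gamma)) \sum_(M : 'M[F]_(N, n))
      (profile Y M kappa' : nat))%:R = 0 :> K.
    by rewrite natr_sum -[RHS]no; apply: eq_bigr => Z _; rewrite natr_sum.
  rewrite charK sum_nat_eq0 => /forallP/(_ Y)/implyP/(_ HY).
  by rewrite sum_nat_eq0 => /forallP/(_ M)/=; case: (profile _ _ _).
by rewrite big1 // => Y HY; rewrite big1 // => M _; rewrite noprof // mul0r.
Qed.
End ColoringCount.

(** * Normalization of Hall-Littlewood polynomials *)

Section FlagSumColorings.
Variables (F : finFieldType) (K : fieldType).
Hypothesis charK : forall k, (k%:R == 0 :> K) = (k == 0%N).
Local Notation q := (#|F|%:R : K).

Lemma flag_weight_profile N (y : 'I_N -> K) n (Y : 'M[F]_n) (M : 'M[F]_(N, n)) (kappa : 'I_n -> 'I_N) :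
  profile Y M kappa -> flag_weight y Y M = \prod_j y (kappa j).
Proof.
move=> /profileP prof; rewrite (partition_big kappa xpredT) //=; apply: eq_bigr => i _.
have dimE k : (k <= N)%N -> flag_dim Y M k = #|[set j : 'I_n | (kappa j < k)%N]|.
  move=> kN; have := prof k n kN (leqnn n); rewrite pid_mx_1 (capmx_idPl (submx1 _)) => e.
  by rewrite /flag_dim e; apply: eq_card => j; rewrite !inE ltn_ord.
rewrite !dimE // ?(ltnW (ltn_ord i)) // (eq_bigr (fun=> y i)) => [|j /eqP->] //.
rewrite prodr_const; congr (_ ^+ _).
have -> : #|[set j : 'I_n | (kappa j < i.+1)%N]| =
    (#|[set j : 'I_n | (kappa j < i)%N]| + #|[set j : 'I_n | kappa j == i]|)%N.
  rewrite -cardsUI [X in (_ + X)%N](_ : _ = 0%N) ?addn0.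
    by apply: eq_card => j; rewrite !inE ltnS leq_eqVlt orbC.
  by apply: eq_card0 => j; rewrite !inE; case: eqP => [->|]; rewrite ?ltnn ?andbF.
by rewrite addKn; apply: eq_card => j; rewrite inE.
Qed.

Lemma flag_sum_profile N (y : 'I_N -> K) n (Y : 'M[F]_n) :
  flag_sum y Y = \sum_(kappa : {ffun 'I_n -> 'I_N})
     (\prod_j y (kappa j)) * \sum_(M : 'M[F]_(N, n)) (profile Y M kappa)%:R.
Proof.
under eq_bigr => kappa _ do rewrite mulr_sumr.
rewrite exchange_big /flag_sum big_mkcond /=; apply: eq_bigr => M _; case: eqP => [full|nfull].
  have [kappa prof] := profile_exists full.
  have prof' : profile Y M (finfun kappa).
    by apply/profileP => i k iN kn; rewrite (profileP _ _ _ prof) //; apply: eq_card => j; rewrite !inE ffunE.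
  rewrite (flag_weight_profile y prof') (bigD1 (finfun kappa)) //= prof' mulr1.
  rewrite [X in _ + X]big1 ?addr0 // => kappa' ne; case: (boolP (profile Y M kappa')) => [p|_]; last by rewrite mulr0.
  by case/eqP: ne; apply/ffunP => j; apply: profile_inj p prof' j.
rewrite big1 // => kappa _; case: (boolP (profile Y M kappa)) => [p|_]; last by rewrite mulr0.
by case: nfull; apply: profile_full p.
Qed.

(** A vertex of color [i] has [(q - 1) * q ^+ (N.-1 - i)] from the count and [q ^- (N - i)] from
    [flag_var], hence the factor [(q - 1) / q] for every color. *)
Lemma sum_lower_flag_sum N (x : 'I_N -> K) n (gamma : indiff_graph n) :
  \sum_(Y in lower_mx F gamma) flag_sum (flag_var F x) Y =
  #|lower_mx F gamma|%:R * ((q - 1) / q) ^+ n *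
  \sum_(kappa : {ffun 'I_n -> 'I_N} | proper gamma kappa)
     \prod_i (q ^+ descents gamma kappa i * x (kappa i)).
Proof.
have q0 := q_neq0 F charK.
under eq_bigr => Y _ do rewrite flag_sum_profile.
rewrite exchange_big /= mulr_sumr [RHS]big_mkcond /=; apply: eq_bigr => kappa _.
rewrite -mulr_sumr card_profile //; case: ifP => _; last by rewrite mulr0.
rewrite mulrCA -mulrA; congr (_ * _).
have -> : ((q - 1) / q) ^+ n = \prod_(i < n) ((q - 1) / q) by rewrite prodr_const card_ord.
rewrite -!big_split /=; apply: eq_bigr => i _; rewrite /flag_var.
have -> : (N - kappa i = (N.-1 - kappa i).+1)%N by have := ltn_ord (kappa i); lia.
rewrite exprS; have := expf_neq0 (N.-1 - kappa i) q0.
move: (q ^+ (N.-1 - _)) (q ^+ descents gamma kappa i) (x (kappa i)) => a b c a0.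
by move: q0; move: q => Q Q0; field; rewrite Q0 a0.
Qed.

Lemma hl_sum_perm N (x : 'I_N -> K) t nu (s : 'S_N) : hl_sum (x \o s) t nu = hl_sum x t nu.
Proof.
rewrite /hl_sum [RHS](reindex_inj (mulIg s)) /=; apply: eq_bigr => w _; congr (_ * _).
  by apply: eq_bigr => i _; rewrite permM.
by apply: eq_bigr => i _; apply: eq_bigr => j _; rewrite !permM.
Qed.
End FlagSumColorings.

Section Normalization.
Variables (F : finFieldType) (K : fieldType).
Hypothesis charK : forall k, (k%:R == 0 :> K) = (k == 0%N).
Local Notation q := (#|F|%:R : K).
Local Notation t := (q^-1).

Lemma one_sub_t_neq0 k : (0 < k)%N -> 1 - t ^+ k != 0.
Proof.
move=> k0; have := q_sub_neq0 F charK k0; rewrite expr0 => qk.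
rewrite subr_eq0 eq_sym exprVn invr_eq1; by rewrite -subr_eq0.
Qed.

Lemma HL_v_neq0 m : HL_v t m != 0.
Proof.
rewrite prodf_seq_neq0; apply/allP => i; rewrite mem_index_iota => /andP[i0 _] /=.
have := one_sub_t_neq0 i0; rewrite -opprB oppr_eq0 subrX1 mulf_eq0 negb_or => /andP[_].
by rewrite big_mkord.
Qed.

(** Each factor is [q ^+ m * (1 - t ^+ (m - j))]. *)
Lemma prod_sub_HL_v m l : (l <= m)%N ->
  \prod_(l <= j < m) (q ^+ m - q ^+ j) = q ^+ (m * (m - l)) * ((1 - t) ^+ (m - l) * HL_v t (m - l)).
Proof.
have q0 := q_neq0 F charK; have [s] := ubnP (m - l); elim: s l => // s IH l ls lm.
move: lm; rewrite leq_eqVlt => /orP[/eqP->|lm].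
  by rewrite big_geq // subnn muln0 /HL_v big_geq // !expr0 !mulr1.
rewrite big_ltn // IH //; last by lia.
have [d ed] : exists d, (m - l = d.+1)%N by exists (m - l).-1; lia.
have -> : (m - l.+1 = d)%N by lia.
have vS : HL_v t d.+1 = HL_v t d * \sum_(0 <= j < d.+1) t ^+ j by rewrite /HL_v big_nat_recr.
rewrite ed vS mulnS exprD [(1 - t) ^+ d.+1]exprS.
have -> : q ^+ m - q ^+ l = q ^+ m * ((1 - t) * \sum_(0 <= j < d.+1) t ^+ j).
  have -> : (1 - t) * \sum_(0 <= j < d.+1) t ^+ j = 1 - t ^+ d.+1.
    by rewrite big_mkord -[1 - t]opprB mulNr -subrX1 opprB.
  rewrite mulrBr mulr1 exprVn -ed; congr (_ - _).
  have -> : q ^+ m = q ^+ l * q ^+ (m - l) by rewrite -exprD subnKC // ltnW.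
  by rewrite mulfK // expf_neq0.
set S := \sum_(0 <= j < d.+1) _; move: (q ^+ m) ((1 - t) ^+ d) (HL_v t d) (q ^+ (m * d)) => a b c e.
ring.
Qed.

Lemma layer_weightE m l : (l <= m)%N ->
  layer_weight F K m l = q ^+ (m * m) * ((1 - t) ^+ (m - l) * HL_v t (m - l)).
Proof.
move=> lm; rewrite /layer_weight prod_sub_HL_v // mulrA -exprD -mulnDr subnKC //.
Qed.

Section Partition.
Variables (n : nat) (la : Defs.partn n).

Lemma part_decreasing : decreasing (fun i : 'I_n => part la i).
Proof.
move=> i j ij; have /andP[srt _] := valP la.
apply: (sorted_leq_nth (leT := geq)) => //.
- by move=> a b c ab bc; apply: leq_trans bc ab.
- by move=> a; apply: leqnn.
- by rewrite inE size_map size_tuple.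
by rewrite inE size_map size_tuple.
Qed.

Lemma part_overflow i : (n <= i)%N -> part la i = 0%N.
Proof. by move=> ni; rewrite /part nth_default // size_map size_tuple. Qed.

Variable Y : 'M[F]_n.
Hypothesis typeY : forall k, \rank (Y ^+ k) = (\sum_(i < n) (part la i - k))%N.

Lemma type_nilpotent : Y ^+ n = 0.
Proof.
apply/eqP; rewrite -mxrank_eq0 typeY sum_nat_eq0; apply/forallP => i /=.
rewrite subn_eq0 -[X in (_ <= X)%N](sum_part la) (bigD1 i) //=; exact: leq_addr.
Qed.

Lemma shape_part : shape Y =1 part la.
Proof.
move=> i; have [ni|iN] := leqP n i; last first.
  apply: (decreasing_tails_inj (@shape_decreasing _ _ Y n) part_decreasing _ (Ordinal iN)) => k.
  by rewrite tails_shape ?typeY ?leq_subr //; apply: type_nilpotent.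
rewrite part_overflow // /shape eq_card0 // => k; rewrite !inE ltnNge.
by rewrite (leq_trans _ ni) // (leq_trans (nullity_step_anti _ (leq0n k))) // nullity_step0 leq_subr.
Qed.

Lemma part_conj_nullity k : part_conj la k = nullity_step Y k.
Proof.
rewrite /nullity_step !typeY -!/(tails (fun i : 'I_n => part la i) _) [in RHS]tails_card addnK.
by apply: eq_card => i; rewrite !inE.
Qed.

Lemma part_len_nullity : part_len la = (n - \rank Y)%N.
Proof. by rewrite -nullity_step0 -part_conj_nullity. Qed.

Lemma part_mult_nullity k : part_mult la k.+1 = (nullity_step Y k - nullity_step Y k.+1)%N.
Proof.
rewrite -!part_conj_nullity; apply/eqP; rewrite -(eqn_add2l (part_conj la k.+1)).
rewrite subnKC; last by apply: subset_leq_card; apply/subsetP => i; rewrite !inE => /ltnW.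
rewrite -cardsUI [X in (_ + X)%N](_ : _ = 0%N) ?addn0.
  by apply/eqP/eq_card => i; rewrite !inE [in RHS]leq_eqVlt orbC eq_sym.
by apply: eq_card0 => i; rewrite !inE; case: eqP => [->|]; rewrite ?ltnn ?andbF.
Qed.

(** The minimum of a pair of parts is the later one, so [min_sum] is the sum of [j] times part [j];
    summing over columns instead yields the binomial coefficients. *)
Lemma min_sum_part_n N : (part_len la <= N)%N -> min_sum (fun i : 'I_N => shape Y i) = part_n la.
Proof.
move=> lN; rewrite /min_sum (exchange_big_dep xpredT) //=.
transitivity (\sum_(j < N) \sum_(k < n) (if (j < nullity_step Y k)%N then j : nat else 0%N))%N.
  apply: eq_bigr => j _; rewrite (eq_bigr (fun=> shape Y j)) => [|i ij]; last first.
    by apply/minn_idPr; apply: shape_decreasing (ltnW ij).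
  rewrite sum_nat_const (_ : #|_| = j); last first.
    by rewrite -[RHS](card_ord_lt (ltnW (ltn_ord j))); apply: eq_card => i; rewrite !inE.
  rewrite -big_mkcond sum_nat_const mulnC; congr (_ * _)%N.
  by apply: eq_card => k; rewrite !inE.
rewrite exchange_big /part_n; apply: eq_bigr => k _.
have dN : (nullity_step Y k <= N)%N.
  by rewrite (leq_trans (nullity_step_anti _ (leq0n k))) // nullity_step0 -part_len_nullity.
rewrite -big_mkcond /= (big_ord_narrow dN) part_conj_nullity -bin2_sum big_mkord.
by [].
Qed.

(** The classical order of the centralizer of an element of type [la]; the multiplicities add up to
    [part_len la], whence the power of [1 - t]. *)
Lemma class_weightE :
  \prod_(k < n) layer_weight F K (nullity_step Y k) (nullity_step Y k.+1) =
  q ^+ (n + (part_n la).*2) * ((1 - t) ^+ part_len la * \prod_(1 <= k < n.+1) HL_v t (part_mult la k)).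
Proof.
rewrite (eq_bigr _ (fun (k : 'I_n) _ => layer_weightE (nullity_stepS Y k))).
rewrite !big_split /= prodrXr; congr (_ ^+ _ * (_ * _)).
- rewrite [X in (X + _)%N](_ : n = \sum_(k < n) nullity_step Y k)%N; last first.
    have e m : (\sum_(k < m) nullity_step Y k = n - \rank (Y ^+ m))%N.
      elim: m => [|m IH]; first by rewrite big_ord0 expr0 mxrank1 subnn.
      rewrite big_ord_recr /= IH /nullity_step; have := rank_expS Y m.
      have := rank_leq_row (Y ^+ m); lia.
    by rewrite e type_nilpotent mxrank0 subn0.
  rewrite /part_n -mul2n big_distrr /= -big_split /=; apply: eq_bigr => k _.
  rewrite part_conj_nullity; elim: (nullity_step Y k) => // d.
  by rewrite binS bin1 mulSn mulnS; lia.
- rewrite prodrXr; congr (_ ^+ _).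
  have e m : (\sum_(k < m) (nullity_step Y k - nullity_step Y k.+1) =
              nullity_step Y 0 - nullity_step Y m)%N.
    elim: m => [|m IH]; first by rewrite big_ord0 subnn.
    rewrite big_ord_recr /= IH; have := nullity_stepS Y m.
    have := nullity_step_anti Y (leq0n m); lia.
  rewrite e nullity_step0 -part_len_nullity /nullity_step type_nilpotent exprS type_nilpotent.
  by rewrite mulr0 !mxrank0 !subn0.
by rewrite big_add1 big_mkord; apply: eq_bigr => k _; rewrite part_mult_nullity.
Qed.

(** The product of [q ^+ N - q ^+ j] over [j < N] is split at [j = part_len la]: the lower part
    occurs in [full_count], the upper one gives [HL_v t (N - part_len la)]. *)
Lemma full_count_HL_v N : (part_len la <= N)%N ->
  full_count K N Y * HL_v t (N - part_len la) =
  q ^+ (n * N) * (1 - t) ^+ part_len la * HL_v t N.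
Proof.
move=> lN; have q0 := q_neq0 F charK.
rewrite full_countE -part_len_nullity; set d := part_len la in lN *.
have := prod_sub_HL_v (leq0n N); rewrite (big_cat_nat (leq0n d) lN) /= prod_sub_HL_v // big_mkord subn0.
have eN : (N * n = N * \rank Y + N * d)%N.
  by rewrite -mulnDr /d part_len_nullity subnKC ?rank_leq_row.
have t0 : 1 - t != 0 by have := one_sub_t_neq0 (ltn0Sn 0); rewrite expr1.
rewrite (mulnC n) eN exprD mulnBr.
have eNN : q ^+ (N * N) = q ^+ (N * N - N * d) * q ^+ (N * d).
  by rewrite -exprD subnK // leq_mul2l lN orbT.
have et : (1 - t) ^+ N = (1 - t) ^+ (N - d) * (1 - t) ^+ d by rewrite -exprD subnK.
rewrite eNN et => e.
have nz : q ^+ (N * N - N * d) * (1 - t) ^+ (N - d) != 0 by rewrite mulf_neq0 ?expf_neq0.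
apply: (mulfI nz); move: e; set P := \prod_(j < d) _.
move: (q ^+ (N * N - N * d)) (q ^+ (N * d)) ((1 - t) ^+ (N - d)) ((1 - t) ^+ d) (HL_v t (N - d)) (HL_v t N) (q ^+ (N * \rank Y)).
move=> a b c e f g h eq.
transitivity (h * (P * (a * (c * f)))); first by ring.
by rewrite eq; ring.
Qed.

(** The centralizer order cancels the [HL_v] of the multiplicities, and [full_count] that of the
    multiplicity of 0. If [N < part_len la], no [N] vectors generate the module and both sides
    vanish. *)
Lemma flag_sum_HL N (x : 'I_N -> K) : injective x -> (forall i, x i != 0) ->
  \prod_(k < n) layer_weight F K (nullity_step Y k) (nullity_step Y k.+1) / q ^+ part_n la *
  (if (N < part_len la)%N then 0
   else (HL_vpart la N t)^-1 * hl_sum x t (fun i => part la i)) =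
  q ^+ n * flag_sum (flag_var F x) Y.
Proof.
move=> inj_x x0; have q0 := q_neq0 F charK.
have := flag_sumE charK inj_x x0 type_nilpotent; rewrite /hl_count.
case: ltnP => [Nl|lN] e.
  move: e; rewrite full_count0 -?part_len_nullity // mul0r mulr0 => /eqP.
  rewrite !mulf_eq0 (negPf (HL_v_neq0 _)) (negPf (expf_neq0 _ q0)) !orbF => /eqP->.
  by rewrite mulr0.
rewrite class_weightE /HL_vpart; have := full_count_HL_v lN; move: e.
rewrite /hl_shape min_sum_part_n // (eq_hl_sum _ _ (fun i : 'I_N => shape_part i)).
set W := \prod_(1 <= k < n.+1) _.
have W0 : W != 0 by rewrite prodf_seq_neq0; apply/allP => k _; apply: HL_v_neq0.
have := HL_v_neq0 (N - part_len la); have := HL_v_neq0 N.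
have := expf_neq0 (n * N) q0; have := expf_neq0 (part_n la) q0.
rewrite -addnn !exprD.
move: (HL_v t N) (HL_v t (N - part_len la)) (full_count K N Y) (hl_sum _ _ _) (flag_sum _ _).
move: (q ^+ n) (q ^+ part_n la) (q ^+ (n * N)) ((1 - t) ^+ part_len la).
move=> a b c d v v' G h f b0 c0 v0 v'0 e1 e2.
have -> : f = G * (b * h) / (c * v) by rewrite -e1; field; rewrite c0 v0.
have -> : G = c * d * v / v' by rewrite -e2 mulfK.
by field; rewrite b0 c0 v0 v'0 W0.
Qed.
End Partition.

Lemma type_exists n (Y : 'M[F]_n) : Y ^+ n = 0 ->
  exists la : Defs.partn n, forall k, \rank (Y ^+ k) = (\sum_(i < n) (part la i - k))%N.
Proof.
move=> nil; pose s : n.-tuple 'I_n.+1 := [tuple inord (shape Y i) | i < n].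
have sE : [seq val k | k <- s] = [seq shape Y i | i <- iota 0 n].
  rewrite -map_comp -val_enum_ord -map_comp; apply: eq_map => i /=.
  by rewrite inordK // ltnS shape_leq.
have tE k : \rank (Y ^+ k) = tails (fun i : 'I_n => shape Y i) k.
  by rewrite tails_shape ?leq_subr.
have ps : is_partn s.
  apply/andP; split; rewrite sE.
    apply/(sortedP 0%N) => i; rewrite size_map size_iota => iN.
    rewrite !(nth_map 0%N) ?size_iota ?(ltnW iN) // !nth_iota ?(ltnW iN) // !add0n.
    exact: (@shape_decreasing _ _ Y n (Ordinal (ltnW iN)) (Ordinal iN)).
  rewrite sumnE big_map -[X in iota 0 X]subn0 -/(index_iota 0 n) big_mkord.
  have := tE 0%N; rewrite expr0 mxrank1 => e; apply/eqP; apply: etrans (esym e).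
    by apply: eq_bigr => i _; rewrite subn0.
exists (Partn ps) => k; rewrite tE; apply: eq_bigr => i _; congr (_ - _)%N.
by rewrite /part /= sE (nth_map 0%N) ?size_iota // nth_iota.
Qed.
End Normalization.

(** * Induced characters *)

Section InducedCharacter.
Variables (F : finFieldType) (n : nat).

Lemma npowE (A : 'M[F]_n) k : npow A k = (A - 1%:M) ^+ k.
Proof. by elim: k => [|k IH]; rewrite ?expr0 // exprS -mulmxE -IH. Qed.

Lemma rank_jordan_exp (la : Defs.partn n) k :
  \rank ((jordan_mx F la - 1%:M) ^+ k) = (\sum_(i < n) (part la i - k))%N.
Proof. by rewrite -npowE rank_npow. Qed.

Lemma rank_trmx_exp (Y : 'M[F]_n) k : \rank (Y^T ^+ k) = \rank (Y ^+ k).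
Proof.
rewrite -mxrank_tr; congr (\rank _); elim: k => [|k IH]; first by rewrite !expr0 trmx1.
by rewrite exprS -mulmxE trmx_mul IH trmxK mulmxE -exprSr.
Qed.

Definition lower_of (u : GL F n) : 'M[F]_n := (glval u - 1%:M)^T.

Lemma lower_of_inj : injective lower_of.
Proof. by move=> u v /trmx_inj/addIr/val_inj. Qed.

Lemma lower_of_UTg (gamma : indiff_graph n) : lower_of @: UTg F gamma = lower_mx F gamma.
Proof.
apply/setP => Y; apply/imsetP/idP => [[u /UTgP[d l e] ->]|/lower_mxP H].
  apply/lower_mxP => i j; rewrite !mxE -[j == i]/(j == i :> nat); case: (ltngtP i j) => [ij _|ji /= g|/val_inj-> _].
  - by rewrite l // subrr.
  - by rewrite e // subrr.
  by rewrite d subrr.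
have uY : (1%:M + Y)^T \in unitmx.
  rewrite unitmx_tr unitmxE det_trig; last first.
    apply/is_trig_mxP => i j ij; rewrite !mxE H ?(ltnW ij) // addr0.
    by rewrite -[i == j]/(i == j :> nat) ltn_eqF.
  by rewrite big1 ?unitr1 // => i _; rewrite !mxE eqxx H ?leqnn // addr0.
exists (MkGL uY); last by rewrite /lower_of /= linearB /= trmxK trmx1 addrC addKr.
apply/UTgP; split=> [i|i j ji|i j ij g] /=; rewrite !mxE.
- by rewrite eqxx H ?leqnn // addr0.
- rewrite H; last by rewrite ltnW.
  by rewrite addr0 -[j == i]/(j == i :> nat) ltn_eqF.
by rewrite H ?g ?orbT // addr0 -[j == i]/(j == i :> nat) gtn_eqF.
Qed.

Variables (K : fieldType) (phi : {rmorphism algC -> K}).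
Local Notation q := (#|F|%:R : K).

Lemma char_target k : (k%:R == 0 :> K) = (k == 0%N).
Proof. by rewrite -(rmorph_nat phi) fmorph_eq0 Num.Theory.pnatr_eq0. Qed.

Definition hl_frac N (x : 'I_N -> K) (la : Defs.partn n) : K :=
  if (N < part_len la)%N then 0
  else (HL_vpart la N q^-1)^-1 * hl_sum x q^-1 (fun i => part la i).

(** The sum counts the conjugating elements: none, or as many as in the centralizer. Ranks are
    tested up to [n] only, beyond which both powers vanish. *)
Lemma sum_conj_jordan (la : Defs.partn n) (u : GL F n) B : (glval u - 1%:M) ^+ B = 0 ->
  \sum_(y : GL F n) (jordan F la ^ y == u)%g%:R =
  if [forall k : 'I_n.+1, \rank ((glval u - 1%:M) ^+ k) == (\sum_(i < n) (part la i - k))%N]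
  then \prod_(k < n) layer_weight F K (nullity_step (glval u - 1%:M) k)
                                      (nullity_step (glval u - 1%:M) k.+1)
  else 0.
Proof.
move=> nilB; have nil := nilpotent_exp nilB; set Y := glval u - 1%:M in nil nilB *.
have eq_conj (y : GL F n) : (jordan F la ^ y == u)%g =
    (glval y *m Y == (jordan_mx F la - 1%:M) *m glval y).
  rewrite -(inj_eq (mulgI y)) conjgE mulKVg -(inj_eq val_inj) /=.
  rewrite mulmxBr mulmxBl mulmx1 mul1mx (inj_eq (addIr _)) eq_sym.
  by [].
case: forallP => [H|nH]; last first.
  rewrite big1 // => y _; case: eqP => // e; case: nH => k; rewrite -rank_jordan_exp.
  have /eqP eY : glval y *m Y == (jordan_mx F la - 1%:M) *m glval y by rewrite -eq_conj e.
  by rewrite (rank_conj (valP y) (conj_exp k eY)).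
have rk k : \rank (Y ^+ k) = \rank ((jordan_mx F la - 1%:M) ^+ k).
  have [kn|nk] := leqP k n.
    by rewrite rank_jordan_exp; apply/eqP; have := H (Ordinal (kn : k < n.+1)%N).
  have jn : (jordan_mx F la - 1%:M) ^+ n = 0.
    by apply: type_nilpotent => k'; rewrite rank_jordan_exp.
  by rewrite -(subnK (ltnW nk)) !exprD nil jn !mulr0.
rewrite -(card_intertwine K nil rk).
rewrite [RHS](reindex_onto (@glval F n) (insubd (GL_one F n))) /=; last first.
  by move=> g /andP[ug _]; rewrite val_insubd ug.
rewrite [RHS]big_mkcond; apply: eq_bigr => y _.
rewrite eq_conj (valP y : glval y \in unitmx) valKd eqxx andbT /=.
by case: ifP.
Qed.

(** For each [u] in the subgroup only the partition that is its Jordan type contributes, by the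
    amount in [flag_sum_HL]. The order of the subgroup and [q ^+ n] cancel with
    [sum_lower_flag_sum]. *)
Lemma induced_character_sum N (x : 'I_N -> K) (gamma : indiff_graph n) :
  injective x -> (forall i, x i != 0) ->
  \sum_(la : Defs.partn n)
     phi ('Ind[[set: GL F n], UTg F gamma] 1 (jordan F la)) / q ^+ part_n la * hl_frac x la =
  (q - 1) ^+ n * \sum_(kappa : {ffun 'I_n -> 'I_N} | proper gamma kappa)
     \prod_i (q ^+ descents gamma kappa i * x (kappa i)).
Proof.
move=> inj_x x0; have charK := char_target; have q0 := q_neq0 F charK.
pose H := UTg F gamma.
have cH : #|H|%:R != 0 :> K by rewrite charK -lt0n cardG_gt0.
have IndE la : phi ('Ind[[set: GL F n], UTg F gamma] 1 (jordan F la)) =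
    #|H|%:R^-1 * \sum_(u in H) \sum_(y : GL F n) (jordan F la ^ y == u)%g%:R.
  rewrite cfIndE ?subsetT // rmorphM fmorphV rmorph_nat rmorph_sum; congr (_ * _).
  rewrite [RHS]exchange_big [LHS]big_mkcond /=; apply: eq_bigr => y _; rewrite inE cfun1E rmorph_nat.
  case: (boolP (_ \in _)) => hy; last first.
    by rewrite big1 // => u uH; case: eqP => // e; rewrite e uH in hy.
  rewrite (bigD1 (jordan F la ^ y)%g) //= eqxx big1 ?addr0 // => u /andP[_ ne].
  by rewrite eq_sym (negPf ne).
transitivity (#|H|%:R^-1 * \sum_(u in H) (q ^+ n * flag_sum (flag_var F x) (lower_of u))).
  under eq_bigr => la _ do rewrite IndE -!mulrA mulr_suml.
  rewrite -[LHS]mulr_sumr; congr (_ * _); rewrite exchange_big; apply: eq_bigr => u uH /=.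
  set Y := lower_of u.
  have nilY : Y ^+ n = 0.
    by apply: (@lower_nilpotent _ _ gamma); rewrite -lower_of_UTg imset_f.
  have rY k : \rank ((glval u - 1%:M) ^+ k) = \rank (Y ^+ k) by rewrite -rank_trmx_exp.
  have nilu : (glval u - 1%:M) ^+ n = 0 by apply/eqP; rewrite -mxrank_eq0 rY nilY mxrank0.
  have [la0 tla0] := type_exists nilY.
  rewrite (bigD1 la0) //= [X in _ + X]big1 => [|la ne]; last first.
    rewrite (sum_conj_jordan _ nilu); case: forallP => [tla|]; last by rewrite mul0r.
    case/eqP: ne; apply: (partn_inj (n := n)) => k; rewrite -tla0 -rY.
    have [kn|nk] := leqP k n.
      by have /eqP := tla (Ordinal (kn : k < n.+1)%N).
    rewrite -(subnK (ltnW nk)) exprD nilu mulr0 mxrank0.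
    apply/eqP; rewrite sum_nat_eq0; apply/forallP => i /=; rewrite subn_eq0.
    apply: leq_trans (leq_addl _ _).
    by rewrite -[X in (_ <= X)%N](sum_part la) (bigD1 i) //= leq_addr.
  rewrite addr0 (sum_conj_jordan _ nilu); case: forallP => [_|[k]]; last by rewrite rY tla0.
  rewrite -(flag_sum_HL charK tla0 inj_x x0) mulrA; congr (_ / _ * _).
  by apply: eq_bigr => k _; rewrite /nullity_step !rY.
rewrite -mulr_sumr -(big_imset _ (in2W lower_of_inj)) /= lower_of_UTg sum_lower_flag_sum //.
have -> : #|lower_mx F gamma| = #|H| by rewrite -lower_of_UTg card_imset //; apply: lower_of_inj.
rewrite expr_div_n; have := expf_neq0 n q0.
move: cH; move: (\sum_(kappa | _) _) ((q - 1) ^+ n) (q ^+ n) (#|H|%:R) => a b c d d0 c0.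
by field; rewrite c0 d0.
Qed.
End InducedCharacter.

Section ChromaticFunction.
Variables (n N : nat).

Lemma asc_descents (gamma : indiff_graph n) (kappa : {ffun 'I_n -> 'I_N}) :
  asc gamma kappa = (\sum_(i < n) descents gamma (fun j => rev_ord (kappa j)) i)%N.
Proof.
transitivity (\sum_(i < n) \sum_(j < n | [&& (i < j)%N, gamma i j & (kappa i < kappa j)%N]) 1)%N.
  by rewrite pair_big_dep /= /asc -sum1_card; apply: eq_bigl => -[i j]; rewrite inE.
apply: eq_bigr => i _; rewrite sum1_card; apply: eq_card => j; rewrite !inE unfold_in /=.
by have := ltn_ord (kappa j); have := ltn_ord (kappa i); case: (i < j)%N; case: (gamma i j) => //=; lia.
Qed.

Lemma chromatic_sum_rev (gamma : indiff_graph n) (K : comNzRingType) (q : K) (x : 'I_N -> K) :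
  \sum_(kappa : {ffun 'I_n -> 'I_N} | proper gamma kappa)
     \prod_i (q ^+ descents gamma kappa i * x (rev_ord (kappa i))) =
  \sum_(kappa : {ffun 'I_n -> 'I_N} | proper_coloring gamma kappa)
     q ^+ asc gamma kappa * \prod_i x (kappa i).
Proof.
pose r (kappa : {ffun 'I_n -> 'I_N}) := [ffun j => rev_ord (kappa j)].
have rK : involutive r by move=> kappa; apply/ffunP => j; rewrite !ffunE rev_ordK.
rewrite (reindex_inj (inv_inj rK)) /=; apply: eq_big => kappa.
  apply/forallP/forallP => H i; apply/forallP => j; apply/implyP => g.
    by have /forallP/(_ j)/implyP/(_ g) := H i; rewrite !ffunE (inj_eq rev_ord_inj).
  by have /forallP/(_ j)/implyP/(_ g) := H i; rewrite !ffunE (inj_eq rev_ord_inj).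
move=> _; rewrite asc_descents -prodrXr -big_split /=; apply: eq_bigr => i _.
rewrite ffunE rev_ordK; congr (_ ^+ _ * _).
by apply: eq_card => j; rewrite !inE !ffunE.
Qed.
End ChromaticFunction.

(** * Linear independence *)

Lemma sort_exists N (nu : 'I_N -> nat) : exists la : 'I_N -> nat,
  decreasing la /\ forall k, tails la k = tails nu k.
Proof.
pose s := sort geq [seq nu i | i <- enum 'I_N].
have sz : size s = N by rewrite size_sort size_map size_enum_ord.
exists (fun i => nth 0%N s i); split=> [i j ij|k].
  apply: (sorted_leq_nth (leT := geq)) => //.
  - by move=> a b c ab bc; apply: leq_trans bc ab.
  - by move=> a; apply: leqnn.
  - by apply: sort_sorted => a b; apply: leq_total.
  - by rewrite inE sz.
  by rewrite inE sz.
transitivity (\sum_(a <- s) (a - k))%N; first by rewrite (big_nth 0%N) sz big_mkord.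
by rewrite /s (perm_big _ (permEl (perm_sort _ _))) big_map big_enum.
Qed.

Lemma partn_exists N (la : 'I_N -> nat) : decreasing la -> tails la 0 = N ->
  exists mu : Defs.partn N, forall i : 'I_N, part mu i = la i.
Proof.
move=> dec sum_la; have sE : (\sum_(i < N) la i = N)%N.
  by rewrite -[RHS]sum_la; apply: eq_bigr => i _; rewrite subn0.
have laN i : (la i < N.+1)%N by rewrite ltnS -[X in (_ <= X)%N]sE (bigD1 i) //= leq_addr.
pose s : N.-tuple 'I_N.+1 := [tuple Ordinal (laN i) | i < N].
have nthE (i : 'I_N) : nth 0%N [seq val k | k <- s] i = la i.
  by rewrite (nth_map ord0) ?size_tuple // -tnth_nth tnth_mktuple.
have sz : size [seq val k | k <- s] = N by rewrite size_map size_tuple.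
have ps : is_partn s.
  apply/andP; split.
    apply/(sortedP 0%N) => i; rewrite sz => iN.
    by rewrite -[i]/(val (Ordinal (ltnW iN))) -[i.+1]/(val (Ordinal iN)) !nthE; apply: dec => /=.
  rewrite sumnE (big_nth 0%N) sz big_mkord; apply/eqP; apply: etrans sE.
  by apply: eq_bigr => i _; rewrite nthE.
by exists (Partn ps).
Qed.

Section Independence.
Variables (F : finFieldType) (n : nat).
Local Notation qC := (#|F|%:R : algC).
Local Notation K := {fraction {mpoly algC[n]}}.

Definition frac_const : {rmorphism algC -> K} :=
  (@FracField.tofrac {mpoly algC[n]} \o @mpolyC n algC)%FUN.

Local Notation phi := frac_const.
Local Notation q := (#|F|%:R : K).
Local Notation x := (@fracX algC n).

Lemma frac_char k : (k%:R == 0 :> K) = (k == 0%N).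
Proof. exact: char_target phi k. Qed.

Lemma fracX_inj : injective x.
Proof.
move=> i j /eqP; rewrite tofrac_eq => /eqP/(congr1 (mcoeff U_(i)%MM)).
by rewrite !mcoeffXU eqxx; case: eqP => // _ /eqP; rewrite oner_eq0.
Qed.

Lemma fracX_neq0 i : x i != 0.
Proof. rewrite tofrac_eq0; apply/eqP => /(congr1 (mcoeff U_(i)%MM))/eqP.
by rewrite mcoeffX eqxx mcoeff0 oner_eq0. Qed.

(** The span is over [algC], embedded by [phi]; over [K] any two nonzero elements are
    proportional. *)
Inductive hl_span (d : nat) : K -> Prop :=
| hl_span0 : hl_span d 0
| hl_spanD f g : hl_span d f -> hl_span d g -> hl_span d (f + g)
| hl_spanZ a (la : 'I_n -> nat) : decreasing la -> tails la 0 = d ->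
    hl_span d (phi a * hl_sum x q^-1 la).

Lemma hl_span_scale d a f : hl_span d f -> hl_span d (phi a * f).
Proof.
elim=> [|g h _ IHg _ IHh|b la dec t]; first by rewrite mulr0; apply: hl_span0.
  by rewrite mulrDr; apply: hl_spanD.
by rewrite mulrA -rmorphM; apply: hl_spanZ.
Qed.

Lemma hl_span_strip d (mu : 'I_n -> nat) (T : {set 'I_n}) : decreasing mu -> tails mu 0 = d ->
  hl_span (d + #|T|)%N (hl_sum x q^-1 (fun i => mu i + (i \in T))%N).
Proof.
move=> dec t; have charK := frac_char; have q0 : q != 0 := q_neq0 F charK.
have [la [dla tla]] := sort_exists (fun i => mu i + (i \in T))%N.
have ad : almost_decreasing (fun i => mu i + (i \in T))%N.
  by move=> i j ij; have := dec _ _ ij; case: (i \in T); case: (j \in T); lia.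
have := hl_sum_sort fracX_inj (two_neq0 charK) q0 ad dla (fun k => esym (tla k)).
set e := (_ + _)%N => eq_la.
have -> : hl_sum x q^-1 (fun i => mu i + (i \in T))%N =
    phi (qC ^- e * qC ^+ min_sum la) * hl_sum x q^-1 la.
  rewrite rmorphM fmorphV !rmorphXn rmorph_nat -mulrA -eq_la mulKf //.
  exact: expf_neq0.
by apply: hl_spanZ => //; rewrite tla tails_strip0 t.
Qed.

Lemma hl_span_esum d m f : hl_span d f -> hl_span (d + m)%N (esum x m * f).
Proof.
elim=> [|g h _ IHg _ IHh|a la dec t]; first by rewrite mulr0; apply: hl_span0.
  by rewrite mulrDr; apply: hl_spanD.
rewrite mulrCA hl_sum_pieri; apply: hl_span_scale.
apply: big_ind => [|f1 f2|T /eqP <-]; [exact: hl_span0|exact: hl_spanD|].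
exact: hl_span_strip.
Qed.

(** Pieri's rule is applied repeatedly to 1, which by [hl_sum0] is a constant multiple of the sum
    for the empty partition. *)
Lemma hl_span_prod s : hl_span (sumn s) (\prod_(m <- s) esum x m).
Proof.
have charK := frac_char.
elim: s => [|m s IH] /=; last by rewrite big_cons addnC; apply: hl_span_esum.
have t1 : 1 - q^-1 != 0 by have := one_sub_t_neq0 F charK (ltn0Sn 0); rewrite expr1.
have phiv : phi (HL_v qC^-1 n) = HL_v q^-1 n.
  rewrite rmorph_prod; apply: eq_bigr => i _; rewrite rmorph_sum; apply: eq_bigr => j _.
  by rewrite rmorphXn fmorphV rmorph_nat.
have e1 : 1 = phi (HL_v qC^-1 n)^-1 * hl_sum x q^-1 (fun=> 0%N).
  by rewrite (hl_sum0 t1 fracX_inj fracX_neq0) fmorphV phiv mulVf // HL_v_neq0.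
by rewrite big_nil e1; apply: hl_spanZ => //; rewrite /tails big1.
Qed.

Lemma hl_span_partn f : hl_span n f -> exists c : Defs.partn n -> algC,
  f = \sum_la phi (c la) * hl_sum x q^-1 (fun i => part la i).
Proof.
elim=> [|g h _ [b ->] _ [c ->]|a la dec t].
- by exists (fun=> 0); rewrite big1 // => la _; rewrite rmorph0 mul0r.
- by exists (fun la => b la + c la); rewrite -big_split; apply: eq_bigr => la _; rewrite rmorphD mulrDl.
have [mu e] := partn_exists dec t; exists (fun nu => a *+ (nu == mu)).
rewrite (bigD1 mu) //= eqxx mulr1n big1 ?addr0 => [|nu /negPf->]; last by rewrite mulr0n rmorph0 mul0r.
by congr (_ * _); apply: eq_hl_sum.
Qed.

(** The exponents of a product of elementary symmetric polynomials [e_1, ..., e_n], as a monomial in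
    these. *)
Definition mult_mnm (la : Defs.partn n) : 'X_{1.. n} := [multinom part_mult la i.+1 | i < n].

Lemma part_leq (la : Defs.partn n) (i : 'I_n) : (part la i <= n)%N.
Proof. by rewrite -[X in (_ <= X)%N](sum_part la) (bigD1 i) //= leq_addr. Qed.

Lemma prod_part_mult (R : comNzRingType) (G : nat -> R) (la : Defs.partn n) : G 0%N = 1 ->
  \prod_(i < n) G (part la i) = \prod_(k < n) G k.+1 ^+ part_mult la k.+1.
Proof.
move=> G0; transitivity (\prod_(i < n) \prod_(k < n) G k.+1 ^+ (part la i == k.+1)).
  apply: eq_bigr => i _; case ep: (part la i) => [|p].
    by rewrite G0 big1 // => k _; rewrite expr0.
  have pn : (p < n)%N by rewrite -ep part_leq.
  rewrite (bigD1 (Ordinal pn)) //= eqxx expr1 big1 ?mulr1 // => k ne.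
  by rewrite eqSS eq_sym (negPf (ne : k != p :> nat)) expr0.
rewrite exchange_big; apply: eq_bigr => k _; rewrite prodrXr; congr (_ ^+ _).
by rewrite /part_mult -sum1dep_card [RHS]big_mkcond; apply: eq_bigr => i _; case: (_ == _).
Qed.

Lemma mult_mnm_inj : injective mult_mnm.
Proof.
move=> la mu e; apply: partn_inj => k.
have sum_mult (nu : Defs.partn n) : (\sum_(i < n) (part nu i - k) =
    \sum_(j < n) part_mult nu j.+1 * (j.+1 - k))%N.
  transitivity (\sum_(i < n) \sum_(j < n) (part nu i == j.+1) * (j.+1 - k))%N.
    apply: eq_bigr => i _; case ep: (part nu i) => [|p]; first by rewrite big1.
    have pn : (p < n)%N by rewrite -ep part_leq.
    rewrite (bigD1 (Ordinal pn)) //= eqxx mul1n big1 ?addn0 // => j ne.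
    by rewrite eqSS eq_sym (negPf (ne : j != p :> nat)).
  rewrite exchange_big; apply: eq_bigr => j _; rewrite -big_distrl /=; congr (_ * _)%N.
  by rewrite /part_mult -sum1dep_card [RHS]big_mkcond; apply: eq_bigr => i _; case: (_ == _).
rewrite !sum_mult; apply: eq_bigr => j _; congr (_ * _)%N.
by have := congr1 (fun m : 'X_{1.. n} => m j) e; rewrite !mnmE.
Qed.

Lemma esum_mesym m : esum x m = FracField.tofrac (mesym n algC m).
Proof.
rewrite /esum /mesym rmorph_sum; apply: eq_bigr => T _.
by rewrite rmorph_prod.
Qed.

(** The elementary symmetric polynomials are algebraically independent, and distinct partitions give
    distinct monomials in them. *)
Lemma esum_prod_free (b : Defs.partn n -> algC) :
  \sum_la phi (b la) * \prod_(i < n) esum x (part la i) = 0 -> forall la, b la = 0.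
Proof.
move=> s0 la.
have : \sum_la b la *: 'X_[mult_mnm la] = 0 :> {mpoly algC[n]}.
  apply: msym_fundamental_un; rewrite comp_mpoly0; apply/eqP.
  rewrite -tofrac_eq0 -[X in _ == X]s0; apply/eqP.
  rewrite (raddf_sum (comp_mpoly _)) /= rmorph_sum /=; apply: eq_bigr => mu _.
  rewrite linearZ /= comp_mpolyX -mul_mpolyC rmorphM; congr (_ * _).
  rewrite (prod_part_mult (G := fun k => esum x k)); last by rewrite esum_mesym mesym0E rmorph1.
  rewrite rmorph_prod; apply: eq_bigr => k _.
  by rewrite tnth_mktuple mnmE rmorphXn esum_mesym.
move/(congr1 (mcoeff (mult_mnm la))); rewrite mcoeff0 raddf_sum (bigD1 la) //=.
rewrite mcoeffZ mcoeffX eqxx mulr1 big1 ?addr0 // => mu ne.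
rewrite mcoeffZ mcoeffX; case: eqP => [/mult_mnm_inj e|_]; last by rewrite mulr0.
by rewrite e eqxx in ne.
Qed.

(** [A] expresses the products of elementary symmetric polynomials in terms of the [hl_sum], both
    indexed by partitions. Independence of the products makes this square matrix invertible, so a
    relation between the [hl_sum] becomes one between the products. *)
Lemma hl_sum_free (c : Defs.partn n -> algC) :
  \sum_la phi (c la) * hl_sum x q^-1 (fun i => part la i) = 0 -> forall la, c la = 0.
Proof.
move=> s0 la; pose P := #|{: Defs.partn n}|.
have aP (mu : Defs.partn n) : exists a : Defs.partn n -> algC, \prod_(i < n) esum x (part mu i) =
    \sum_nu phi (a nu) * hl_sum x q^-1 (fun i => part nu i).
  apply: hl_span_partn; have := hl_span_prod [seq part mu i | i <- iota 0 n].
  have -> : sumn [seq part mu i | i <- iota 0 n] = n.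
    by rewrite sumnE big_map -[X in iota 0 X]subn0 -/(index_iota 0 n) big_mkord; apply: (sum_part mu).
  by rewrite big_map -[X in iota 0 X]subn0 -/(index_iota 0 n) big_mkord.
have [a aE] := fin_all_exists aP.
pose A : 'M[algC]_P := \matrix_(i, j) a (enum_val i) (enum_val j).
have combo (v : 'rV_P) : \sum_mu phi (v 0 (enum_rank mu)) * \prod_(i < n) esum x (part mu i) =
    \sum_nu phi ((v *m A) 0 (enum_rank nu)) * hl_sum x q^-1 (fun i => part nu i).
  under eq_bigr => mu _ do rewrite aE mulr_sumr.
  rewrite exchange_big; apply: eq_bigr => nu _.
  rewrite mxE (rmorph_sum phi) mulr_suml [RHS](reindex _ (onW_bij _ (enum_rank_bij _))) /=.
  apply: eq_bigr => mu _; rewrite !mxE !enum_rankK mulrA; congr (_ * _).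
  by apply: esym; apply: (rmorphM phi).
have freeA : row_free A.
  rewrite -kermx_eq0; apply/eqP/row_matrixP => i; rewrite row0.
  have eA : row i (kermx A) *m A = 0 by rewrite -row_mul mulmx_ker row0.
  have v0 := esum_prod_free (b := fun mu => row i (kermx A) 0 (enum_rank mu)).
  apply/rowP => j; rewrite [RHS]mxE -[j]enum_valK; apply: v0; rewrite combo eA.
  by rewrite big1 // => nu _; rewrite mxE rmorph0 mul0r.
have uA : A \in unitmx by rewrite -row_free_unit.
pose v := (\row_i c (enum_val i)) *m invmx A.
have vA : v *m A = \row_i c (enum_val i) by rewrite mulmxKV.
have v0 mu : v 0 (enum_rank mu) = 0.
  apply: (esum_prod_free (b := fun mu => v 0 (enum_rank mu))); rewrite combo vA -[RHS]s0.
  by apply: eq_bigr => nu _; rewrite mxE enum_rankK.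
have : (v *m A) 0 (enum_rank la) = 0.
  rewrite mxE big1 // => i _; by rewrite -[i]enum_valK v0 mul0r.
by rewrite vA mxE enum_rankK.
Qed.
End Independence.

(** * Class functions supported on unipotent elements *)

Section UnipotentSupport.
Variables (F : finFieldType) (n : nat).
Local Notation G := [set: GL F n].

Lemma cf_uni_coord (f : 'CF(G)) : f \in cf_uni F n ->
  f = \sum_la f (jordan F la) *: delta F la.
Proof.
rewrite /cf_uni span_def big_image => /memv_sumP[v vP ->]; apply: eq_bigr => la _.
have coord mu : v mu = v mu (jordan F mu) *: delta F mu.
  have /vlineP[k ->] := vP mu isT.
  by rewrite cfunE delta_jordan eqxx mulr1.
rewrite sum_cfunE (bigD1 la) //= big1 ?addr0 // => mu ne.
by rewrite coord cfunE delta_jordan eq_sym (negPf ne) mulr0.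
Qed.

Lemma UTg_jordan (gamma : indiff_graph n) u : u \in UTg F gamma ->
  exists la, u \in (jordan F la ^: G)%g.
Proof.
move=> uH; have nilY : lower_of u ^+ n = 0.
  by apply: (@lower_nilpotent _ _ gamma); rewrite -lower_of_UTg imset_f.
have [la tla] := type_exists nilY; exists la.
have rY k : \rank ((glval u - 1%:M) ^+ k) = \rank (lower_of u ^+ k) by rewrite -rank_trmx_exp.
have nilu : (glval u - 1%:M) ^+ n = 0 by apply/eqP; rewrite -mxrank_eq0 rY nilY mxrank0.
have [k|g ug e] := nilpotent_conj (@Num.Theory.pnatr_eq0 algC) nilu (Z := jordan_mx F la - 1%:M).
  by rewrite rank_jordan_exp rY tla.
apply/imsetP; exists (MkGL ug); first by rewrite inE.
apply: (mulgI (MkGL ug)); rewrite conjgE mulKVg; apply: val_inj => /=.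
move/eqP: e; rewrite mulmxBr mulmxBl mulmx1 mul1mx => /eqP; exact: addIr.
Qed.

Lemma induced_cf_uni (gamma : indiff_graph n) : 'Ind[G, UTg F gamma] 1 \in cf_uni F n.
Proof.
set f := 'Ind 1; suff -> : f = \sum_la f (jordan F la) *: delta F la.
  by apply: memv_suml => la _; apply/memvZ/memv_span/image_f.
apply/cfunP => g; have [/existsP[la /imsetP[h hG ->]]|nconj] :=
  boolP [exists la, g \in (jordan F la ^: G)%g].
  rewrite !cfunJ // sum_cfunE (bigD1 la) //= cfunE delta_jordan eqxx mulr1 big1 ?addr0 // => mu ne.
  by rewrite cfunE delta_jordan eq_sym (negPf ne) mulr0.
rewrite negb_exists in nconj; move/forallP: nconj => nconj.
rewrite sum_cfunE [RHS]big1 => [|la _]; last first.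
  by rewrite cfunE /delta cfun_classE (negPf (nconj la)) andbF mulr0.
rewrite /f cfIndE ?subsetT // big1 ?mulr0 // => y _; rewrite cfun1E.
case: (boolP (_ \in _)) => // /UTg_jordan[la gy]; case/negP: (nconj la).
by rewrite memJ_norm ?(subsetP (class_norm _ _)) ?inE // in gy.
Qed.
End UnipotentSupport.

Section Characteristic.
Variables (F : finFieldType) (n : nat).
Local Notation G := [set: GL F n].
Local Notation qC := (#|F|%:R : algC).

Lemma frac_const_HL_vpart N (la : Defs.partn n) :
  frac_const N (HL_vpart la N qC^-1) = HL_vpart la N #|F|%:R^-1.
Proof.
have vE m : frac_const N (HL_v qC^-1 m) = HL_v #|F|%:R^-1 m.
  rewrite rmorph_prod; apply: eq_bigr => i _; rewrite rmorph_sum; apply: eq_bigr => j _.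
  by rewrite rmorphXn fmorphV rmorph_nat.
by rewrite rmorphM vE rmorph_prod; congr (_ * _); apply: eq_bigr => k _; rewrite vE.
Qed.

Lemma p1E (g : 'CF(G)) N : p1 g N = \sum_la
  frac_const N (g (jordan F la)) / #|F|%:R ^+ part_n la * hl_frac F (@fracX algC N) la.
Proof.
apply: eq_bigr => la _; rewrite -[fracC N (_ * _)]/(frac_const N _).
rewrite rmorphM fmorphV rmorphXn rmorph_nat; congr (_ * _).
rewrite /hall_littlewood /hl_frac; case: ifP => // _; congr (_ * _).
  by rewrite -[LHS]/(frac_const N _) fmorphV frac_const_HL_vpart.
by rewrite -[fracC N _]/(frac_const N _) fmorphV rmorph_nat.
Qed.

(** The formula is used with the variables in reverse order: this turns descents into ascents and
    leaves each [hl_sum] unchanged. *)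
Lemma p1_induced (gamma : indiff_graph n) N :
  p1 ('Ind[G, UTg F gamma] 1) N =
  frac_const N ((qC - 1) ^+ n) * mfrac (chromatic_qsym gamma qC N).
Proof.
pose x := @fracX algC N; pose s := perm (@rev_ord_inj N).
have xs : x \o s =1 x \o @rev_ord N by move=> i; rewrite /= permE.
have inj_x : injective (x \o s) by apply: inj_comp (@perm_inj _ s); apply: fracX_inj.
have := induced_character_sum F (frac_const N) gamma inj_x (fun i => fracX_neq0 _).
move=> e; rewrite p1E; apply: etrans (etrans e _).
  apply: eq_bigr => la _; congr (_ * _); rewrite /hl_frac; case: ifP => // _.
  by rewrite hl_sum_perm.
rewrite rmorphXn rmorphB rmorph_nat rmorph1; congr (_ * _).
under eq_bigr => kappa _ do under eq_bigr => i _ do rewrite xs.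
rewrite (chromatic_sum_rev gamma (#|F|%:R) x) /mfrac /chromatic_qsym rmorph_sum.
apply: eq_bigr => kappa _; rewrite -mul_mpolyC rmorphM rmorph_prod; congr (_ * _).
by rewrite -[RHS]/(frac_const N _) rmorphXn rmorph_nat.
Qed.

(** In [n] variables no partition of [n] has too many parts, so the coordinates of a class function
    appear, up to the nonzero constants [w la], as coefficients of independent sums. *)
Lemma p1_inj (f g : 'CF(G)) : f \in cf_uni F n -> g \in cf_uni F n ->
  p1 f n = p1 g n -> f = g.
Proof.
move=> fU gU; rewrite !p1E => e; rewrite (cf_uni_coord fU) (cf_uni_coord gU).
have charC := @Num.Theory.pnatr_eq0 algC; have q0 := q_neq0 F charC.
pose w (la : Defs.partn n) := qC ^- part_n la * (HL_vpart la n qC^-1)^-1.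
have w0 la : w la != 0.
  rewrite mulf_neq0 ?invr_eq0 ?expf_neq0 // mulf_neq0 ?(HL_v_neq0 F charC) //.
  by rewrite prodf_seq_neq0; apply/allP => k _; apply: HL_v_neq0.
have sumE (h : 'CF(G)) : \sum_la frac_const n (h (jordan F la)) / #|F|%:R ^+ part_n la *
    hl_frac F (@fracX algC n) la =
    \sum_la frac_const n (h (jordan F la) * w la) * hl_sum (@fracX algC n) #|F|%:R^-1 (fun i => part la i).
  apply: eq_bigr => la _; rewrite /hl_frac ltnNge -[X in (_ <= X)%N]card_ord max_card /=.
  rewrite mulrA; congr (_ * _); rewrite -[LHS]mulrA.
  have -> : #|F|%:R ^- part_n la / HL_vpart la n #|F|%:R^-1 = frac_const n (w la).
    by rewrite [RHS](rmorphM (frac_const n)) !fmorphV (rmorphXn (frac_const n)) rmorph_nat frac_const_HL_vpart.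
  by apply: esym; apply: (rmorphM (frac_const n)).
have free := @hl_sum_free F n (fun la => f (jordan F la) * w la - g (jordan F la) * w la).
apply: eq_bigr => la _; congr (_ *: _); apply: (mulIf (w0 la)); apply/eqP; rewrite -subr_eq0.
apply/eqP; apply: free; under eq_bigr => mu _ do rewrite rmorphB mulrBl.
by rewrite big_split /= sumrN -!sumE e subrr.
Qed.
End Characteristic.

Theorem theorem3p1 (F : finFieldType) (n : nat) (gamma : indiff_graph n) :
  let q : algC := #|F|%:R in
  exists f : 'CF([set: GL F n]),
    unique (fun g => g \in cf_uni F n /\
              forall N, p1 g N = mfrac (chromatic_qsym gamma q N)) f /\
    'Ind[[set: GL F n], UTg F gamma] 1 = (q - 1) ^+ n *: f.
Proof.
move=> q; have q1 : (q - 1) ^+ n != 0.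
  rewrite expf_neq0 // subr_eq0 -[1]/(1%:R) Num.Theory.eqr_nat.
  by rewrite gtn_eqF // finRing_gt1.
pose f := ((q - 1) ^+ n)^-1 *: 'Ind[[set: GL F n], UTg F gamma] 1.
have p1f N : p1 f N = mfrac (chromatic_qsym gamma q N).
  have := p1_linear ((q - 1) ^+ n)^-1 ('Ind[[set: GL F n], UTg F gamma] 1) 0 N.
  have -> : p1 (0 : 'CF([set: GL F n])) N = 0.
    by rewrite p1E big1 // => la _; rewrite cfunE rmorph0 !mul0r.
  rewrite !addr0 p1_induced -[fracC N _]/(frac_const N _) fmorphV mulKf //.
  by rewrite fmorph_eq0.
have fU : f \in cf_uni F n by apply/memvZ/induced_cf_uni.
exists f; split; last by rewrite scalerA divff // scale1r.
split=> // g [gU p1g]; apply: p1_inj => //.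
by rewrite p1f p1g.
Qed.
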